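(* Let $n\geq 2$, let $k\in\mathbb{N}\cup\{\infty\}$, and let $\mathcal{M}^n$ be an $n$-dimensional connected and oriented manifold of class $C^k$. Suppose that $\{D_i\}_{i=1}^\ell$ and $\{D'_i\}_{i=1}^\ell$, $D_i,D'_i\subset\mathcal{M}^n$, are two families of $C^k$-closed balls, such that the balls $D_1,\ldots,D_\ell$ are pairwise disjoint and the balls $D'_1,\ldots,D'_\ell$ are pairwise disjoint (a ball $D_i$ is allowed to intersect a ball $D'_j$). If $F_i:D_i\to D'_i$, $i=1,\ldots,\ell$, are surjective orientation preserving $C^k$-diffeomorphisms, then there is a surjective $C^k$-diffeomorphism $F:\mathcal{M}^n\to\mathcal{M}^n$ such that $F|_{D_i}=F_i$ for all $i=1,\ldots,\ell$. Moreover, if $U\subset\mathcal{M}^n$ is a domain such that $D_i\subset U$ and $D'_i\subset U$ for all $i=1,\ldots,\ell$, then $F$ can be chosen to equal the identity outside $U$.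
   Context: $\mathbb{N}$ is the set of positive integers. A domain is an open and connected set. $B^n(x,r)$ is the open Euclidean ball in $\mathbb{R}^n$ and $\mathbb{B}^n=B^n(0,1)$, with closure $\overline{\mathbb{B}}^n$. A diffeomorphism $f:\Omega\to\mathcal{N}^n$ defined on an open subset $\Omega$ of a manifold means a diffeomorphism onto its image $f(\Omega)$. If $A\subset\mathcal{M}^n$ is closed, a $C^k$-diffeomorphism $F:A\to\mathcal{N}^n$ means a mapping that extends to a $C^k$-diffeomorphism (onto its image) on an open neighborhood of $A$. A closed set $D\subset\mathcal{M}^n$ is a $C^k$-closed ball if there is a $C^k$-diffeomorphism $F$ of $\overline{\mathbb{B}}^n$ onto $D$; in other words, there are $\varepsilon>0$ and a $C^k$-diffeomorphism $F:B^n(0,1+\varepsilon)\to\mathcal{M}^n$ (onto its image) such that $F(\overline{B}^n(0,1))=D$. *)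

(* Defs.v *)
From HB Require Import structures.
From mathcomp Require Import all_boot all_order all_algebra.
From mathcomp Require Import all_classical all_reals all_analysis.

Set Implicit Arguments.
Unset Strict Implicit.
Unset Printing Implicit Defensive.

Import Order.TTheory GRing.Theory Num.Theory.
Import numFieldNormedType.Exports.

Local Open Scope classical_set_scope.
Local Open Scope ring_scope.

(* The topology and differentials of ['rV[R]_n] in the library come from the
   sup norm, which is equivalent to the Euclidean norm; the round balls below
   are genuinely Euclidean. *)
Definition enorm {R : realType} {n : nat} (x : 'rV[R]_n) : R :=
  Num.sqrt (\sum_(i < n) x ord0 i ^+ 2).

Definition eball {R : realType} {n : nat} (c : 'rV[R]_n) (r : R) :
    set 'rV[R]_n :=
  [set x | enorm (x - c) < r].

Definition closed_eball {R : realType} {n : nat} (c : 'rV[R]_n) (r : R) :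
    set 'rV[R]_n :=
  [set x | enorm (x - c) <= r].

Variant smoothness := Cfin of nat | Cinfty.

(* Meaningful for open [U]: the values of [f] outside [U] are then irrelevant,
   because continuity and differentiability at a point of [U] are local. *)
Fixpoint Cfin_on {R : realType} {n m : nat} (j : nat) (U : set 'rV[R]_n)
    (f : 'rV[R]_n -> 'rV[R]_m) : Prop :=
  match j with
  | 0 => forall x, U x -> {for x, continuous f}
  | j'.+1 => (forall x, U x -> differentiable f x) /\
             (forall v : 'rV[R]_n, Cfin_on j' U ('D_v f))
  end.

Definition C_on {R : realType} {n m : nat} (k : smoothness)
    (U : set 'rV[R]_n) (f : 'rV[R]_n -> 'rV[R]_m) : Prop :=
  match k with
  | Cfin j => Cfin_on j U f
  | Cinfty => forall j, Cfin_on j U f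
  end.

(* A homeomorphism between an open subset of [M] and an open subset of R^n.
   Both directions are total functions, with junk values outside [chart_dom]
   and outside [chart_map @` chart_dom] respectively. *)
Record chart (R : realType) (n : nat) (M : topologicalType) := Chart {
  chart_dom : set M;
  chart_map : M -> 'rV[R]_n;
  chart_inv : 'rV[R]_n -> M;
  chart_dom_open : open chart_dom;
  chart_img_open : open (chart_map @` chart_dom);
  chart_mapK : {in chart_dom, cancel chart_map chart_inv};
  chart_map_continuous :
    forall x, chart_dom x -> {for x, continuous chart_map};
  chart_inv_continuous :
    forall y, (chart_map @` chart_dom) y -> {for y, continuous chart_inv}
}.

Definition in_charts {R : realType} {n : nat} {M N : topologicalType}
    (phi : chart R n M) (psi : chart R n N) (f : M -> N) :
    'rV[R]_n -> 'rV[R]_n :=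
  chart_map psi \o f \o chart_inv phi.

(* [A] and [B] are atlases and [Om] is open. *)
Definition C_map {R : realType} {n : nat} {M N : topologicalType}
    (k : smoothness) (A : set (chart R n M)) (B : set (chart R n N))
    (Om : set M) (f : M -> N) : Prop :=
  (forall x, Om x -> {for x, continuous f}) /\
  (forall phi psi, A phi -> B psi ->
    C_on k
      (chart_map phi @` (chart_dom phi `&` Om `&` f @^-1` chart_dom psi))
      (in_charts phi psi f)).

(* When [A] and [B] are oriented atlases and [f] is differentiable near [S],
   the sign of the Jacobian determinant does not depend on the charts. *)
Definition orientation_preserving {R : realType} {n : nat}
    {M N : topologicalType} (A : set (chart R n M)) (B : set (chart R n N))
    (S : set M) (f : M -> N) : Prop :=
  forall phi psi, A phi -> B psi ->
  forall x, S x -> chart_dom phi x -> chart_dom psi (f x) ->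
    0 < \det ('J (in_charts phi psi f) (chart_map phi x)).

(* The orientation is the one given by the atlas: transition maps are required
   to have positive Jacobian determinant. *)
Record is_oriented_manifold {R : realType} {n : nat} {M : topologicalType}
    (k : smoothness) (A : set (chart R n M)) : Prop := OrientedManifold {
  manifold_hausdorff : hausdorff_space M;
  manifold_second_countable : @second_countable M;
  atlas_cover : forall x, exists2 phi, A phi & chart_dom phi x;
  atlas_smooth : forall phi psi, A phi -> A psi ->
    C_on k (chart_map phi @` (chart_dom phi `&` chart_dom psi))
      (in_charts phi psi id);
  atlas_oriented : orientation_preserving A A setT id
}.

(* C^k-diffeomorphism of the open set [Om] onto its image. *)
Definition C_diffeo {R : realType} {n : nat} {M N : topologicalType}
    (k : smoothness) (A : set (chart R n M)) (B : set (chart R n N))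
    (Om : set M) (f : M -> N) : Prop :=
  [/\ open Om, open (f @` Om), C_map k A B Om f &
    exists2 g : N -> M, {in Om, cancel f g} & C_map k B A (f @` Om) g].

(* [f] restricted to the closed set [S] is an orientation preserving
   C^k-diffeomorphism: it extends to a C^k-diffeomorphism [G] of an open
   neighbourhood of [S]. Only the values of [f] on [S] matter. *)
Definition op_C_diffeo_closed {R : realType} {n : nat} {M N : topologicalType}
    (k : smoothness) (A : set (chart R n M)) (B : set (chart R n N))
    (S : set M) (f : M -> N) : Prop :=
  exists V : set M, exists G : M -> N,
    [/\ S `<=` V, C_diffeo k A B V G, {in S, f =1 G} &
        orientation_preserving A B S G].

Section euclidean_atlas.
Variables (R : realType) (n : nat).

Fact id_chart_img_open : open (@id 'rV[R]_n @` setT).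
Proof. by rewrite image_id; exact: openT. Qed.

Definition id_chart : chart R n 'rV[R]_n :=
  @Chart R n 'rV[R]_n setT id id openT id_chart_img_open
    (fun _ _ => erefl) (fun _ _ => cvg_id) (fun _ _ => cvg_id).

Definition euclidean_atlas : set (chart R n 'rV[R]_n) := [set id_chart].

End euclidean_atlas.

Definition C_closed_ball {R : realType} {n : nat} {M : topologicalType}
    (k : smoothness) (A : set (chart R n M)) (D : set M) : Prop :=
  closed D /\
  exists e : R, exists F : 'rV[R]_n -> M,
    [/\ 0 < e, C_diffeo k (@euclidean_atlas R n) A (eball 0 (1 + e)) F &
        F @` closed_eball 0 1 = D].

(* Main.v *)
From HB Require Import structures.
Require Import Defs.
From mathcomp Require Import all_boot all_order all_algebra.
From mathcomp Require Import all_classical all_reals all_analysis.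
From mathcomp Require Import ring lra.
Set Implicit Arguments.
Unset Strict Implicit.
Unset Printing Implicit Defensive.
Import Order.TTheory GRing.Theory Num.Theory.
Import numFieldNormedType.Exports.
Local Open Scope classical_set_scope.
Local Open Scope ring_scope.

(* Any two C^k charts of balls that induce the same orientation are carried into
   each other by a diffeomorphism supported in [U].  Such a diffeomorphism is a
   product of maps which, read in a chart, are x |-> x + w(x) with w compactly
   supported and |Dw| <= 1/2; these are invertible by the contraction principle.
   With w = (cut-off) * (linear or constant) one translates, shrinks balls and
   realises every matrix close to 1, hence all of GL_n^+; with
   w = (cut-off at scale d) * (f - Df(0)) one linearises a germ f.  So two germs
   of embeddings at points of one chart ball, of equal orientation, are
   equivalent, and by connectedness the same holds in all of [U].  Shrinking both
   balls into the region where the germs agree, moving, and expanding back settles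
   one ball.  Several balls are treated one at a time in the complement of those
   already placed, which stays connected because a ball is surrounded by a
   connected shell (this is where n >= 2 enters).  No flows are used, so that no
   derivative is lost and k = 1 is allowed. *)

(** * Functions of class C^j *)

(** Each elementary move is the identity outside a compact part of an open chart image. With
    Hausdorffness, this compactness is what makes its extension by the identity smooth. The bound
    1/2 on |Dw| means that x + w(x) shrinks no distance by more than a factor 2; bijectivity,
    regularity of the inverse and positivity of the Jacobian all rest on it. A given field meets the
    bound only after multiplication by a small number, so a long move is a finite product of small
    ones. Orientation is carried along as a sign instead of being normalised: D_i is parametrised by
    some f_i of sign s_i = 1 or -1, and g_i := F_i o f_i, with F_i extended to a neighbourhood, has
    the same sign. Matching f_i with g_i pointwise on the unit ball prescribes the values F_i on
    D_i, not merely the image. That D_i may meet D'_j does no harm: at each stage one removes the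
    targets already occupied, and the earlier moves, being injective, have carried the ball still to
    be treated away from them. *)

Lemma near_eq_differentiable (R : realType) (V W : normedModType R) (f g : V -> W) (x : V) :
  (\forall y \near x, f y = g y) -> differentiable f x -> differentiable g x.
Proof.
move=> fg df.
(* [g - f] vanishes near [x], so its expansion there is [o(id)] with zero differential. *)
have Ez : g = f + (g - f) by apply/funext => y /=; rewrite !fctE addrC subrK.
rewrite Ez; apply: differentiableD => //.
have hz : (g - f) \o shift x = cst ((g - f) x) + (\0 : V -> W) +o_ 0 id.
  apply/eqaddoE; rewrite funeqE => y /=.
  rewrite !fctE (nbhs_singleton fg) subrr add0r add0r.
  set h := (fun y => g (y + x) - f (y + x)).
  rewrite -[LHS]/(h y).
  suff -> : h = [o_ (0:V) id of h] by [].
  rewrite littleoE //.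
  move=> e e0; near=> z.
  rewrite /h /=.
  have -> : g (z + x) = f (z + x).
    near: z. 
    move: fg; rewrite (near_shift (0:V)) subr0 /=; apply: filterS => z -> //.
  by rewrite subrr normr0 mulr_ge0 // ltW.
apply/diff_locallyP.
have c0 : continuous (\0 : V -> W) by move=> ?; exact: cst_continuous.
rewrite (@diff_unique _ _ _ (g-f) \0 x c0 hz). split => //.
Unshelve. all: by end_near. 
Qed.

Lemma near_eq_continuous_at (T T' : topologicalType) (f g : T -> T') (x : T) :
  (\forall y \near x, f y = g y) -> {for x, continuous f} -> {for x, continuous g}.
Proof.
move=> fg; rewrite /prop_for /continuous_at -(nbhs_singleton fg); apply: cvg_trans.
exact: (near_eq_cvg fg).
Qed.

Section Creal.
Variables (R : realType) (n : nat).
Implicit Types (f g : 'rV[R]_n -> R) (U : set 'rV[R]_n).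

(* Scalar analogue of [Cfin_on]; [Cfin_onP] reduces vector-valued maps to it. *)
Fixpoint CR (j : nat) U f : Prop :=
  match j with
  | 0 => forall x, U x -> {for x, continuous f}
  | j'.+1 => (forall x, U x -> differentiable f x) /\
             (forall v : 'rV[R]_n, CR j' U ('D_v f))
  end.

(** On an open set, agreement on [U] is agreement near each point of [U], hence passes to all
    iterated derivatives. *)
Lemma CR_ext j U f g : open U -> (forall x, U x -> f x = g x) -> CR j U f -> CR j U g.
Proof.
move=> oU; elim: j f g => [|j IH] f g fg /=.
  move=> cf x Ux; have nU : nbhs x U by apply: open_nbhs_nbhs.
  by apply: near_eq_continuous_at (cf x Ux); apply: filterS nU => y; exact: fg.
have nfg x : U x -> \forall y \near x, f y = g y.
  move=> Ux; have nU : nbhs x U by apply: open_nbhs_nbhs.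
  by apply: filterS nU => y; exact: fg.
move=> [df Df]; split=> [x Ux|v].
  by apply: near_eq_differentiable (df x Ux); exact: nfg.
apply: IH (Df v) => x Ux; apply: near_eq_derive; exact: nfg.
Qed.

(** Every clause of [CR] concerns one point at a time, which yields restriction and locality for
    arbitrary sets. *)
Lemma CR_pt j U f : CR j U f <-> forall x, U x -> CR j [set x] f.
Proof.
elim: j f => [|j IH] f /=.
  split=> [h x Ux y ->|h x Ux]; first exact: h.
  exact: (h x Ux).
split=> [[h1 h2] x Ux|h].
  split=> [y ->|v]; first exact: h1.
  have := h2 v; rewrite IH; exact.
split=> [x Ux|v]; first by case: (h x Ux) => h1 _; exact: h1.
by rewrite IH => x Ux; case: (h x Ux) => _; exact.
Qed.

Lemma CR_sub j U U' f : U `<=` U' -> CR j U' f -> CR j U f.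
Proof. by move=> sU /CR_pt h; apply/CR_pt => x /sU; exact: h. Qed.

Lemma CR_loc j U f :
  (forall x, U x -> exists2 W : set 'rV[R]_n, W x & CR j W f) -> CR j U f.
Proof.
move=> h; apply/CR_pt => x Ux; have [W Wx hW] := h x Ux.
by apply: CR_sub hW => y ->.
Qed.

Lemma CR_continuous j U f : CR j U f -> forall x, U x -> {for x, continuous f}.
Proof.
case: j => [|j] //= [df _] x Ux; exact/differentiable_continuous/df.
Qed.

Lemma CRS j U f : CR j.+1 U f -> CR j U f.
Proof.
elim: j f => [|j IH] f; first exact: CR_continuous.
by move=> [df Df]; split => // v; apply: IH; apply: Df.
Qed.

Lemma CR_cst j U (a : R) : CR j U (cst a).
Proof.
elim: j a => [|j IH] a /=; first by move=> x _; exact: cst_continuous.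
split=> [x _|v]; first exact: differentiable_cst.
have -> : 'D_v (cst a) = cst 0 :> (_ -> R) by apply/funext => x; rewrite derive_cst.
exact: IH.
Qed.

Lemma CR_add j U f g : open U -> CR j U f -> CR j U g -> CR j U (fun x => f x + g x).
Proof.
move=> oU; elim: j f g => [|j IH] f g.
  by move=> cf cg x Ux; apply: continuousD; [exact: cf|exact: cg].
move=> [df Df] [dg Dg]; split=> [x Ux|v].
  by apply: (@differentiableD _ _ _ f g); [exact: df|exact: dg].
apply: (CR_ext (f := fun x => 'D_v f x + 'D_v g x)) => //; last exact: IH (Df v) (Dg v).
move=> x Ux; rewrite (@deriveD _ _ _ f g) //; apply: diff_derivable; [exact: df|exact: dg].
Qed.

Lemma CR_mul j U f g : open U -> CR j U f -> CR j U g -> CR j U (fun x => f x * g x).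
Proof.
move=> oU; elim: j f g => [|j IH] f g.
  by move=> cf cg x Ux; apply: continuousM; [exact: cf|exact: cg].
(* In the Leibniz rule the underived factors are needed at level [j] as well. *)
move=> hf hg; have hf' := CRS hf; have hg' := CRS hg; move: hf hg.
move=> [df Df] [dg Dg]; split=> [x Ux|v].
  by apply: (@differentiableM _ _ f g); [exact: df|exact: dg].
apply: (CR_ext (f := fun x => f x * 'D_v g x + g x * 'D_v f x)) => //; last first.
  by apply: CR_add => //; apply: IH => //; [exact: Dg|exact: Df].
move=> x Ux; rewrite (@deriveM _ _ f g) //; apply: diff_derivable; [exact: df|exact: dg].
Qed.

Lemma CR_opp j U f : open U -> CR j U f -> CR j U (fun x => - f x).
Proof.
move=> oU hf; apply: (CR_ext (f := fun x => (-1) * f x)) => //.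
  by move=> x _; rewrite mulN1r.
by apply: CR_mul => //; exact: CR_cst.
Qed.

(** The derivative of [1/f] is [-(1/f)^2 D f], where [1/f] recurs one level lower. *)
Lemma CR_inv j U f : open U -> (forall x, U x -> f x != 0) -> CR j U f ->
  CR j U (fun x => (f x)^-1).
Proof.
move=> oU f0; elim: j => [|j IH].
  by move=> cf x Ux; apply: continuousV; [exact: f0|exact: cf].
move=> hf; have hf' := CRS hf; move: hf => [df Df]; split=> [x Ux|v].
  by apply: (@differentiableV _ _ f); [exact: df|exact: f0].
apply: (CR_ext (f := fun x => - ((f x)^-1 * (f x)^-1 * 'D_v f x))) => //; last first.
  apply: CR_opp => //; apply: CR_mul => //; last exact: Df.
  by apply: CR_mul => //; exact: IH.
move=> x Ux; rewrite (@deriveV _ _ f) //; [|exact: f0|apply: diff_derivable; exact: df].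
by rewrite scaleNr -exprVn expr2.
Qed.

Lemma CR_sum j U (I : Type) (r : seq I) (P : pred I) (F : I -> 'rV[R]_n -> R) : open U ->
  (forall i, CR j U (F i)) -> CR j U (fun x => \sum_(i <- r | P i) F i x).
Proof.
move=> oU hF; elim: r => [|i r IH].
  apply: (CR_ext (f := cst 0)) => //; first by move=> x _; rewrite big_nil.
  exact: CR_cst.
case Pi : (P i).
  apply: (CR_ext (f := fun x => F i x + \sum_(i <- r | P i) F i x)) => //.
    by move=> x _; rewrite big_cons Pi.
  exact: CR_add.
by apply: CR_ext IH => // x _; rewrite big_cons Pi.
Qed.

Lemma CR_prod j U (I : Type) (r : seq I) (P : pred I) (F : I -> 'rV[R]_n -> R) : open U ->
  (forall i, CR j U (F i)) -> CR j U (fun x => \prod_(i <- r | P i) F i x).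
Proof.
move=> oU hF; elim: r => [|i r IH].
  apply: (CR_ext (f := cst 1)) => //; first by move=> x _; rewrite big_nil.
  exact: CR_cst.
case Pi : (P i).
  apply: (CR_ext (f := fun x => F i x * \prod_(i <- r | P i) F i x)) => //.
    by move=> x _; rewrite big_cons Pi.
  exact: CR_mul.
by apply: CR_ext IH => // x _; rewrite big_cons Pi.
Qed.

Lemma CR_lin j U (f : {linear 'rV[R]_n -> R}) : continuous f -> CR j U f.
Proof.
move=> cf; case: j => [|j]; first by move=> x _; exact: cf.
split=> [x _|v]; first exact: linear_differentiable.
have -> : 'D_v f = cst (f v) :> (_ -> _).
  by apply/funext => x; rewrite deriveE ?diff_lin //; exact: linear_differentiable.
exact: CR_cst.
Qed.

Lemma CR_coord j U (i : 'I_n) : CR j U (fun x => x ord0 i).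
Proof.
have @f : {linear 'rV[R]_n -> R}.
  by exists (fun N : 'rV[R]_n => N ord0 i); do 2![eexists]; do ?[constructor];
     rewrite ?mxE// => ? *; rewrite ?mxE//; move=> ?; rewrite !mxE.
have -> : (fun x : 'rV[R]_n => x ord0 i) = f by [].
by apply: CR_lin; exact: coord_continuous.
Qed.
End Creal.

Section CRvec.
Variables (R : realType).

Lemma continuous_at_row (T : topologicalType) m (f : T -> 'rV[R]_m) x :
  {for x, continuous f} <-> forall i, {for x, continuous (fun y => f y ord0 i)}.
Proof.
split=> [cf i|cf].
  apply: (@continuous_comp _ _ _ f (fun M : 'rV[R]_m => M ord0 i)) => //.
  exact: coord_continuous.
move=> A [P Pn PA]; rewrite /= nbhs_filterE.
have : \forall y \near x, forall i, P ord0 i (f y ord0 i).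
  apply: filter_forall => i; exact: (cf i _ (Pn ord0 i)).
apply: filterS => y Py; apply: PA => i j; rewrite (ord1 i); exact: Py.
Qed.

Lemma differentiable_row (V : normedModType R) m (f : V -> 'rV[R]_m) x :
  differentiable f x <-> forall i, differentiable (fun y => f y ord0 i) x.
Proof.
split=> [cf i|cf].
  apply: (@differentiable_comp _ _ _ _ f (fun M : 'rV[R]_m => M ord0 i)) => //.
  exact: differentiable_coord.
have -> : f = \sum_(i < m) (fun y => f y ord0 i *: delta_mx ord0 i).
  by apply/funext => y; rewrite fct_sumE -row_sum_delta.
by apply: differentiable_sum => i; apply: differentiableZl.
Qed.

Lemma derive_row (V : normedModType R) m (f : V -> 'rV[R]_m) x v i :
  differentiable f x -> 'D_v f x ord0 i = 'D_v (fun y => f y ord0 i) x.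
Proof. by move=> df; rewrite derive_mx ?mxE //; exact: diff_derivable. Qed.

Variable n : nat.
Implicit Types (U : set 'rV[R]_n).

Lemma Cfin_onP m j U (f : 'rV[R]_n -> 'rV[R]_m) : open U ->
  Cfin_on j U f <-> forall i, CR j U (fun x => f x ord0 i).
Proof.
move=> oU; elim: j f => [|j IH] f /=.
  split=> [cf i x Ux|cf x Ux]; first by move: i; apply/continuous_at_row; exact: cf.
  by apply/continuous_at_row => i; exact: cf.
split=> [[df Df] i|h].
  split=> [x Ux|v]; first by move: i; apply/differentiable_row; exact: df.
  have /IH /(_ i) := Df v; apply: CR_ext => // x Ux.
  by rewrite derive_row //; exact: df.
have df x : U x -> differentiable f x.
  by move=> Ux; apply/differentiable_row => i; case: (h i) => + _; exact.
split=> // v; apply/IH => i; case: (h i) => _ /(_ v).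
by apply: CR_ext => // x Ux; rewrite derive_row //; exact: df.
Qed.

Lemma CR_le i j U (f : 'rV[R]_n -> R) : (i <= j)%N -> CR j U f -> CR i U f.
Proof.
move=> ij; rewrite -(subnK ij); elim: (j - i)%N => // k IH /CRS; exact: IH.
Qed.

Lemma diff_row_sum (V : normedModType R) m (f : 'rV[R]_m -> V) x v :
  'd f x v = \sum_(i < m) v ord0 i *: 'd f x (delta_mx ord0 i).
Proof.
rewrite {1}(row_sum_delta v) linear_sum; apply: eq_bigr => i _; exact: linearZ.
Qed.

Lemma derive_row_sum (V : normedModType R) m (f : 'rV[R]_m -> V) x v : differentiable f x ->
  'D_v f x = \sum_(i < m) v ord0 i *: 'D_(delta_mx ord0 i) f x.
Proof.
move=> df; rewrite deriveE // diff_row_sum; apply: eq_bigr => i _; by rewrite deriveE.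
Qed.

Lemma derive_comp_row m (g : 'rV[R]_m -> R) (f : 'rV[R]_n -> 'rV[R]_m) x v :
  differentiable f x -> differentiable g (f x) ->
  'D_v (g \o f) x =
  \sum_(i < m) 'D_v (fun y => f y ord0 i) x * 'D_(delta_mx ord0 i) g (f x).
Proof.
move=> df dg; rewrite deriveE; last exact: differentiable_comp.
rewrite diff_comp //= -deriveE // derive_row_sum //.
by apply: eq_bigr => i _; rewrite -derive_row // (deriveE _ df).
Qed.

(** The chain rule turns [D_v (g o f)] into a sum of products of [D_v f_i] with [(D_i g) o f]; the
    induction therefore generalises over [g]. *)
Lemma CR_comp m j U (V : set 'rV[R]_m) (g : 'rV[R]_m -> R) (f : 'rV[R]_n -> 'rV[R]_m) :
  open U -> open V -> (forall x, U x -> V (f x)) ->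
  (forall i, CR j U (fun x => f x ord0 i)) -> CR j V g -> CR j U (g \o f).
Proof.
move=> oU oV fV; elim: j g => [|j IH] g hf hg.
  move=> x Ux; apply: continuous_comp; last by apply: hg; exact: fV.
  by apply/continuous_at_row => i; exact: hf.
have hf' i := CRS (hf i).
have df x : U x -> differentiable f x.
  by move=> Ux; apply/differentiable_row => i; case: (hf i) => + _; exact.
move: hg => [dg Dg]; split=> [x Ux|v].
  by apply: differentiable_comp; [exact: df|exact/dg/fV].
apply: (CR_ext (f := fun x =>
  \sum_(i < m) 'D_v (fun y => f y ord0 i) x * (('D_(delta_mx ord0 i) g) \o f) x)) => //.
  by move=> x Ux; rewrite derive_comp_row //; [exact: df|exact/dg/fV].
apply: CR_sum => // i; apply: CR_mul => //; last by apply: IH => //; exact: Dg.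
by case: (hf i) => _; exact.
Qed.

Lemma CR_det p j U (A : 'rV[R]_n -> 'M[R]_p) : open U ->
  (forall i k, CR j U (fun x => A x i k)) -> CR j U (fun x => \det (A x)).
Proof.
move=> oU hA; rewrite /determinant; apply: CR_sum => // s.
by apply: CR_mul => //; [exact: CR_cst|apply: CR_prod => // i].
Qed.

(** Cramer's rule: the entries of the inverse are cofactors divided by the determinant. *)
Lemma CR_invmx p j U (A : 'rV[R]_n -> 'M[R]_p) i k : open U ->
  (forall x, U x -> A x \in unitmx) ->
  (forall i k, CR j U (fun x => A x i k)) -> CR j U (fun x => invmx (A x) i k).
Proof.
move=> oU Au hA.
apply: (CR_ext (f := fun x =>
  (\det (A x))^-1 * ((-1) ^+ (k + i) * \det (row' k (col' i (A x)))))) => //.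
  by move=> x Ux; rewrite /invmx Au // !mxE.
apply: CR_mul => //.
  by apply: CR_inv => // [x Ux|]; [rewrite -unitfE -unitmxE; exact: Au|exact: CR_det].
apply: CR_mul => //; first exact: CR_cst.
apply: CR_det => // i' k';
  apply: (CR_ext (f := fun x => A x (lift k i') (lift i k'))) => //.
by move=> x _; rewrite !mxE.
Qed.
End CRvec.

(* [C_on k] means [CR j] of all coordinates for every [j] with [jle j k]. *)
Definition jle (j : nat) (k : smoothness) : bool :=
  match k with Cfin m => (j <= m)%N | Cinfty => true end.

Section Con.
Variable (R : realType).

Lemma C_onP n m k U (f : 'rV[R]_n -> 'rV[R]_m) : open U ->
  C_on k U f <-> forall j, jle j k -> forall i, CR j U (fun x => f x ord0 i).
Proof.
move=> oU; case: k => [k|] /=.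
  split=> [/(Cfin_onP _ _ oU) h j jk i|h]; first exact: CR_le jk (h i).
  by apply/Cfin_onP => // i; exact: h.
split=> [h j _|h j]; first by apply/Cfin_onP.
by apply/Cfin_onP => //; exact: h.
Qed.

Lemma C_on_ext n m k U (f g : 'rV[R]_n -> 'rV[R]_m) : open U ->
  (forall x, U x -> f x = g x) -> C_on k U f -> C_on k U g.
Proof.
move=> oU fg /(C_onP _ _ oU) h; apply/C_onP => // j jk i.
by apply: CR_ext (h j jk i) => // x Ux; rewrite fg.
Qed.

Lemma C_on_sub n m k U V (f : 'rV[R]_n -> 'rV[R]_m) : open U -> open V ->
  U `<=` V -> C_on k V f -> C_on k U f.
Proof.
move=> oU oV UV /(C_onP _ _ oV) h; apply/C_onP => // j jk i.
exact: CR_sub (h j jk i).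
Qed.

Lemma C_on_loc n m k U (f : 'rV[R]_n -> 'rV[R]_m) : open U ->
  (forall x, U x -> exists W : set 'rV[R]_n, [/\ open W, W x & C_on k W f]) -> C_on k U f.
Proof.
move=> oU h; apply/C_onP => // j jk i; apply: CR_loc => x Ux.
have [W [oW Wx /(C_onP _ _ oW) hW]] := h x Ux; exists W => //; exact: hW.
Qed.

Lemma C_on_comp n m p k U V (f : 'rV[R]_n -> 'rV[R]_m) (g : 'rV[R]_m -> 'rV[R]_p) :
  open U -> open V -> (forall x, U x -> V (f x)) ->
  C_on k U f -> C_on k V g -> C_on k U (g \o f).
Proof.
move=> oU oV fV /(C_onP _ _ oU) hf /(C_onP _ _ oV) hg; apply/C_onP => // j jk i.
by apply: (CR_comp oU oV fV (hf j jk) (hg j jk i)).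
Qed.

Lemma C_on_id n k U : open U -> C_on k U (id : 'rV[R]_n -> 'rV[R]_n).
Proof. by move=> oU; apply/C_onP => // j jk i; exact: CR_coord. Qed.

Lemma C_on_add n m k U (f g : 'rV[R]_n -> 'rV[R]_m) : open U ->
  C_on k U f -> C_on k U g -> C_on k U (fun x => f x + g x).
Proof.
move=> oU /(C_onP _ _ oU) hf /(C_onP _ _ oU) hg; apply/C_onP => // j jk i.
apply: (CR_ext (f := fun x => f x ord0 i + g x ord0 i)) => //.
  by move=> x _; rewrite mxE.
by apply: CR_add; [|exact: hf|exact: hg].
Qed.

Lemma C_on_scale n m k U (a : 'rV[R]_n -> R) (f : 'rV[R]_n -> 'rV[R]_m) : open U ->
  (forall j, CR j U a) -> C_on k U f -> C_on k U (fun x => a x *: f x).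
Proof.
move=> oU ha /(C_onP _ _ oU) hf; apply/C_onP => // j jk i.
apply: (CR_ext (f := fun x => a x * f x ord0 i)) => //.
  by move=> x _; rewrite mxE.
by apply: CR_mul; [|exact: ha|exact: hf].
Qed.

Lemma C_on_cst n m k U (a : 'rV[R]_m) : open U -> C_on k U (cst a : 'rV[R]_n -> _).
Proof. by move=> oU; apply/C_onP => // j jk i; exact: CR_cst. Qed.

Lemma C_on_mulmx n m k U (M : 'M[R]_(n, m)) : open U ->
  C_on k U (mulmx^~ M : 'rV[R]_n -> 'rV[R]_m).
Proof.
move=> oU; apply/C_onP => // j jk i.
apply: (CR_ext (f := fun x => \sum_l x ord0 l * M l i)) => //.
  by move=> x _; rewrite mxE.
by apply: CR_sum => // l; apply: CR_mul => //; [exact: CR_coord|exact: CR_cst].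
Qed.

Lemma C_on_continuous n m k U (f : 'rV[R]_n -> 'rV[R]_m) : open U -> C_on k U f ->
  forall x, U x -> {for x, continuous f}.
Proof.
move=> oU /(C_onP _ _ oU) h x Ux; apply/continuous_at_row => i.
by apply: CR_continuous (h 0%N _ i) _ Ux; case: k {h}.
Qed.

Lemma jle1 k : k <> Cfin 0 -> jle 1 k.
Proof. by case: k => [[|k]|]. Qed.

Lemma C_on_differentiable n m k U (f : 'rV[R]_n -> 'rV[R]_m) : k <> Cfin 0 -> open U ->
  C_on k U f ->
  forall x, U x -> differentiable f x.
Proof.
move=> k0 oU /(C_onP _ _ oU) h x Ux; apply/differentiable_row => i.
by have [+ _] := h 1%N (jle1 k0) i; exact.
Qed.

Lemma C_on_derive n m k U (f : 'rV[R]_n -> 'rV[R]_m) v i : k <> Cfin 0 -> open U ->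
  C_on k U f ->
  forall x, U x -> {for x, continuous (fun x => 'D_v f x ord0 i)}.
Proof.
move=> k0 oU hf x Ux; have df := C_on_differentiable k0 oU hf.
move: hf => /(C_onP _ _ oU) h.
have [_ /(_ v) /= ch] := h 1%N (jle1 k0) i.
apply: near_eq_continuous_at (ch x Ux).
have : nbhs x U by exact: open_nbhs_nbhs.
by apply: filterS => y Uy; rewrite derive_row //; exact: df.
Qed.

Lemma jacobianE n m (f : 'rV[R]_n -> 'rV[R]_m) x l i : differentiable f x ->
  'J f x l i = 'D_(delta_mx ord0 l) f x ord0 i.
Proof. by move=> df; rewrite deriveEjacobian // -rowE [RHS]mxE. Qed.

Lemma continuous_mulmxr n m (M : 'M[R]_(n, m)) : continuous (mulmxr M : 'rV[R]_n ->
  'rV[R]_m).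
Proof.
move=> x; apply: (C_on_continuous (k := Cinfty) openT) => //; exact: C_on_mulmx openT.
Qed.

Lemma differentiable_approx (V W : normedModType R) (f : V -> W) x : differentiable f x ->
  forall e, 0 < e -> \forall k \near (0 : V), `|f (k + x) - f x - 'd f x k| <= e * `|k|.
Proof.
move=> df e e0; have /diff_locallyP [_ h] := df.
move/eqaddoP: h => /(_ e e0); apply: filterS => k.
by rewrite !fctE /= opprD addrA.
Qed.

Lemma approx_differentiable (V W : normedModType R) (f : V -> W) (df : {linear V -> W}) x :
  continuous df ->
  (forall e, 0 < e -> \forall k \near (0 : V), `|f (k + x) - f x - df k| <= e * `|k|) ->
  differentiable f x /\ 'd f x = df :> (V -> W).
Proof.
move=> cdf h.
have hz : f \o shift x = cst (f x) + (df : V -> W) +o_ 0 id.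
  apply/eqaddoP => e e0; apply: filterS (h e e0) => k.
  by rewrite !fctE /= opprD addrA.
have E := diff_unique cdf hz.
split => //; apply/diff_locallyP; rewrite E; split => //.
Qed.

Lemma near0_norm (V : normedModType R) (P : V -> Prop) :
  (\forall k \near (0 : V), P k) <-> exists2 d : R, 0 < d & forall k, `|k| < d -> P k.
Proof.
split=> [/nbhs_ballP [d d0 h]|[d d0 h]].
  by exists d => // k kd; apply: h; rewrite -ball_normE /= sub0r normrN.
apply/nbhs_ballP; exists d => // k; rewrite -ball_normE /= sub0r normrN; exact: h.
Qed.

Lemma mulmx_bounded n m (M : 'M[R]_(n, m)) :
  exists2 C : R, 0 < C & forall v : 'rV[R]_n, `|v *m M| <= C * `|v|.
Proof.
have [C C0 h] := linear_lipschitz (@continuous_mulmxr n m M).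
by exists C => // v; exact: h.
Qed.

(** The second hypothesis makes [g] 2-Lipschitz, so an error that is small against the increment of
    [g] is small against [k]. *)
Lemma inverse_differentiable n (h g : 'rV[R]_n -> 'rV[R]_n) y : cancel g h ->
  (forall x x', `|x - x'| <= 2 * `|h x - h x'|) ->
  differentiable h (g y) -> 'J h (g y) \in unitmx ->
  differentiable g y /\ 'd g y = mulmxr (invmx ('J h (g y))) :> (_ -> _).
Proof.
move=> gK hlip dh Ju; set M := invmx _; set x := g y.
have [C C0 hC] := mulmx_bounded M.
apply: (approx_differentiable (@continuous_mulmxr n n M)) => e e0.
(* The 2 pays for the Lipschitz constant of [g], and [C] for the norm of the inverse Jacobian. *)
have e'0 : 0 < e / (2 * C) by rewrite divr_gt0 // mulr_gt0.
have /near0_norm [d d0 hd] := differentiable_approx dh e'0.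
apply/near0_norm; exists (d / 2) => [|k kd]; first by rewrite divr_gt0.
set s := g (k + y) - x.
have s2 : `|s| <= 2 * `|k| by rewrite (le_trans (hlip _ _)) // !gK addrK.
have /hd : `|s| < d by rewrite (le_lt_trans s2) // mulrC -ltr_pdivlMr.
rewrite /s subrK !gK addrK => H.
(* Up to sign, the remainder of [g] is the remainder of [h] at the increment [s], multiplied by the
   inverse Jacobian. *)
have -> : g (k + y) - g y - mulmxr M k = - ((k - 'd h x s) *m M).
  rewrite mulmxBl opprB /= /s; congr (_ - _).
  by rewrite -deriveE // deriveEjacobian // mulmxK.
rewrite normrN (le_trans (hC _)) // -ler_pdivlMl // (le_trans H) //.
have -> : C^-1 * (e * `|k|) = e / (2 * C) * (2 * `|k|).
  by field; rewrite gt_eqF.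
by rewrite ler_wpM2l // ltW.
Qed.

(* Bootstrap: 'J g = (invmx 'J h) \o g is as smooth as g. *)
Lemma inverse_CR n j (h g : 'rV[R]_n -> 'rV[R]_n) : cancel g h ->
  (forall x x', `|x - x'| <= 2 * `|h x - h x'|) ->
  (forall x, 'J h x \in unitmx) ->
  (forall i, CR j.+1 setT (fun x => h x ord0 i)) ->
  forall i, CR j.+1 setT (fun x => g x ord0 i).
Proof.
move=> gK hlip Ju hC.
have dh x : differentiable h x.
  by apply/differentiable_row => i; case: (hC i) => + _; apply.
have dg y : differentiable g y /\ 'd g y = mulmxr (invmx ('J h (g y))) :> (_ -> _).
  exact: inverse_differentiable.
have step m : (forall i, CR m.+1 setT (fun x => h x ord0 i)) ->
    (forall i, CR m setT (fun x => g x ord0 i)) ->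
    forall i, CR m.+1 setT (fun x => g x ord0 i).
  move=> hm cg i; split=> [x _|v]; first by move: i; apply/differentiable_row; case: (dg x).
  apply: (CR_ext (f := fun x => \sum_l v ord0 l * invmx ('J h (g x)) l i) openT) => [x _|].
    by case: (dg x) => dgx Dgx; rewrite -derive_row // deriveE // Dgx mxE //.
  apply: (CR_sum _ _ openT) => l; apply: (CR_mul openT); first exact: CR_cst.
  apply: CR_invmx => [|x _|a b]; [exact: openT|exact: Ju|].
  apply: (@CR_comp _ _ _ _ setT setT (fun x => 'J h x a b) g openT openT) => //.
  case: (hm b) => _ /(_ (delta_mx ord0 a)); apply: (CR_ext openT) => x _.
  by rewrite jacobianE // derive_row.
elim: j hC => [|j IH] hC; apply: step => //.
  move=> l x _; move: l; apply/continuous_at_row/differentiable_continuous.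
  by case: (dg x).
by apply: IH => l; apply: CR_le (hC l).
Qed.
End Con.

(** * Perturbations of the identity *)

(* [banach_fixed_point] wants a [completeNormedModType]. *)
HB.instance Definition _ (R : realType) m n := Complete.on 'M[R]_(m, n).

Section NearId.
Variables (R : realType) (n : nat).

Lemma row_norm_le m (u : 'rV[R]_m) B : 0 <= B -> (forall i, `|u ord0 i| <= B) -> `|u| <= B.
Proof.
move=> B0 h; rewrite [leLHS]/Num.Def.normr/= mx_normrE bigmax_le // => -[i j] _ /=.
by rewrite (ord1 i).
Qed.

Lemma coord_norm_le m (u : 'rV[R]_m) i : `|u ord0 i| <= `|u|.
Proof.
rewrite [leRHS]/Num.Def.normr/= mx_normrE; exact: (le_bigmax _ _ (ord0, i)).
Qed.

Lemma derive_line (w : 'rV[R]_n -> R) (x v : 'rV[R]_n) (t : R) :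
  differentiable w (x + t *: v) ->
  is_derive t (1 : R) (fun s : R => w (x + s *: v)) ('D_v w (x + t *: v)).
Proof.
move=> dw; set l := (fun s : R => x + s *: v).
have dl : is_diff t l (fun s => s *: v).
  have := is_diffD (is_diff_cst x t) (is_diff_scalel t v).
  by move/is_diff_eq; apply; rewrite add0r.
have dwl : differentiable (w \o l) t by apply: differentiable_comp.
apply: DeriveDef; first exact: diff_derivable.
rewrite -[LHS]/('D_1 (w \o l) t) deriveE // diff_comp //= deriveE //.
by rewrite diff_val scale1r.
Qed.

(** In the sup norm each coordinate may use its own intermediate point of the segment, without
    enlarging [L]. *)
Lemma MVT_rV m (w : 'rV[R]_n -> 'rV[R]_m) L x y :
  0 <= L -> (forall x, differentiable w x) -> (forall x v, `|'D_v w x| <= L * `|v|) ->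
  `|w x - w y| <= L * `|x - y|.
Proof.
move=> L0 dw hw; apply: row_norm_le => [|i]; first by rewrite mulr_ge0.
set v := x - y; set wi := fun x => w x ord0 i.
have dwi z : differentiable wi z by move: i @wi; apply/differentiable_row.
have [|c _] := @MVT_segment R (fun s => wi (y + s *: v)) (fun s =>
  'D_v wi (y + s *: v)) 0 1 ler01 (fun t _ => derive_line (dwi _)).
  apply: continuous_subspaceT => t.
  by apply/differentiable_continuous/derivable1_diffP;
    case: (@derive_line wi y v t (dwi _)).
have yx : y + v = x by rewrite addrC subrK.
rewrite scale1r yx scale0r addr0 subr0 mulr1 !mxE => E.
rewrite -/(wi x) -/(wi y) E -derive_row //.
exact: le_trans (coord_norm_le _ _) (hw _ _).
Qed.

Lemma small_perturbation_onto (w : 'rV[R]_n -> 'rV[R]_n) :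
  (forall x y, `|w x - w y| <= 2^-1 * `|x - y|) ->
  forall y, exists x, x + w x = y.
Proof.
move=> lw y; pose T x := y - w x.
pose Tf : {fun setT >-> setT} := HB.pack T (isFun.Build _ _ setT setT T (fun _ _ => I)).
have [||x _] := @banach_fixed_point R 'rV[R]_n setT Tf _ closedT.
- exists 2^-1%:nng; split; first by rewrite /= invf_lt1 ?ltr1n.
  move=> [a b] _ /=; rewrite /T opprB addrC addrA subrK.
  by rewrite distrC; exact: lw.
- by exists 0.
by move=> E; exists x; rewrite {1}E /Tf /= /T subrK.
Qed.

(* The path t |-> 1 + t J runs through invertible matrices from 1 to 1 + J. *)
Lemma det_perturbation_gt0 (J : 'M[R]_n) : (forall v : 'rV[R]_n,
  `|v *m J| <= 2^-1 * `|v|) ->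
  0 < \det (1%:M + J).
Proof.
(* A kernel vector satisfies [v = - t v J], hence [|v| <= |v| / 2]. *)
move=> hJ; have nz t : 0 <= t <= 1 -> \det (1%:M + t *: J) != 0.
  move=> /andP[t0 t1]; apply/det0P => -[v v0]; apply/eqP.
  rewrite mulmxDr mulmx1 addr_eq0; apply: contra v0 => /eqP E.
  rewrite -normr_le0; have : `|v| <= 2^-1 * `|v|.
    rewrite {1}E normrN -scalemxAr normrZ (ger0_norm t0).
    by rewrite (le_trans (ler_wpM2r _ t1)) // mul1r.
  by lra.
(* The parameter [t] becomes a row vector of length 1, since [CR_det] is about functions of row
   vectors. *)
pose A (x : 'rV[R]_1) := 1%:M + x ord0 ord0 *: J.
have cA : CR 0 setT (fun x => \det (A x)).
  apply: (CR_det openT) => i k;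
    apply: (CR_ext (f := fun x => (1%:M : 'M[R]_n) i k + x ord0 ord0 * J i k) openT).
    by move=> x _; rewrite [in RHS]mxE [X in _ = _ + X]mxE.
  apply: (CR_add openT (CR_cst _ _ _)).
  by apply: (@CR_mul R 1 0 setT _ (cst (J i k)) openT); [exact: CR_coord|exact: CR_cst].
pose f (t : R) := \det (A (t%:M)).
have fE t : f t = \det (1%:M + t *: J) by rewrite /f /A mxE eqxx mulr1n.
have cf : {within `[0, 1], continuous f}.
  apply: continuous_subspaceT => t.
  apply: (@continuous_comp _ _ _ (fun t : R => t%:M : 'rV[R]_1) (fun x => \det (A x)));
    last exact: cA.
  apply/continuous_at_row => i.
  have -> : (fun y : R => (y%:M : 'rV[R]_1) ord0 i) = id.
    by apply/funext => s; rewrite (ord1 i) mxE eqxx mulr1n.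
  exact: cvg_id.
rewrite -[J]scale1r -fE ltNge; apply/negP => f1.
have f0 : f 0 = 1 by rewrite fE scale0r addr0 det1.
have [|c c01] := IVT (v := 0) ler01 cf.
  by rewrite f0 minC ge_min f1 /= le_max ler01.
rewrite fE => /eqP; apply/negP/nz.
by move: c01; rewrite in_itv.
Qed.

(** For [h = id + w] the bound 1/2 gives [|x - y| <= 2 |h x - h y|]: [h] is injective, and the
    inverse supplied by the fixed point argument satisfies the hypotheses of [inverse_CR]. *)
Lemma near_id_diffeo k (w : 'rV[R]_n -> 'rV[R]_n) : k <> Cfin 0 -> C_on k setT w ->
  (forall x v, `|'D_v w x| <= 2^-1 * `|v|) ->
  exists g : 'rV[R]_n -> 'rV[R]_n,
    [/\ cancel (fun x => x + w x) g, cancel g (fun x => x + w x), 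
        C_on k setT (fun x => x + w x), C_on k setT g &
        forall x, 0 < \det ('J (fun x => x + w x) x)].
Proof.
move=> k0 Cw hw; set h := fun x => x + w x.
have dw x : differentiable w x by apply: (C_on_differentiable k0 openT Cw).
have lw x y : `|w x - w y| <= 2^-1 * `|x - y| by apply: MVT_rV.
have lh x y : `|x - y| <= 2 * `|h x - h y|.
  have : `|x - y| <= `|h x - h y| + `|w x - w y|.
    have -> : x - y = (h x - h y) - (w x - w y).
      by rewrite /h (opprD y) (addrACA x) addrK.
    exact: ler_normB.
  by have := lw x y; lra.
have /choice[g gK] := small_perturbation_onto lw.
have hI : injective h.
  move=> x y E; apply/subr0_eq/eqP; rewrite -normr_le0.
  by have := lh x y; rewrite E subrr normr0 mulr0.
have Jh x : 0 < \det ('J h x).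
  have -> : 'J h x = 1%:M + 'J w x.
    have dh : differentiable h x by exact: (@differentiableD _ _ _ id w).
    apply/row_matrixP => i; rewrite [LHS]rowE [RHS]rowE mulmxDr mulmx1.
    apply: etrans (esym (deriveEjacobian _ dh)) _.
    apply: etrans _ (congr1 (+%R _) (deriveEjacobian _ (dw x))).
    rewrite (@deriveD _ _ _ id w); first by rewrite derive_id.
      exact: derivable_id.
    exact: diff_derivable.
  by apply: det_perturbation_gt0 => v; rewrite -deriveEjacobian.
have Ch : C_on k setT h by apply: C_on_add openT _ Cw; exact: C_on_id openT.
exists g; split => //.
  by move=> x; apply: hI; exact: gK.
apply/(C_onP _ _ openT) => j jk.
(* [inverse_CR] starts at class 1; continuity of [g] is read off from that case. *)
have [->|j0] := eqVneq j 0%N.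
  move=> i; apply: (@CR_le R n 0 1) => //; move: i.
  apply: (inverse_CR gK lh) => [x|i]; first by rewrite unitmxE unitfE gt_eqF.
  by move/(C_onP _ _ openT): Ch => /(_ 1%N (jle1 k0)).
case: j jk j0 => // j jk _.
apply: (inverse_CR gK lh) => [x|i]; first by rewrite unitmxE unitfE gt_eqF.
by move/(C_onP _ _ openT): Ch => /(_ _ jk).
Qed.
End NearId.

(** * Smooth cut-off functions *)

Section Bump.
Variable (R : realType).

(* The functions p(1/t) exp(-1/t), extended by 0, are stable under
   differentiation; this is what the parameter [p] is for. *)
Definition flat (p : {poly R}) (t : R) : R := if 0 < t then p.[t^-1] * expR (- t^-1) else 0.

Lemma horner_bound (p : {poly R}) : exists2 C, 0 <= C & forall s, 1 <= s ->
  `|p.[s]| <= C * s ^+ size p.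
Proof.
exists (\sum_(i < size p) `|p`_i|) => [|s s1]; first by apply: sumr_ge0.
rewrite horner_coef (le_trans (ler_norm_sum _ _ _)) // mulr_suml ler_sum // => i _.
rewrite normrM ler_wpM2l // ger0_norm; last by rewrite exprn_ge0 // (le_trans ler01).
by rewrite ler_weXn2l // ltnW.
Qed.

Lemma expRN_bound (m : nat) : exists2 C : R, 0 <= C & forall s, 0 < s ->
  expR (- s) * s ^+ m <= C.
Proof.
(* For [m > 0], [e^s = (e^(s/m))^m >= (s/m)^m]; for [m = 0] the constant is [0^0 = 1]. *)
exists (m%:R ^+ m) => [|s s0]; first by rewrite exprn_ge0.
case: m => [|m]; first by rewrite !expr0 mulr1 -expR0 ler_expR oppr_le0 ltW.
rewrite expRN mulrC ler_pdivrMr ?expR_gt0 //.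
have -> : expR s = expR (s / m.+1%:R) ^+ m.+1.
  by rewrite -expRM_natl mulrC divfK.
rewrite -exprMn; apply: lerXn2r; rewrite ?nnegrE ?(ltW s0) // ?mulr_ge0 ?expR_ge0 //.
have := expR_ge1Dx (s / m.+1%:R); rewrite -ler_pdivrMl // mulrC => h.
by apply: le_trans h; rewrite lerDr.
Qed.

(** Quadratic decay makes the difference quotient at 0 tend to 0. The exponent [size p + 2] in the
    exponential bound absorbs the growth of [p] and leaves the factor [h^2]. *)
Lemma flat_bound p : exists2 C : R, 0 <= C & forall h, 0 < h <= 1 ->
  `|flat p h| <= C * h ^+ 2.
Proof.
have [A A0 hA] := horner_bound p; have [B B0 hB] := expRN_bound (size p + 2).
exists (A * B) => [|h /andP[h0 h1]]; first exact: mulr_ge0.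
rewrite /flat h0 normrM (ger0_norm (expR_ge0 _)).
have s1 : 1 <= h^-1 by rewrite invf_ge1.
have s0 : 0 < h^-1 by rewrite invr_gt0.
apply: (le_trans (ler_wpM2r (expR_ge0 _) (hA _ s1))).
rewrite -!mulrA ler_wpM2l //; have := hB _ s0; rewrite exprD => H.
have -> : h^-1 ^+ size p * expR (- h^-1) = (expR (- h^-1) * (h^-1 ^+ size p * h^-1 ^+
  2)) * h ^+ 2.
  by field; rewrite gt_eqF.
by rewrite ler_wpM2r // exprn_ge0 // ltW.
Qed.

(** For [t > 0] differentiation gives [t^-2 (p - p')(1/t) exp(-1/t)], whence the new polynomial; at
    0 the decay of [flat_bound] gives derivative 0. *)
Lemma is_derive_flat p t : is_derive t (1 : R) (flat p) (flat ('X^2 * (p - p^`())) t).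
Proof.
have [t0|t0|->] := ltgtP t 0.
- have -> : flat ('X^2 * (p - p^`())) t = 0 by rewrite /flat ltNge (ltW t0).
  apply: (@near_eq_is_derive R R R (cst 0)).
  near=> s; rewrite /flat; case: ifP => // s0; exfalso.
  have : s < 0 by near: s; exact: lt_nbhsl.
  by rewrite ltNge (ltW s0).
- have tn0 : t != 0 by rewrite gt_eqF.
  pose f := (fun s : R => p.[s^-1] * expR (- s^-1)).
  apply: (@near_eq_is_derive _ _ _ f).
    near=> s; rewrite /flat; case: ifP => // /negP; case.
    by near: s; exact: lt_nbhsr.
  have dV : is_derive t (1 : R) (fun s : R => s^-1) (- t ^- 2).
    by have := is_deriveV tn0 (is_derive_id t (1 : R)) => /is_derive_eq; apply;
      rewrite /= [_ *: _]mulr1.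
  have d1 := is_derive1_comp (is_derive_poly p t^-1) dV.
  have d2 := @is_derive1_comp R expR (- (fun s : R =>
    s^-1)) t _ _ (is_derive_expR (- t^-1)) (is_deriveN dV).
  apply: (is_derive_eq (is_deriveM d1 d2)).
  rewrite /flat t0 /= !fctE !hornerE /= !/(_ *: _) /=.
  by field.
- have -> : flat ('X^2 * (p - p^`())) 0 = 0 by rewrite /flat ltxx.
  have [C C0 hC] := flat_bound p.
  have [|e e0|df Df] := @approx_differentiable R R R (flat p) (\0 : {linear R -> R}) 0.
  + by move=> x; exact: cst_continuous.
  + apply: (near0_norm (V := R) _).2.
    (* 1 is the range of [flat_bound]; [C + 1] stands in for [C], which may be 0. *)
    exists (Num.min 1 (e / (C + 1))) => [|k].
      by rewrite lt_min ltr01 divr_gt0 // ltr_wpDl.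
    rewrite lt_min => /andP[/ltW k1 /ltW k2].
    rewrite addr0 /= subr0 {2}/flat ltxx subr0.
    have [k0|k0] := ltP 0 k; last by rewrite /flat ltNge k0 normr0 mulr_ge0 // ltW.
    move: k1 k2; rewrite (gtr0_norm k0) => k1 k2.
    have := hC k; rewrite k0 k1 => /(_ isT) /le_trans; apply.
    move: k2; rewrite ler_pdivlMr; last by rewrite ltr_wpDl.
    by rewrite expr2 mulrA => k2; rewrite ler_wpM2r ?(ltW k0) //; lra.
  apply: DeriveDef; first exact: diff_derivable.
  by rewrite deriveE // Df.
Unshelve. all: by end_near.
Qed.

Lemma CR_flat n p j (U : set 'rV[R]_n) (f : 'rV[R]_n -> R) : open U -> CR j U f ->
  CR j U (fun x => flat p (f x)).
Proof.
move=> oU; have dfl q t : differentiable (flat q) t.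
  by apply/derivable1_diffP; case: (is_derive_flat q t).
elim: j p => [|j IH] p hf.
  move=> x Ux; apply: (@continuous_comp _ _ _ f (flat p)); first exact: hf.
  exact/differentiable_continuous/dfl.
have hf' := CRS hf; case: hf => df Df; split=> [x Ux|v].
  by apply: (@differentiable_comp _ _ _ _ f (flat p)) => //; exact: df.
apply: (CR_ext (f := fun x => flat ('X^2 * (p - p^`())) (f x) * 'D_v f x)) => //;
  last first.
  by apply: CR_mul => //; [exact: IH|exact: Df].
move=> x Ux; have dfx := df x Ux.
rewrite -[RHS]/('D_v (flat p \o f) x).
have -> : 'D_v (flat p \o f) x = 'd (flat p) (f x) ('d f x v).
  by rewrite (deriveE _ (differentiable_comp dfx (dfl p (f x)))) diff_comp.
rewrite (diff1E (dfl p (f x))) derive1E -(deriveE _ dfx).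
by rewrite (@derive_val _ _ _ _ _ _ _ (is_derive_flat p (f x))) mulrC.
Qed.

Lemma flat1_ge0 t : 0 <= flat 1 t.
Proof. by rewrite /flat; case: ifP => // _; rewrite hornerC mul1r expR_ge0. Qed.

Lemma flat1_gt0 t : 0 < t -> 0 < flat 1 t.
Proof. by rewrite /flat => ->; rewrite hornerC mul1r expR_gt0. Qed.

Lemma flat1_le0 t : t <= 0 -> flat 1 t = 0.
Proof. by rewrite /flat => t0; rewrite ltNge t0. Qed.

Variable n : nat.

Definition sqn (x : 'rV[R]_n) : R := \sum_(i < n) x ord0 i ^+ 2.

(** The usual smooth step, taken in the squared norm so that the argument is polynomial and smooth
    at 0 too. It is 1 up to [a] and 0 from [b] on; both parameters are squared radii. *)
Definition bump (a b : R) (x : 'rV[R]_n) : R :=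
  let t := (b - sqn x) / (b - a) in flat 1 t / (flat 1 t + flat 1 (1 - t)).

Lemma CR_sqn j (U : set 'rV[R]_n) : open U -> CR j U sqn.
Proof.
move=> oU; apply: CR_sum => // i.
apply: (CR_ext (f := fun x => x ord0 i * x ord0 i)) => //.
by apply: CR_mul => //; exact: CR_coord.
Qed.

Lemma sqn_continuous : continuous sqn.
Proof. by move=> x; apply: (CR_sqn 0 openT). Qed.

Lemma flat1_den_gt0 t : 0 < flat 1 t + flat 1 (1 - t).
Proof.
have [t0|t0] := ltP 0 t; first by rewrite ltr_pwDl ?flat1_gt0 ?flat1_ge0.
by rewrite ltr_wpDl ?flat1_ge0 // flat1_gt0 // subr_gt0 (le_lt_trans t0).
Qed.

Lemma CR_bump a b j (U : set 'rV[R]_n) : open U -> CR j U (bump a b).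
Proof.
move=> oU; have ht : CR j U (fun x => (b - sqn x) / (b - a)).
  apply: CR_mul => //; last exact: CR_cst.
  by apply: CR_add => //; [exact: CR_cst|apply: CR_opp => //; exact: CR_sqn].
apply: CR_mul => //; first exact: CR_flat.
apply: CR_inv => // [x _|]; first by rewrite gt_eqF // flat1_den_gt0.
apply: CR_add => //; apply: CR_flat => //.
by apply: CR_add => //; [exact: CR_cst|exact: CR_opp].
Qed.

Lemma bump_eq1 a b x : a < b -> sqn x <= a -> bump a b x = 1.
Proof.
move=> ab xa; rewrite /bump; set t := (b - sqn x) / (b - a).
have t1 : 1 <= t by rewrite ler_pdivlMr ?subr_gt0 // mul1r lerD2l lerN2.
by rewrite (@flat1_le0 (1 - t)) ?subr_le0 // addr0 divff // gt_eqF // flat1_gt0 //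
  (lt_le_trans ltr01).
Qed.

Lemma bump_eq0 a b x : a < b -> b <= sqn x -> bump a b x = 0.
Proof.
move=> ab xb; rewrite /bump; set t := (b - sqn x) / (b - a).
by rewrite (@flat1_le0 t) ?mul0r // pmulr_lle0 ?invr_gt0 ?subr_gt0 // subr_le0.
Qed.

Lemma bump_le1 a b x : 0 <= bump a b x <= 1.
Proof.
rewrite /bump; set t := (b - sqn x) / (b - a);
  rewrite divr_ge0 ?flat1_ge0 ?(ltW (flat1_den_gt0 t)) //=.
by rewrite ler_pdivrMr ?flat1_den_gt0 // mul1r lerDl flat1_ge0.
Qed.

Lemma sqnZ t x : sqn (t *: x) = t ^+ 2 * sqn x.
Proof. by rewrite /sqn mulr_sumr; apply: eq_bigr => i _; rewrite mxE exprMn. Qed.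

Lemma sqn0 : sqn 0 = 0.
Proof. by rewrite -[0](scale0r (0 : 'rV[R]_n)) sqnZ expr0n mul0r. Qed.

Lemma sqn_ge0 x : 0 <= sqn x.
Proof. by apply: sumr_ge0 => i _; exact: sqr_ge0. Qed.

Lemma enormE x : enorm x = Num.sqrt (sqn x).
Proof. by []. Qed.

Lemma sqn_norm x : `|x| ^+ 2 <= sqn x.
Proof.
have : `|x| <= enorm x.
  apply: row_norm_le => [|i]; first exact: sqrtr_ge0.
  rewrite -sqrtr_sqr /enorm ler_wsqrtr // (bigD1 i) //= lerDl.
  by apply: sumr_ge0 => k _; exact: sqr_ge0.
move=> h; rewrite -[leRHS]sqr_sqrtr ?sqn_ge0 //.
by apply: lerXn2r; rewrite ?nnegrE ?sqrtr_ge0.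
Qed.

Lemma sqn_eq0 x : (sqn x == 0) = (x == 0).
Proof.
apply/eqP/eqP => [E|->]; last exact: sqn0.
by apply/eqP; rewrite -normr_eq0 -sqrf_eq0 eq_le sqr_ge0 andbT -E sqn_norm.
Qed.
End Bump.

(** * Generators of the identity component of GL_n *)

Section GLpos.
Variable R : realType.

(** Gaussian elimination that keeps determinants positive. Matrices [1 + N] with [N^2 = 0] cover the
    row operations and the unipotent block factors, so a dilation is needed only in size 1, where
    the determinant is what remains. *)
Lemma GLpos_elementary n (P : 'M[R]_n -> Prop) :
  (forall A B, P A -> P B -> P (A *m B)) ->
  (forall N, N *m N = 0 -> P (1%:M + N)) ->
  (forall i d, 0 < d -> P (1%:M + (d - 1) *: delta_mx i i)) ->
  forall A, 0 < \det A -> P A.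
Proof.
elim: n P => [|n IH] P Pm PN Pd A A0.
  by rewrite (_ : A = 1%:M + 0); [apply: PN; rewrite mulmx0|apply/matrixP => -[]].
(* Size 1 is the end of the recursion: there is no second row with which to normalise the pivot. *)
have [n0|n0] := posnP n.
  subst n; rewrite (_ : A = 1%:M + (\det A - 1) *: delta_mx ord0 ord0); first exact: Pd.
  apply/matrixP => i j; rewrite (ord1 i) (ord1 j) !mxE det_mx11 /= mulr1.
  by rewrite addrC subrK.
(* 1 + N = (1 + N / 2)^2 *)
have detN (N : 'M[R]_n.+1) : N *m N = 0 -> 0 <= \det (1%:M + N).
  move=> NN; have -> : 1%:M + N = (1%:M + 2^-1 *: N) *m (1%:M + 2^-1 *: N).
    rewrite mulmxDl !mulmxDr !mul1mx mulmx1 -scalemxAl -scalemxAr NN !scaler0 addr0.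
    rewrite -addrA -scalerDl; congr (_ + _); rewrite -[LHS]scale1r; congr (_ *: _); lra.
  by rewrite det_mulmx -expr2 sqr_ge0.
(* Row operations may be applied freely: [1 - N] undoes [1 + N], is of the same kind, and the
   determinant stays positive. *)
have reduce (N B : 'M[R]_n.+1) : N *m N = 0 -> (0 < \det ((1%:M + N) *m B) ->
  P ((1%:M + N) *m B)) ->
    0 < \det B -> P B.
  move=> NN h B0.
  have NK : (1%:M - N) *m (1%:M + N) = 1%:M.
    by rewrite mulmxBl !mulmxDr !mul1mx mulmx1 NN addr0 addrK.
  rewrite -[B]mul1mx -NK -mulmxA; apply: Pm.
    by apply: PN; rewrite mulmxN mulNmx NN !oppr0.
  apply: h; rewrite det_mulmx mulr_gt0 // lt_def detN // andbT.
  by apply/eqP => d0; have := congr1 determinant NK;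
    rewrite det_mulmx d0 mulr0 det1 => /eqP; rewrite eq_sym oner_eq0.
have sq0 (i j : 'I_n.+1) t : i != j ->
  (t *: delta_mx i j : 'M[R]_n.+1) *m (t *: delta_mx i j) = 0.
  move=> ij; rewrite -scalemxAl -scalemxAr mul_delta_mx_0 ?scaler0 //.
  by rewrite eq_sym.
have addE (i j k l : 'I_n.+1) t (B : 'M[R]_n.+1) :
    ((1%:M + t *: delta_mx i j) *m B) k l = B k l + t * (k == i)%:R * B j l.
  rewrite mulmxDl mul1mx mxE; congr (_ + _).
  rewrite -scalemxAl mxE -mulrA; congr (_ * _).
  rewrite mxE (bigD1 j) //= big1 ?addr0; last by move=> m mj;
    rewrite mxE (negPf mj) andbF mul0r.
  by rewrite mxE eqxx andbT.
have main (B : 'M[R]_n.+1) : B ord0 ord0 = 1 -> 0 < \det B -> P B.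
  rewrite -[n.+1]/(1 + n)%N in P Pm PN Pd A A0 detN reduce sq0 addE B *.
  rewrite -(submxK B); set u := ursubmx B; set v := dlsubmx B; set D := drsubmx B.
  move=> B1; have -> : ulsubmx B = 1%:M.
    apply/matrixP => i j; rewrite (ord1 i) (ord1 j) [RHS]mxE eqxx -B1 submxK mxE mxE.
    by congr (B _ _); apply/val_inj.
  (* Block LDU factorisation with pivot 1; the Schur complement [D - v u] inherits the
     determinant. *)
  have -> : block_mx 1%:M u v D =
      block_mx 1%:M 0 v 1%:M *m (block_mx 1%:M 0 0 (D - v *m u) *m block_mx 1%:M u 0 1%:M).
    rewrite !mulmx_block !mulmx1 !mul1mx !mulmx0 !mul0mx !addr0 !add0r.
    by rewrite mulmx1 (addrC (v *m u)) subrK.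
  rewrite !det_mulmx det_lblock !det_ublock !det1 !mulr1 !mul1r => D0.
  have PN' (N : 'M[R]_(1 + n)) X : N *m N = 0 -> X = 1%:M + N -> P X by move=> NN ->;
    exact: PN.
  apply: (Pm _ _ _ (Pm _ _ _ _)).
  - apply: (PN' (block_mx 0 0 v 0)).
      by rewrite mulmx_block !mulmx0 !mul0mx !addr0 block_mx0.
    by rewrite scalar_mx_block add_block_mx !addr0 !add0r.
  (* Matrices of size [n] are embedded as lower right blocks, which respects products, square-zero
     matrices and dilations. *)
  - apply: (IH (fun X => P (block_mx 1%:M 0 0 X))) => //.
    + move=> X Y PX PY; have := Pm _ _ PX PY.
      by rewrite mulmx_block !mulmx1 !mulmx0 !mul0mx !addr0 !add0r.
    + move=> N NN; apply: (PN' (block_mx 0 0 0 N)).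
        by rewrite mulmx_block !mulmx0 !mul0mx !addr0 NN add0r block_mx0.
      by rewrite (scalar_mx_block 1 n) add_block_mx !addr0.
    + move=> i d d0; have := Pd (rshift 1 i) d d0; congr P.
      rewrite (scalar_mx_block 1 n) (_ : delta_mx _ _ = block_mx 0 0 0 (delta_mx i i)).
        by rewrite scale_block_mx !scaler0 add_block_mx !addr0.
      rewrite -[LHS]submxK; congr block_mx; apply/matrixP => a b; rewrite !mxE //.
      * by rewrite eq_lrshift.
      * by rewrite eq_lrshift.
      * by rewrite eq_lrshift andbF.
  - apply: (PN' (block_mx 0 u 0 0)).
      by rewrite mulmx_block !mulmx0 !mul0mx !addr0 block_mx0.
    by rewrite scalar_mx_block add_block_mx !addr0 !add0r.
(* A nonzero entry below the corner lets a multiple of its row turn the corner into 1. *)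
have col_case (B : 'M[R]_n.+1) (i : 'I_n.+1) : i != ord0 -> B i ord0 != 0 ->
  0 < \det B -> P B.
  move=> i0 Bi; apply: (reduce (((1 - B ord0 ord0) / B i ord0) *: delta_mx ord0 i)).
    by apply: sq0; rewrite eq_sym.
  by apply: main; rewrite addE eqxx mulr1 divfK // addrC subrK.
have i1 : (1 < n.+1)%N by [].
have [B10|A1] := eqVneq (A (Ordinal i1) ord0) 0; last exact: (col_case A (Ordinal i1)).
have [/existsP[i /andP[i0 Ai]]|/existsPn h] := boolP [exists i,
  (i != ord0) && (A i ord0 != 0)].
  exact: (col_case A i).
(* The first column is zero below the corner, so the corner is nonzero because the determinant is;
   adding row 0 to row 1 leads back to [col_case]. *)
have A0' := A0; apply: (reduce (1 *: delta_mx (Ordinal i1) ord0)) A0'; first exact: sq0.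
apply: (col_case _ (Ordinal i1)) => //; rewrite addE eqxx !mul1r B10 add0r.
apply/eqP => A00; move: A0; rewrite (expand_det_col A ord0) big1 ?ltxx // => i _.
have [->|i0] := eqVneq i ord0; first by rewrite A00 mul0r.
by have := h i; rewrite i0 /= negbK => /eqP ->; rewrite mul0r.
Qed.

(** The threshold [eta] may depend on the direction [N]. This is the form in which cut-off linear
    fields realise matrices: each [N] gives one field, admissible after a scaling of its own. *)
Lemma GLpos_small n (P : 'M[R]_n -> Prop) :
  (forall A B, P A -> P B -> P (A *m B)) ->
  (forall N, exists2 eta, 0 < eta & forall t, `|t| <= eta -> P (1%:M + t *: N)) ->
  forall A, 0 < \det A -> P A.
Proof.
move=> Pm Ps.
have P1 : P 1%:M.
  by have [eta e0 /(_ 0)] := Ps 0; rewrite normr0 (ltW e0) scaler0 addr0; apply.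
apply: GLpos_elementary => // [N NN|i d d0].
  (* 1 + N = (1 + N / m)^m as N^2 = 0; for dilations, d = (exp (ln d / m))^m. *)
  have [eta e0 he] := Ps N.
  have [m hm] : exists m : nat, m.+1%:R^-1 < eta.
    exists (Num.truncn eta^-1).
    by rewrite invf_plt ?posrE // truncnS_gt.
  have E j : P (1%:M + (j%:R / m.+1%:R) *: N).
    elim: j => [|j IH]; first by rewrite mul0r scale0r addr0.
    have := Pm _ _ IH (he m.+1%:R^-1 _);
      rewrite ger0_norm ?invr_ge0 // (ltW hm) => /(_ isT).
    rewrite mulmxDl !mulmxDr !mul1mx mulmx1 -scalemxAl -scalemxAr NN !scaler0 addr0.
    by rewrite -addrA -scalerDl -[in j.+1%:R]natr1 mulrDl mul1r (addrC m.+1%:R^-1).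
  by have := E m.+1; rewrite divff // scale1r.
have [eta e0 he] := Ps (delta_mx i i).
have : {for (0 : R), continuous (@expR R)} by exact: continuous_expR.
move=> /cvgrPdist_lt /(_ _ e0) /near0_norm [c c0 hc].
pose m := Num.truncn (`|ln d| / c).
have hm : `|ln d / m.+1%:R| < c.
  rewrite normrM normfV (@ger0_norm _ m.+1%:R) // ltr_pdivrMr // mulrC -ltr_pdivrMr //.
  exact: truncnS_gt.
have {hm}/hc := hm; rewrite expR0 distrC => /ltW /he.
set q := expR _ => Pq.
have E j : P (1%:M + (q ^+ j - 1) *: delta_mx i i).
  elim: j => [|j IH]; first by rewrite expr0 subrr scale0r addr0.
  have := Pm _ _ IH Pq; congr P.
  rewrite mulmxDl !mulmxDr !mul1mx mulmx1 -scalemxAl -scalemxAr mul_delta_mx scalerA.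
  rewrite -addrA -!scalerDl; congr (_ + _ *: _); rewrite exprS; ring.
have := E m.+1; rewrite /q -expRM_natl mulrC divfK // lnK //.
Qed.
End GLpos.

(** * Maps between manifolds *)

Section Cat.
Variables (R : realType) (k : smoothness).

Definition C_at n m (F : 'rV[R]_n -> 'rV[R]_m) (z : 'rV[R]_n) : Prop :=
  exists W : set 'rV[R]_n, [/\ open W, W z & C_on k W F].

Lemma C_at_on n m (F : 'rV[R]_n -> 'rV[R]_m) W z : open W -> W z -> C_on k W F -> C_at F z.
Proof. by move=> oW Wz hF; exists W. Qed.

Lemma C_at_continuous n m (F : 'rV[R]_n -> 'rV[R]_m) z : C_at F z -> {for z, continuous F}.
Proof. by move=> [W [oW Wz hF]]; exact: C_on_continuous oW hF z Wz. Qed.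

Lemma C_at_ext n m (F G : 'rV[R]_n -> 'rV[R]_m) z : (\forall y \near z, F y = G y) ->
  C_at F z -> C_at G z.
Proof.
move=> nFG; have : nbhs z [set y | F y = G y] by [].
rewrite nbhsE /= => -[V [oV Vz] FG] [W [oW Wz hF]].
exists (V `&` W); split => //; first exact: openI.
apply: (@C_on_ext _ _ _ _ _ F); first exact: openI.
  by move=> x [Vx _]; exact: FG.
by apply: C_on_sub hF => //; exact: openI.
Qed.

Lemma open_at (T : topologicalType) (A : set T) : (forall x, A x -> nbhs x A) -> open A.
Proof. by move=> h; rewrite openE => x Ax; exact: h. Qed.

Lemma C_at_comp n m p (F : 'rV[R]_n -> 'rV[R]_m) (G : 'rV[R]_m -> 'rV[R]_p) z :
  C_at F z -> C_at G (F z) -> C_at (G \o F) z.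
Proof.
move=> [W [oW Wz hF]] [V [oV Vz hG]]; exists (W `&` F @^-1` V).
have o : open (W `&` F @^-1` V).
  apply: open_at => x [Wx Vx]; apply: filterI; first exact: open_nbhs_nbhs.
  by apply: (C_on_continuous oW hF Wx); exact: open_nbhs_nbhs.
split => //; apply: (C_on_comp o oV) hG; first by move=> x [].
by apply: C_on_sub hF => // x [].
Qed.

Hypothesis k0 : k <> Cfin 0.

Lemma C_at_differentiable n m (F : 'rV[R]_n -> 'rV[R]_m) z : C_at F z -> differentiable F z.
Proof. by move=> [W [oW Wz hF]]; exact: (C_on_differentiable k0 oW hF Wz). Qed.

(** Vectors are rows and Jacobians act from the right, so the factor of the inner map comes
    first. *)
Lemma jacobian_comp n m p (F : 'rV[R]_n -> 'rV[R]_m) (G : 'rV[R]_m -> 'rV[R]_p) z :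
  differentiable F z -> differentiable G (F z) ->
  'J (G \o F) z = 'J F z *m 'J G (F z).
Proof.
move=> dF dG; apply/row_matrixP => i; rewrite [LHS]rowE [RHS]rowE mulmxA.
apply: etrans (mul_rV_lin1 _ _) _; rewrite diff_comp //=.
by rewrite /jacobian !mul_rV_lin1.
Qed.

Lemma jacobian_ext n m (F G : 'rV[R]_n -> 'rV[R]_m) z : (\forall y \near z, F y = G y) ->
  differentiable F z -> 'J F z = 'J G z.
Proof.
move=> FG dF; have dG := near_eq_differentiable FG dF.
apply/matrixP => i j; apply: etrans (jacobianE _ _ dF) _.
apply: etrans _ (esym (jacobianE _ _ dG)).
by rewrite (near_eq_derive _ FG).
Qed.

Lemma jacobian_id n z : 'J (@id 'rV[R]_n) z = 1%:M.
Proof.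
apply/matrixP => i j; rewrite /jacobian mxE diff_val !mxE eqxx /= eq_sym.
by rewrite eq_sym.
Qed.

Lemma C_at_jacobian_continuous n (F : 'rV[R]_n -> 'rV[R]_n) z : C_at F z ->
  {for z, continuous (fun y => \det ('J F y))}.
Proof.
move=> [W [oW Wz hF]].
have dF := C_on_differentiable k0 oW hF.
have h : CR 0 W (fun y => \det ('J F y)).
  apply: CR_det => // i j.
  apply: (CR_ext (f := fun y => 'D_(delta_mx ord0 i) F y ord0 j)) => // [x Wx|x Wx].
    by rewrite jacobianE //; exact: dF.
  exact: C_on_derive k0 oW hF x Wx.
exact: h.
Qed.
End Cat.

(** The part of [is_oriented_manifold] that concerns charts. Euclidean space then qualifies through
    its single chart, and Hausdorffness of [M] is assumed separately where compact images must be
    closed. *)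
Record oriented_atlas (R : realType) (n : nat) (k : smoothness) (M : topologicalType)
    (A : set (chart R n M)) : Prop := OrientedAtlas {
  oa_cover : forall x, exists2 phi, A phi & chart_dom phi x;
  oa_smooth : forall phi psi, A phi -> A psi ->
    C_on k (chart_map phi @` (chart_dom phi `&` chart_dom psi)) (in_charts phi psi id);
  oa_oriented : orientation_preserving A A setT id
}.

Section Smap.
Variables (R : realType) (n : nat) (k : smoothness).
Hypothesis k0 : k <> Cfin 0.
Implicit Types (M N : topologicalType).

Lemma chart_nbhs M (phi : chart R n M) x : chart_dom phi x -> nbhs x (chart_dom phi).
Proof. by move=> dx; apply: open_nbhs_nbhs; split => //; exact: chart_dom_open. Qed.

Lemma chartK M (phi : chart R n M) x : chart_dom phi x ->
  chart_inv phi (chart_map phi x) = x.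
Proof. by move=> dx; apply: chart_mapK; rewrite inE. Qed.

Lemma chart_inv_cvg M (phi : chart R n M) x (P : set M) : chart_dom phi x -> nbhs x P ->
  \forall z \near chart_map phi x, P (chart_inv phi z).
Proof.
move=> dx nP; have := @chart_inv_continuous _ _ _ phi (chart_map phi x).
move=> /(_ (ex_intro2 _ _ x dx erefl)) h; apply: h.
by rewrite chartK.
Qed.

Lemma chart_map_near M (phi : chart R n M) x (P : set M) : chart_dom phi x -> nbhs x P ->
  \forall z \near chart_map phi x, exists y, [/\ P y,
    chart_dom phi y & z = chart_map phi y].
Proof.
move=> dx nP.
have nPd : nbhs x (P `&` chart_dom phi) by apply: filterI => //; exact: chart_nbhs.
have h := chart_inv_cvg dx nPd.
have : nbhs (chart_map phi x) (chart_map phi @` chart_dom phi).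
  by apply: open_nbhs_nbhs; split; [exact: chart_img_open|exists x].
apply: filterS2 h => z [Pz _] [y dy yz]; exists y; split => //.
by move: Pz; rewrite -yz chartK.
Qed.

Lemma chart_image_open M (phi : chart R n M) (W : set M) : open W -> W `<=` chart_dom phi ->
  open (chart_map phi @` W).
Proof.
move=> oW Wd; apply: open_at => _ [x Wx <-].
have := chart_map_near (Wd _ Wx) (open_nbhs_nbhs (conj oW Wx)).
by apply: filterS => z [y [Wy _ ->]]; exists y.
Qed.

Lemma chart_near M (phi : chart R n M) x (P : 'rV[R]_n -> Prop) : chart_dom phi x ->
  (\forall z \near chart_map phi x, P z) -> \forall y \near x, P (chart_map phi y).
Proof. by move=> dx nP; exact: (chart_map_continuous dx nP). Qed.

(* [smap] is class C^k near [x]; [sgnat s f x] says that the Jacobian of [f] at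
   [x] has the sign of [s] in all charts, so that orientation reversing maps are
   treated on the same footing. *)
Definition smap M N (A : set (chart R n M)) (B : set (chart R n N)) (f : M -> N) (x : M) :=
  {for x, continuous f} /\
  forall phi psi, A phi -> B psi -> chart_dom phi x -> chart_dom psi (f x) ->
    C_at k (in_charts phi psi f) (chart_map phi x).

Definition sgnat M N (A : set (chart R n M)) (B : set (chart R n N)) (s : R) (f : M ->
  N) (x : M) :=
  forall phi psi, A phi -> B psi -> chart_dom phi x -> chart_dom psi (f x) ->
    0 < s * \det ('J (in_charts phi psi f) (chart_map phi x)).

Lemma C_mapP M N (A : set (chart R n M)) (B : set (chart R n N)) (Om : set M) f : open Om ->
  C_map k A B Om f <-> forall x, Om x -> smap A B f x.
Proof.
move=> oO.
(* The domain of a coordinate expression is open because [f] is continuous on [Om]. *)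
have opn phi psi : (forall x, Om x -> {for x, continuous f}) ->
    open (@chart_dom R n M phi `&` Om `&` f @^-1` @chart_dom R n N psi).
  move=> cf; apply: open_at => x [[dx Ox] dfx]; apply: filterI.
    by apply: filterI; [exact: chart_nbhs|exact: open_nbhs_nbhs].
  by apply: (cf x Ox); exact: chart_nbhs.
split=> [[cf h] x Ox|h].
  split=> [|phi psi Ap Bp dx dfx]; first exact: cf.
  apply: C_at_on (h phi psi Ap Bp); last by exists x.
  by apply: chart_image_open; [exact: opn|move=> y [[]]].
have cf x : Om x -> {for x, continuous f} by case/h.
split=> // phi psi Ap Bp; apply: C_on_loc => [|_ [x [[dx Ox] dfx] <-]].
  by apply: chart_image_open; [exact: opn|move=> y [[]]].
by case: (h x Ox) => _; exact.
Qed.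

Lemma in_charts_comp M N Q (phi : chart R n M) (psi : chart R n N) (chi : chart R n Q)
  (f : M -> N) (g : N -> Q) x : chart_dom phi x -> {for x, continuous f} ->
    chart_dom psi (f x) ->
  \forall z \near chart_map phi x,
    (in_charts psi chi g \o in_charts phi psi f) z = in_charts phi chi (g \o f) z.
Proof.
move=> dx cf dfx; have := chart_inv_cvg dx (cf _ (chart_nbhs dfx)).
by apply: filterS => z dz; rewrite /in_charts /= chartK.
Qed.

Lemma in_chartsE M N (phi : chart R n M) (psi : chart R n N) (f : M -> N) x :
  chart_dom phi x -> in_charts phi psi f (chart_map phi x) = chart_map psi (f x).
Proof. by move=> dx; rewrite /in_charts /= chartK. Qed.

Section Two.
Variables (M N : topologicalType) (A : set (chart R n M)) (B : set (chart R n N)).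
Hypothesis (hA : oriented_atlas k A) (hB : oriented_atlas k B).

Lemma smap_id x : smap A A id x.
Proof.
split=> [|phi psi Ap Bp dx dfx]; first exact: cvg_id.
apply: C_at_on (oa_smooth hA Ap Bp); last by exists x.
by apply: chart_image_open; [apply: openI; exact: chart_dom_open|move=> y []].
Qed.

(** One pair of charts suffices: any other pair differs by transition maps before and after, which
    are of class C^k. *)
Lemma smap_intro f x phi psi : {for x, continuous f} -> A phi -> B psi -> chart_dom phi x ->
  chart_dom psi (f x) -> C_at k (in_charts phi psi f) (chart_map phi x) -> smap A B f x.
Proof.
move=> cf Ap Bp dx dfx h; split=> // phi' psi' Ap' Bp' dx' dfx'.
have [_ /(_ phi' phi Ap' Ap dx' dx) h1] := smap_id x.
have h2 : C_at k (in_charts psi psi' id) (chart_map psi (f x)).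
  apply: C_at_on (oa_smooth hB Bp Bp'); last by exists (f x).
  by apply: chart_image_open; [apply: openI; exact: chart_dom_open|move=> y []].
apply: C_at_ext (in_charts_comp psi' id dx' cf dfx) _.
apply: C_at_comp; last by rewrite in_chartsE.
apply: C_at_ext (in_charts_comp psi f dx' (@cvg_id _ _) dx) _.
by apply: C_at_comp => //; rewrite in_chartsE.
Qed.
End Two.

Section Three.
Variables (M N Q : topologicalType) (A : set (chart R n M)) (B : set (chart R n N)) (C
  : set (chart R n Q)).
Hypothesis (hA : oriented_atlas k A) (hB : oriented_atlas k B) (hC : oriented_atlas k C).

Lemma smap_comp f g x : smap A B f x -> smap B C g (f x) -> smap A C (g \o f) x.
Proof.
move=> [cf hf] [cg hg]; split=> [|phi chi Ap Cp dx dgx]; first exact: continuous_comp.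
have [psi Bp dfx] := oa_cover hB (f x).
apply: C_at_ext (in_charts_comp chi g dx cf dfx) _.
apply: C_at_comp; first exact: hf.
by rewrite in_chartsE //; exact: hg.
Qed.

Lemma det_charts_comp f g x phi psi chi : A phi -> B psi -> C chi ->
  chart_dom phi x -> chart_dom psi (f x) -> chart_dom chi (g (f x)) ->
  smap A B f x -> smap B C g (f x) ->
  \det ('J (in_charts phi chi (g \o f)) (chart_map phi x)) =
  \det ('J (in_charts phi psi f) (chart_map phi x)) *
  \det ('J (in_charts psi chi g) (chart_map psi (f x))).
Proof.
move=> Ap Bp Cp dx dfx dgx [cf hf] [cg hg].
have df := C_at_differentiable k0 (hf phi psi Ap Bp dx dfx).
have dg := C_at_differentiable k0 (hg psi chi Bp Cp dfx dgx).
have dg' : differentiable (in_charts psi chi g) (in_charts phi psi f (chart_map phi x)).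
  by rewrite in_chartsE.
rewrite -(jacobian_ext (in_charts_comp chi g dx cf dfx)); last exact: differentiable_comp.
by rewrite jacobian_comp // det_mulmx in_chartsE.
Qed.

Lemma sgnat_comp s t f g x : smap A B f x -> smap B C g (f x) ->
  sgnat A B s f x -> sgnat B C t g (f x) -> sgnat A C (s * t) (g \o f) x.
Proof.
move=> hf hg sf sg phi chi Ap Cp dx dgx.
have [psi Bp dfx] := oa_cover hB (f x).
rewrite (det_charts_comp Ap Bp Cp) // mulrACA.
by rewrite mulr_gt0 //; [exact: sf|exact: sg].
Qed.
End Three.
End Smap.

Lemma mul3_gt0 (R : realDomainType) (s a b c : R) :
  0 < a -> 0 < b -> 0 < s * c -> 0 < s * (a * c * b).
Proof.
move=> a0 b0 sc; have -> : s * (a * c * b) = a * (s * c) * b by ring.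
by apply: mulr_gt0 => //; exact: mulr_gt0.
Qed.

Lemma mul_eq1_sign (R : realDomainType) (a b : R) : a * b = 1 -> 0 < 1 * a \/ 0 < -1 * a.
Proof.
move=> E; rewrite mul1r mulN1r oppr_gt0; have [a0|a0|a0] := ltgtP a 0; [by right|by left|].
by move: E; rewrite a0 mul0r => /eqP; rewrite eq_sym oner_eq0.
Qed.

Lemma mul_eq1_gt0 (R : realDomainType) (s a b : R) : a * b = 1 -> 0 < s * a -> 0 < s * b.
Proof.
move=> E sa; have b0 : 0 < b * b.
  rewrite lt_def -expr2 sqr_ge0 andbT sqrf_eq0; apply: contra_eq_neq E => ->.
  by rewrite mulr0 eq_sym oner_eq0.
by have := mulr_gt0 sa b0; rewrite -mulrA [a * _]mulrA E mul1r.
Qed.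

Section Sgn.
Variables (R : realType) (n : nat) (k : smoothness).
Hypothesis k0 : k <> Cfin 0.

Lemma oriented_manifold_atlas (M : topologicalType) (A : set (chart R n M)) :
  is_oriented_manifold k A -> oriented_atlas k A.
Proof. by case=> *; split. Qed.

Lemma in_charts_euclidean (F : 'rV[R]_n -> 'rV[R]_n) :
  in_charts (@id_chart R n) (@id_chart R n) F = F.
Proof. by []. Qed.

Lemma euclidean_oriented_atlas : oriented_atlas k (@euclidean_atlas R n).
Proof.
split=> [x|phi psi -> ->|phi psi -> -> x _ _ _].
- by exists (@id_chart R n).
- by rewrite setIT image_id; exact: C_on_id openT.
- by rewrite in_charts_euclidean (jacobian_id x) det1.
Qed.
Let hE := euclidean_oriented_atlas.

Lemma smap_euclideanP (F : 'rV[R]_n -> 'rV[R]_n) x :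
  smap k (@euclidean_atlas R n) (@euclidean_atlas R n) F x <-> C_at k F x.
Proof.
split=> [[_ h]|h]; first exact: (h (@id_chart R n) (@id_chart R n)).
by split=> [|phi psi -> -> _ _]; [exact: C_at_continuous h|].
Qed.

Lemma sgnat_euclidean s (F : 'rV[R]_n -> 'rV[R]_n) x :
  sgnat (@euclidean_atlas R n) (@euclidean_atlas R n) s F x <-> 0 < s * \det ('J F x).
Proof.
split=> [h|h]; first exact: (h (@id_chart R n) (@id_chart R n)).
by move=> phi psi -> -> _ _.
Qed.

Section Two.
Variables (M N : topologicalType) (A : set (chart R n M)) (B : set (chart R n N)).
Hypothesis (hA : oriented_atlas k A) (hB : oriented_atlas k B).

Lemma sgnat_id x : sgnat A A 1 id x.
Proof. by move=> phi psi Ap Bp dx dfx; rewrite mul1r; exact: (oa_oriented hA Ap Bp I). Qed.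

Lemma sgnat_intro s f x phi psi : smap k A B f x -> A phi -> B psi -> chart_dom phi x ->
  chart_dom psi (f x) -> 0 < s * \det ('J (in_charts phi psi f) (chart_map phi x)) ->
  sgnat A B s f x.
Proof.
move=> hf Ap Bp dx dfx sf phi' psi' Ap' Bp' dx' dfx'.
have hi := smap_id hA x; have hi' := smap_id hB (f x).
have hif : smap k A B (f \o id) x by [].
(* Factoring [f] as [id o f o id] through [phi] and [psi] multiplies its determinant by those of two
   transition maps, positive in an oriented atlas. *)
have E1 := @det_charts_comp R n k k0 M N N A B B f id x phi' psi psi' Ap' Bp Bp' dx'
  dfx dfx' hf hi'.
have E2 := @det_charts_comp R n k k0 M M N A A B id f x phi' phi psi Ap' Ap Bp dx' dx
  dfx hi hf.
have E : \det ('J (in_charts phi' psi' f) (chart_map phi' x)) = _ :=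
  etrans E1 (congr1 ( *%R^~ _) E2).
rewrite {}E {E1 E2}.
have a1 : 0 < 1 * \det ('J (in_charts phi' phi id) (chart_map phi' x)).
  exact: (@sgnat_id x phi' phi Ap' Ap dx' dx).
have a2 : 0 < \det ('J (in_charts psi psi' id) (chart_map psi (f x))).
  exact: (oa_oriented hB Bp Bp' I).
rewrite mul1r in a1.
exact: mul3_gt0 a1 a2 sf.
Qed.

Lemma near_charts (f g : M -> N) x (phi : chart R n M) (psi : chart R n N) :
  (\forall y \near x, f y = g y) -> chart_dom phi x ->
  \forall z \near chart_map phi x, in_charts phi psi f z = in_charts phi psi g z.
Proof. by move=> fg dx; have := chart_inv_cvg dx fg; apply: filterS => z;
  rewrite /in_charts /= => ->. Qed.

Lemma smap_ext f g x : (\forall y \near x, f y = g y) -> smap k A B f x -> smap k A B g x.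
Proof.
move=> fg [cf hf]; split=> [|phi psi Ap Bp dx dgx];
  first exact: near_eq_continuous_at fg cf.
apply: C_at_ext (near_charts psi fg dx) _; apply: hf => //.
by rewrite (nbhs_singleton fg).
Qed.

Lemma sgnat_ext s f g x : (\forall y \near x, f y = g y) -> smap k A B f x ->
  sgnat A B s f x -> sgnat A B s g x.
Proof.
move=> fg [cf hf] sf phi psi Ap Bp dx dgx.
have dfx : chart_dom psi (f x) by rewrite (nbhs_singleton fg).
rewrite -(jacobian_ext (near_charts psi fg dx)); first exact: sf.
exact/(C_at_differentiable k0)/hf.
Qed.

Lemma sgnat_scale s s' f x : 0 < s * s' -> sgnat A B s f x -> sgnat A B s' f x.
Proof.
move=> ss sf phi psi Ap Bp dx dgx; have := mulr_gt0 ss (sf phi psi Ap Bp dx dgx).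
have s0 : s != 0 by apply: contraTneq ss => ->; rewrite mul0r ltxx.
by rewrite mulrACA pmulr_rgt0 // lt_def mulf_neq0 //= -expr2 sqr_ge0.
Qed.

Lemma sgnat_unique s s' f x : sgnat A B s f x -> sgnat A B s' f x -> 0 < s * s'.
Proof.
move=> sf sf'; have [phi Ap dx] := oa_cover hA x; have [psi Bp dfx] := oa_cover hB (f x).
have a := sf _ _ Ap Bp dx dfx; have b := sf' _ _ Ap Bp dx dfx.
set d := \det _ in a b.
have d0 : d != 0 by apply: contraTneq a => ->; rewrite mulr0 ltxx.
have := mulr_gt0 a b; rewrite mulrACA pmulr_lgt0 //.
by rewrite lt_def mulf_neq0 //= -expr2 sqr_ge0.
Qed.

(** The Jacobian determinant is continuous in fixed charts. Openness of the sign condition later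
    makes the sign constant on connected domains. *)
Lemma sgnat_near s f x : (\forall y \near x, smap k A B f y) -> sgnat A B s f x ->
  \forall y \near x, sgnat A B s f y.
Proof.
move=> hf sf; have [phi Ap dx] := oa_cover hA x; have [psi Bp dfx] := oa_cover hB (f x).
have [cf /(_ _ _ Ap Bp dx dfx) h] := nbhs_singleton hf.
have c := C_at_jacobian_continuous k0 h.
have : {for chart_map phi x, continuous (fun z => s * \det ('J (in_charts phi psi f) z))}.
  by apply: continuousM => //; exact: cst_continuous.
move=> /cvgr_gt /(_ _ (sf _ _ Ap Bp dx dfx)) /(chart_near dx) n1.
have n2 := cf _ (chart_nbhs dfx); have n3 := chart_nbhs dx.
near=> y; apply: (@sgnat_intro _ _ _ phi psi) => //.
- by near: y.
- by near: y.
- by near: y; exact: n2.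
- by near: y.
Unshelve. all: by end_near. Qed.
End Two.

Section Inv.
Variables (M N : topologicalType) (A : set (chart R n M)) (B : set (chart R n N)).
Hypothesis (hA : oriented_atlas k A) (hB : oriented_atlas k B).

(** Near the point [g o f] reads as the identity in the chart [phi], so the determinants are inverse
    to each other. *)
Lemma det_local_inverse f g x phi psi : A phi -> B psi -> chart_dom phi x ->
  chart_dom psi (f x) ->
  smap k A B f x -> smap k B A g (f x) -> (\forall y \near x, g (f y) = y) ->
  \det ('J (in_charts phi psi f) (chart_map phi x)) *
  \det ('J (in_charts psi phi g) (chart_map psi (f x))) = 1.
Proof.
move=> Ap Bp dx dfx hf hg gf.
have dgx : chart_dom phi (g (f x)) by rewrite (nbhs_singleton gf).
rewrite -(det_charts_comp k0 Ap Bp Ap) //.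
have gf' : \forall y \near x, y = (g \o f) y by apply: filterS gf => y /= ->.
rewrite -(jacobian_ext (near_charts phi gf' dx)).
  have nd : \forall z \near chart_map phi x, z = in_charts phi phi id z.
    have : nbhs (chart_map phi x) (chart_map phi @` chart_dom phi).
      by apply: open_nbhs_nbhs; split; [exact: chart_img_open|exists x].
    by apply: filterS => _ [y dy <-]; rewrite in_chartsE.
  have did : differentiable (@id 'rV[R]_n) (chart_map phi x) by [].
  apply: etrans (congr1 determinant (esym (@jacobian_ext R n n id _ _ nd did))) _.
  by rewrite (jacobian_id (chart_map phi x)) det1.
by apply: (C_at_differentiable k0); case: (smap_id hA x) => _; exact.
Qed.

Lemma sgnat_exists f g x : smap k A B f x -> smap k B A g (f x) ->
  (\forall y \near x, g (f y) = y) -> sgnat A B 1 f x \/ sgnat A B (-1) f x.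
Proof.
move=> hf hg gf; have [phi Ap dx] := oa_cover hA x; have [psi Bp dfx] := oa_cover hB (f x).
have [dp|dn] := mul_eq1_sign (det_local_inverse Ap Bp dx dfx hf hg gf).
  by left; exact: (sgnat_intro hA hB hf Ap Bp dx dfx).
by right; exact: (sgnat_intro hA hB hf Ap Bp dx dfx).
Qed.

Lemma sgnat_inverse s f g x : smap k A B f x -> smap k B A g (f x) ->
  (\forall y \near x, g (f y) = y) -> sgnat A B s f x -> sgnat B A s g (f x).
Proof.
move=> hf hg gf sf; have [phi Ap dx] := oa_cover hA x;
  have [psi Bp dfx] := oa_cover hB (f x).
have dgx : chart_dom phi (g (f x)) by rewrite (nbhs_singleton gf).
apply: (sgnat_intro hB hA hg Bp Ap dfx dgx).
exact: mul_eq1_gt0 (det_local_inverse Ap Bp dx dfx hf hg gf) (sf _ _ Ap Bp dx dfx).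
Qed.
End Inv.

Section ChartEmb.
Variables (M : topologicalType) (A : set (chart R n M)).
Hypothesis (hA : oriented_atlas k A).
Let E := @euclidean_atlas R n.

Lemma smap_chart phi x : A phi -> chart_dom phi x -> smap k A E (chart_map phi) x.
Proof.
move=> Ap dx; apply: (smap_intro hA hE (chart_map_continuous dx) Ap (erefl : E
  (@id_chart R n)) dx I).
by have [_ /(_ phi phi Ap Ap dx dx)] := smap_id hA x.
Qed.

Lemma smap_chart_inv phi x : A phi -> chart_dom phi x ->
  smap k E A (chart_inv phi) (chart_map phi x).
Proof.
move=> Ap dx; have dx' : chart_dom phi (chart_inv phi (chart_map phi x)) by rewrite chartK.
have c : {for chart_map phi x, continuous (chart_inv phi)}.
  by apply: chart_inv_continuous; exists x.
apply: (smap_intro hE hA c (erefl : E (@id_chart R n)) Ap I dx').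
by have [_ /(_ phi phi Ap Ap dx dx)] := smap_id hA x.
Qed.

Lemma sgnat_chart_inv phi x : A phi -> chart_dom phi x ->
  sgnat E A 1 (chart_inv phi) (chart_map phi x).
Proof.
move=> Ap dx; have dx' : chart_dom phi (chart_inv phi (chart_map phi x)) by rewrite chartK.
apply: (sgnat_intro hE hA (smap_chart_inv Ap dx) (erefl : E (@id_chart R n)) Ap I dx').
exact: (@sgnat_id M A hA x phi phi Ap Ap dx dx).
Qed.
End ChartEmb.
End Sgn.

(** * Ambient diffeomorphisms, and their transplantation through embeddings *)

Section Diffeos.
Variables (R : realType) (n : nat) (k : smoothness).
Hypothesis k0 : k <> Cfin 0.
Variables (M : topologicalType) (A : set (chart R n M)).
Hypothesis (hA : oriented_atlas k A) (hM : hausdorff_space M).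
Let E := @euclidean_atlas R n.
Let hE : oriented_atlas k E := @euclidean_oriented_atlas R n k.
Implicit Types (U : set M) (H : M -> M).

(* Equality to the identity off [U] is all that is needed in the sequel: the
   supports need not be compact in [U]. *)
Record opdiff U H H' : Prop := OpDiff {
  od_smooth : forall x, smap k A A H x;
  od_smooth_inv : forall x, smap k A A H' x;
  od_K : cancel H H';
  od_invK : cancel H' H;
  od_off : forall x, ~ U x -> H x = x;
  od_sign : forall x, sgnat A A 1 H x
}.

Lemma opdiff_id U : opdiff U id id.
Proof.
by split => // x; [exact: smap_id|exact: smap_id|exact: (sgnat_id hA)].
Qed.

Lemma opdiff_sub U V H H' : U `<=` V -> opdiff U H H' -> opdiff V H H'.
Proof.
by move=> UV [h1 h2 h3 h4 h5 h6]; split => // x Vx; apply: h5 => /UV.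
Qed.

Lemma opdiff_inv U H H' : opdiff U H H' -> opdiff U H' H.
Proof.
move=> [h1 h2 h3 h4 h5 h6]; split => // x.
  by move=> Ux; rewrite -{1}(h5 x Ux) h3.
rewrite -{1}[x]h4; apply: (sgnat_inverse k0 hA hA (h1 _) (h2 _) _ (h6 _)).
by apply: nearW => y; exact: h3.
Qed.

Lemma opdiff_comp U H H' G G' : opdiff U H H' -> opdiff U G G' ->
  opdiff U (G \o H) (H' \o G').
Proof.
move=> [h1 h2 h3 h4 h5 h6] [g1 g2 g3 g4 g5 g6]; split => x.
- exact: (smap_comp hA (h1 _) (g1 _)).
- exact: (smap_comp hA (g2 _) (h2 _)).
- by rewrite /= g3 h3.
- by rewrite /= h4 g4.
- by move=> Ux; rewrite /= h5 // g5.
- by have := sgnat_comp k0 hA (h1 x) (g1 _) (h6 x) (g6 _); rewrite mul1r.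
Qed.

Record embedding (O : set 'rV[R]_n) (s : R) (f : 'rV[R]_n -> M) (f' : M ->
  'rV[R]_n) : Prop := Embedding {
  em_open : open O;
  em_img : open (f @` O);
  em_smooth : forall x, O x -> smap k E A f x;
  em_smooth_inv : forall x, O x -> smap k A E f' (f x);
  em_K : forall x, O x -> f' (f x) = x;
  em_sign : forall x, O x -> sgnat E A s f x
}.

(** The membership test guards against the values of [f'] off the image of [f], which are
    arbitrary. *)
Definition transplant (O : set 'rV[R]_n) (f : 'rV[R]_n -> M) (f' : M -> 'rV[R]_n)
  (h : 'rV[R]_n -> 'rV[R]_n) (x : M) : M :=
  if x \in f @` O then f (h (f' x)) else x.

(** If [h z] is outside [K] then [h] fixes it, and injectivity forces [h z = z]. *)
Lemma fixed_off_stable (T : Type) (O K : set T) (h h' : T -> T) : cancel h h' -> K `<=` O ->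
  (forall z, ~ K z -> h z = z) -> forall z, O z -> O (h z).
Proof.
move=> hK KO off z Oz; have [Kz|Kz] := pselect (K (h z)); first exact: KO.
by have := off _ Kz => /(can_inj hK) ->.
Qed.

Section Transplant.
Variables (O : set 'rV[R]_n) (s : R) (f : 'rV[R]_n -> M) (f' : M -> 'rV[R]_n).
Hypothesis (s0 : s != 0) (ef : embedding O s f f').
Variable (K : set 'rV[R]_n).
Hypotheses (cK : compact K) (KO : K `<=` O).

(** Hausdorffness enters here: the complement of [f @] K[is open, so a transplanted map is the
    identity near every point outside]f @[O]. *)
Lemma image_compact_closed : closed (f @` K).
Proof.
apply: (compact_closed hM); apply: continuous_compact cK.
by apply: continuous_in_subspaceT => x; rewrite inE => /KO /(em_smooth ef) [].
Qed.

Lemma transplantE h z : O z -> transplant O f f' h (f z) = f (h z).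
Proof.
move=> Oz; rewrite /transplant ifT; first by rewrite (em_K ef).
by rewrite inE; exists z.
Qed.

Lemma transplant_off h x : ~ (f @` O) x -> transplant O f f' h x = x.
Proof. by move=> nx; rewrite /transplant ifF //; apply/negbTE; rewrite notin_setE. Qed.

Section One.
Variables (h h' : 'rV[R]_n -> 'rV[R]_n).
Hypotheses (hK : cancel h h') (off : forall z, ~ K z -> h z = z).
Let hO := fixed_off_stable hK KO off.

Lemma transplant_fix x : ~ (f @` K) x -> transplant O f f' h x = x.
Proof.
move=> nKx; have [[z Oz zx]|Ox] := pselect ((f @` O) x); last exact: transplant_off.
by rewrite -zx transplantE // off // => Kz; apply: nKx; exists z.
Qed.

Hypothesis hC : forall z, C_at k h z.

Lemma transplant_near z : O z ->
  \forall y \near f z, ((f \o h) \o f') y = transplant O f f' h y.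
Proof.
move=> Oz; have : nbhs (f z) (f @` O) by apply: open_nbhs_nbhs; split;
  [exact: em_img ef|exists z].
by apply: filterS => _ [w Ow <-]; rewrite transplantE //= (em_K ef).
Qed.

Lemma transplant_near_off x : ~ (f @` O) x -> \forall y \near x, y = transplant O f f' h y.
Proof.
move=> nx; have : nbhs x (~` (f @` K)).
  apply: open_nbhs_nbhs; split; first by rewrite openC; exact: image_compact_closed.
  by move=> [z /KO Oz zx]; apply: nx; exists z.
by apply: filterS => y ny; rewrite transplant_fix.
Qed.

Lemma smap_transplant_in z : O z -> smap k E A (f \o h) z.
Proof.
move=> Oz; apply: (smap_comp hE (B := E)); last by apply: (em_smooth ef); exact: hO.
by apply/smap_euclideanP; exact: hC.
Qed.

(** [M] is covered by two open sets, [f @] O[and the complement of]f @[K]; the map is [f o h o f']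
    on the first and the identity on the second. *)
Lemma smap_transplant x : smap k A A (transplant O f f' h) x.
Proof.
have [[z Oz <-]|Ox] := pselect ((f @` O) x).
  apply: smap_ext (transplant_near Oz) _.
  apply: (smap_comp hE (B := E)); first exact: em_smooth_inv ef _ Oz.
  by rewrite (em_K ef) //; exact: smap_transplant_in.
apply: smap_ext (transplant_near_off Ox) _; exact: smap_id.
Qed.

Hypothesis hJ : forall z, 0 < \det ('J h z).

Lemma sgnat_transplant x : sgnat A A 1 (transplant O f f' h) x.
Proof.
have [[z Oz <-]|Ox] := pselect ((f @` O) x); last first.
  apply: (@sgnat_ext R n k k0 M M A A 1 id _ x (transplant_near_off Ox)).
    exact: smap_id.
  exact: (sgnat_id hA).
have hh : smap k E E h z by apply/smap_euclideanP; exact: hC.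
have sh : sgnat E E 1 h z by apply/sgnat_euclidean; rewrite mul1r.
have sf' : sgnat A E s f' (f z).
  apply: (sgnat_inverse k0 hE hA (em_smooth ef Oz) (em_smooth_inv ef Oz) _ (em_sign ef Oz)).
  have : nbhs z O by apply: open_nbhs_nbhs; split=> //; exact: em_open ef.
  by apply: filterS => w Ow; exact: em_K ef _ Ow.
have Ohz := hO Oz.
have sfh := sgnat_comp k0 hE hh (em_smooth ef Ohz) sh (em_sign ef Ohz).
have S : smap k A A ((f \o h) \o f') (f z).
  apply: (smap_comp hE (B := E)); first exact: em_smooth_inv ef _ Oz.
  by rewrite (em_K ef) //; exact: smap_transplant_in.
apply: (sgnat_ext k0 (transplant_near Oz) S).
(* [f'], [h] and [f] have signs [s], 1 and [s], and [s * s] is positive. *)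
apply: (@sgnat_scale _ _ _ _ _ _ (s * (1 * s))).
  by rewrite mul1r mulr1 -expr2 lt_def sqrf_eq0 s0 sqr_ge0.
apply: (sgnat_comp k0 hE (em_smooth_inv ef Oz)) sf' _; rewrite (em_K ef) //.
exact: smap_transplant_in.
Qed.
End One.

Lemma transplant_opdiff U h h' : f @` O `<=` U -> cancel h h' -> cancel h' h ->
  (forall z, C_at k h z) -> (forall z, C_at k h' z) -> (forall z, ~ K z -> h z = z) ->
  (forall z, 0 < \det ('J h z)) ->
  opdiff U (transplant O f f' h) (transplant O f f' h').
Proof.
move=> OU hK h'K hC h'C off hJ.
have off' z : ~ K z -> h' z = z by move=> Kz; rewrite -{1}(off z Kz) hK.
have canc g g' : cancel g g' -> (forall z, ~ K z -> g z = z) ->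
    cancel (transplant O f f' g) (transplant O f f' g').
  move=> gK offg x; have [[z Oz <-]|Ox] := pselect ((f @` O) x).
    by rewrite !transplantE // ?gK //; exact: (fixed_off_stable gK KO offg).
  by rewrite !transplant_off.
split.
- exact: smap_transplant hK off hC.
- exact: smap_transplant h'K off' h'C.
- exact: canc.
- exact: canc.
- by move=> x nU; apply: transplant_off => /OU.
- exact: sgnat_transplant hK off hC hJ.
Qed.

Lemma field_opdiff U w : f @` O `<=` U -> C_on k setT w -> (forall z, ~ K z -> w z = 0) ->
  (forall x v, `|'D_v w x| <= 2^-1 * `|v|) ->
  exists H H', opdiff U H H' /\ forall z, O z -> H (f z) = f (z + w z).
Proof.
move=> OU Cw off hw; have [g [hg gh Ch Cg Jh]] := near_id_diffeo k0 Cw hw.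
exists (transplant O f f' (fun x => x + w x)), (transplant O f f' g); split.
  apply: transplant_opdiff => //.
  - by move=> z; exact: C_at_on openT I Ch.
  - by move=> z; exact: C_at_on openT I Cg.
  - by move=> z /off ->; rewrite addr0.
by move=> z Oz; rewrite transplantE.
Qed.
End Transplant.

End Diffeos.

(** * Derivative bounds for compactly supported fields, and Euclidean balls *)

Section Bounds.
Variables (R : realType) (n : nat).

Lemma CR1_derive_bound (f : 'rV[R]_n -> R) (K : set 'rV[R]_n) :
  CR 1 setT f -> compact K -> (forall z, ~ K z -> f z = 0) ->
  exists2 B, 0 <= B & forall x v, `|'D_v f x| <= B * `|v|.
Proof.
move=> [df Df] cK off.
have dw x : differentiable f x by exact: df.
have KC : closed K by apply: compact_closed cK; exact: norm_hausdorff.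
have bnd (l : 'I_n) : exists B : R, 0 <= B /\ forall x, `|'D_(delta_mx ord0 l) f x| <= B.
  have D0 x : ~ K x -> 'D_(delta_mx ord0 l) f x = 0.
    move=> Kx; rewrite -(@derive_cst R _ _ (0 : R) x (delta_mx ord0 l)).
    apply: near_eq_derive; have : nbhs x (~` K) by apply: open_nbhs_nbhs; split => //;
      rewrite openC.
    by apply: filterS => y /off.
  (* The maximum is taken over [K], so the empty support is set apart. *)
  have [K0|/set0P K0] := eqVneq K set0.
    by exists 0; split=> // x; rewrite D0 ?normr0 // K0.
  have [|c _ hc] := @compact_EVT_max _ R (fun x => `|'D_(delta_mx ord0 l) f x|) K K0 cK.
    apply: continuous_subspaceT => x.
    apply: (@continuous_comp _ _ _ (fun x => 'D_(delta_mx ord0 l) f x) (fun y => `|y|)).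
      exact: (Df (delta_mx ord0 l) x I).
    exact: norm_continuous.
  exists `|'D_(delta_mx ord0 l) f c|; split => // x.
  have [Kx|Kx] := pselect (K x); first by apply: hc; rewrite inE.
  by rewrite D0 // normr0.
have /choice[B hB] := bnd.
exists (\sum_l B l) => [|x v]; first by apply: sumr_ge0 => l _; case: (hB l).
rewrite derive_row_sum // (le_trans (ler_norm_sum _ _ _)) // mulr_suml ler_sum // => l _.
rewrite normrM mulrC; apply: ler_pM => //; first by case: (hB l).
exact: coord_norm_le.
Qed.

Lemma C_on_derive_bound k m (w : 'rV[R]_n -> 'rV[R]_m) (K : set 'rV[R]_n) : k <> Cfin 0 ->
  C_on k setT w -> compact K -> (forall z, ~ K z -> w z = 0) ->
  exists2 B, 0 <= B & forall x v, `|'D_v w x| <= B * `|v|.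
Proof.
move=> k0 Cw cK off.
have bnd (i : 'I_m) : exists B : R, 0 <= B /\ forall x v, `|'D_v (fun x =>
  w x ord0 i) x| <= B * `|v|.
  have [||B B0 hB] := @CR1_derive_bound (fun x => w x ord0 i) K _ cK.
  - by move/(C_onP _ _ openT): Cw => /(_ 1%N (jle1 k0)).
  - by move=> z /off ->; rewrite mxE.
  by exists B.
have /choice[B hB] := bnd.
have B0 l : 0 <= B l by case: (hB l).
exists (\sum_l B l) => [|x v]; first exact: sumr_ge0.
apply: row_norm_le => [|i]; first by rewrite mulr_ge0 // sumr_ge0.
rewrite derive_row; last exact: (C_on_differentiable k0 openT Cw).
have [_ /(_ x v) h] := hB i; rewrite (le_trans h) // ler_wpM2r // (bigD1 i) //= lerDl.
exact: sumr_ge0.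
Qed.

Lemma small_field k (w : 'rV[R]_n -> 'rV[R]_n) (K : set 'rV[R]_n) : k <> Cfin 0 ->
  C_on k setT w -> compact K -> (forall z, ~ K z -> w z = 0) ->
  exists2 eta, 0 < eta & forall t, `|t| <= eta ->
    forall x v, `|'D_v (t \*: w) x| <= 2^-1 * `|v|.
Proof.
move=> k0 Cw cK off; have [B B0 hB] := C_on_derive_bound k0 Cw cK off.
(* [B + 1] replaces the bound [B], which may be 0. *)
exists (2 * (B + 1))^-1 => [|t ht x v].
  by rewrite invr_gt0 mulr_gt0 // ltr_wpDl.
rewrite deriveZ; last exact/diff_derivable/(C_on_differentiable k0 openT Cw).
rewrite normrZ (le_trans (ler_wpM2l _ (hB x v))) // mulrA ler_wpM2r //.
move: ht; rewrite -[(2 * _)^-1]div1r ler_pdivlMr; last by rewrite mulr_gt0 // ltr_wpDl.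
have := normr_ge0 t; set u := `|t|; lra.
Qed.

(** [r] is a squared radius, matching the parameters of [bump]. *)
Definition sball (c : 'rV[R]_n) r : set 'rV[R]_n := [set z | sqn (z - c) < r].
Definition csball (c : 'rV[R]_n) r : set 'rV[R]_n := [set z | sqn (z - c) <= r].

Lemma sqn_shift_continuous (c : 'rV[R]_n) : continuous (fun z => sqn (z - c)).
Proof.
move=> z; apply: (@continuous_comp _ _ _ (fun z => z - c) (@sqn R n));
  last exact: sqn_continuous.
apply: continuousB; [exact: cvg_id|exact: cst_continuous].
Qed.

Lemma sball_open c r : open (sball c r).
Proof.
apply: open_comp (@open_lt R r) => z _; exact: sqn_shift_continuous.
Qed.

Lemma csball_compact c r : compact (csball c r).
Proof.
apply: bounded_closed_compact; last first.
  apply: (@preimage_closed _ _ (fun z => sqn (z - c)) [set y | y <= r]);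
    last exact: closed_le.
  by move=> z _; exact: sqn_shift_continuous.
(* With [u = |z - c|] and [u^2 <= r], one has [u <= 1 + u^2 <= 1 + r <= 2 + r^2]; no square root is
   taken. *)
exists (`|c| + (1 + r ^+ 2 + 1)); split; first exact: num_real.
move=> B hB z hz /=; rewrite /csball /= in hz.
apply: le_trans _ (ltW hB).
have -> : z = c + (z - c) by rewrite addrC subrK.
rewrite (le_trans (ler_normD _ _)) // lerD2l.
have := le_trans (sqn_norm _) hz; set u := `|z - c| => ur.
have u1 : u <= 1 + u ^+ 2 by nra.
have r1 : r <= 1 + r ^+ 2 by nra.
lra.
Qed.

Lemma csball_sub_sball c a b : a < b -> csball c a `<=` sball c b.
Proof. by move=> ab z /le_lt_trans; apply. Qed.

Lemma nbhs_sball c (V : set 'rV[R]_n) : nbhs c V -> exists2 r, 0 < r & sball c r `<=` V.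
Proof.
move=> /nbhs_ballP [d d0 h]; exists (d ^+ 2) => [|z hz]; first by rewrite exprn_gt0.
apply: h; rewrite -ball_normE /= distrC.
have := le_lt_trans (sqn_norm _) hz.
by rewrite ltr_pXn2r // ?nnegrE // ltW.
Qed.

Lemma CR_bump_shift a b c j : CR j setT (fun z : 'rV[R]_n => bump a b (z - c)).
Proof.
apply: (@CR_comp _ _ _ _ setT setT (@bump R n a b) (fun z => z - c) openT openT) => [//|i|].
  apply: (CR_ext (f := fun z => z ord0 i - c ord0 i) openT) => [z _|];
    first by rewrite !mxE.
  by apply: (CR_add openT); [exact: CR_coord|exact: CR_cst].
exact: CR_bump openT.
Qed.
End Bounds.

(** * Germs of embeddings *)

Section Deriv.
Variable R : realType.

Lemma derive_comp (V W X : normedModType R) (g : W -> X) (f : V -> W) x v :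
  differentiable f x -> differentiable g (f x) -> 'D_v (g \o f) x = 'D_('D_v f x) g (f x).
Proof.
move=> df dg; rewrite (deriveE _ (differentiable_comp df dg)) diff_comp //=.
by rewrite (deriveE _ df) (deriveE _ dg).
Qed.

Lemma is_derive_affine n m (c : 'rV[R]_n) (L : 'M[R]_(n, m)) z v :
  differentiable (fun z => (z - c) *m L) z /\ 'D_v (fun z => (z - c) *m L) z = v *m L.
Proof.
have E : (fun z => (z - c) *m L) = mulmxr L \o (id - cst c : 'rV[R]_n -> 'rV[R]_n).
  by apply/funext.
have dB : differentiable (id - cst c : 'rV[R]_n -> 'rV[R]_n) z by exact: differentiableB.
have dL (y : 'rV[R]_n) : differentiable (mulmxr L : 'rV[R]_n -> 'rV[R]_m) y.
  by apply: linear_differentiable; exact: (@continuous_mulmxr R n m L).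
rewrite E; split; first exact: differentiable_comp.
rewrite derive_comp // deriveB; [|exact: derivable_id|exact: derivable_cst].
rewrite derive_id derive_cst subr0 deriveE // diff_lin //;
  exact: (@continuous_mulmxr R n m L).
Qed.

Lemma C_on_affine n m k S (c : 'rV[R]_n) (L : 'M[R]_(n, m)) : open S ->
  C_on k S (fun z => (z - c) *m L).
Proof.
move=> oS; apply: (C_on_comp (V := setT) oS openT (f := fun z =>
  z - c) (g := mulmx^~ L)) => //.
  by apply: C_on_add (C_on_id _ _) _ => //; exact: (C_on_cst _ (- c)).
exact: C_on_mulmx openT.
Qed.

Lemma derive_bound_near n m (p : 'rV[R]_n -> 'rV[R]_m) c e : 0 < e ->
  (\forall z \near c, differentiable p z) ->
  (forall v i, {for c, continuous (fun z => 'D_v p z ord0 i)}) ->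
    (forall v, 'D_v p c = 0) ->
  \forall z \near c, forall v, `|'D_v p z| <= e * `|v|.
Proof.
move=> e0 dp cp p0.
(* The [n] partial derivatives share [e]; the successor keeps the division meaningful for
   [n = 0]. *)
have e1 : 0 < e / n.+1%:R by rewrite divr_gt0.
have : \forall z \near c, forall li : 'I_n * 'I_m,
  `|'D_(delta_mx ord0 li.1) p z ord0 li.2| < e / n.+1%:R.
  apply: (@filter_forall _ _ (fun (li : 'I_n * 'I_m) =>
    [set z : 'rV[R]_n | `|'D_(delta_mx ord0 li.1) p z ord0 li.2| < e / n.+1%:R]) (nbhs c)).
  move=> [l i] /=.
  have := cvgr_norm_lt _ (cp (delta_mx ord0 l) i).
  by apply; rewrite p0 mxE normr0.
apply: filterS2 dp => z dz h v.
apply: row_norm_le => [|i]; first by rewrite mulr_ge0 // ltW.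
rewrite derive_row_sum // summxE (le_trans (ler_norm_sum _ _ _)) //.
apply: (@le_trans _ _ (\sum_(l < n) (e / n.+1%:R) * `|v|)).
  apply: ler_sum => l _; rewrite mxE normrM mulrC; apply: ler_pM => //.
    exact/ltW/(h (l, i)).
  exact: coord_norm_le.
rewrite sumr_const card_ord.
have -> : e / n.+1%:R * `|v| *+ n = e * (n%:R / n.+1%:R) * `|v|.
  rewrite -[LHS]mulr_natr; ring.
rewrite ler_wpM2r // ler_piMr ?(ltW e0) // ler_pdivrMr // mul1r ler_nat.
exact: leqnSn.
Qed.
End Deriv.

Section Germs.
Variables (R : realType) (n : nat) (k : smoothness).
Hypothesis k0 : k <> Cfin 0.
Variables (M : topologicalType) (A : set (chart R n M)).
Hypothesis (hA : oriented_atlas k A) (hM : hausdorff_space M).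
Implicit Types (U : set M) (f g : 'rV[R]_n -> M).

Definition germ_equiv U f g := exists H H',
  opdiff k A U H H' /\ \forall x \near (0 : 'rV[R]_n), H (f x) = g x.

Lemma germ_equiv_near U f g : (\forall x \near (0 : 'rV[R]_n), f x = g x) ->
  germ_equiv U f g.
Proof. by move=> fg; exists id, id; split => //; exact: opdiff_id. Qed.

Lemma germ_equiv_sym U f g : germ_equiv U f g -> germ_equiv U g f.
Proof.
move=> [H [H' [HH fg]]]; exists H', H; split; first exact: opdiff_inv.
by apply: filterS fg => x <-; rewrite (od_K HH).
Qed.

Lemma germ_equiv_trans U f g h : germ_equiv U f g -> germ_equiv U g h -> germ_equiv U f h.
Proof.
move=> [H [H' [HH fg]]] [G [G' [GG gh]]]; exists (G \o H), (H' \o G'); split.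
  exact: opdiff_comp.
by apply: filterS2 fg gh => x /= -> ->.
Qed.

Section Local.
Variables (U : set M) (c : 'rV[R]_n) (r s : R) (f : 'rV[R]_n -> M) (f' : M -> 'rV[R]_n).
Hypotheses (r0 : 0 < r) (s0 : s != 0) (ef : embedding k A (sball c r) s f f')
  (fU : f @` sball c r `<=` U).
Implicit Types (F G : 'rV[R]_n -> 'rV[R]_n).

(* Germs [F], [G] at 0 of maps into the chart ball [sball c r]. *)
Definition leqv F G := germ_equiv U (f \o F) (f \o G).

Lemma leqv_near F G : (\forall x \near (0 : 'rV[R]_n), F x = G x) -> leqv F G.
Proof. by move=> FG; apply: germ_equiv_near; apply: filterS FG => x /= ->. Qed.

Lemma leqv_eq F G : (forall x, F x = G x) -> leqv F G.
Proof.
move=> /funext ->; exists id, id; split; [exact: opdiff_id|near=> x].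
Unshelve. all: by end_near. Qed.

Lemma leqv_field F w (K : set 'rV[R]_n) : compact K -> K `<=` sball c r ->
  C_on k setT w -> (forall z, ~ K z -> w z = 0) ->
  (forall x v, `|'D_v w x| <= 2^-1 * `|v|) ->
  (\forall x \near (0 : 'rV[R]_n), sball c r (F x)) -> leqv F (fun x => F x + w (F x)).
Proof.
move=> cK KO Cw off hw nF.
have [H [H' [HH Hf]]] := field_opdiff k0 hA hM s0 ef cK KO fU Cw off hw.
by exists H, H'; split => //; apply: filterS nF => x /Hf.
Qed.

(** Where the cut-off is 1 the field acts as [w] itself. [eta] is chosen before [F], so one step
    size serves a whole chain of germs. *)
Lemma leqv_bump_field w a b : 0 <= a -> a < b -> b < r -> C_on k setT w ->
  exists2 eta, 0 < eta & forall t, `|t| <= eta -> forall F,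
    (\forall x \near (0 : 'rV[R]_n), sqn (F x - c) < a) ->
      leqv F (fun x => F x + t *: w (F x)).
Proof.
move=> a0 ab br Cw.
pose W z := bump a b (z - c) *: w z.
have CW : C_on k setT W by apply: C_on_scale openT _ Cw => j; exact: CR_bump_shift.
have offW z : ~ csball c b z -> W z = 0.
  move=> /negP; rewrite -ltNge => zb; rewrite /W bump_eq0 ?scale0r //; exact: ltW.
have [eta e0 he] := small_field k0 CW (@csball_compact _ _ c b) offW.
exists eta => // t te F nF.
apply: (@germ_equiv_trans _ _ (f \o (fun x => F x + (t \*: W) (F x)))); last first.
  apply: leqv_near; apply: filterS nF => x Fx; rewrite /= /W bump_eq1 ?scale1r //;
    exact: ltW.
apply: (leqv_field (@csball_compact _ _ c b)) => //.
- exact: csball_sub_sball.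
- apply: (@C_on_ext _ _ _ _ _ (fun z => cst t z *: W z) _ openT) => //.
  by apply: C_on_scale openT _ CW => j; exact: CR_cst.
- by move=> z /offW /= ->; rewrite scaler0.
- exact: he.
- by apply: filterS nF => x Fx; apply: (lt_trans Fx); exact: lt_trans br.
Qed.

(** [F 0] moves to the centre along a segment; the distance to [c] decreases, so every intermediate
    germ stays in the region where the cut-off is 1. *)
Lemma leqv_translate F : {for (0 : 'rV[R]_n), continuous F} -> sball c r (F 0) ->
  leqv F (fun x => F x + (c - F 0)).
Proof.
move=> cF F0; set v := c - F 0.
(* [a] and [b] cut the interval from [sqn (F 0 - c)] to [r] into thirds. *)
have [a [b [Fa ab br]]] : exists a b, [/\ sqn (F 0 - c) < a, a < b & b < r].
  rewrite /sball /= in F0; set q := sqn _ in F0 *.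
  exists ((2 * q + r) / 3), ((q + 2 * r) / 3); split; lra.
have a0 : 0 <= a by rewrite (le_trans _ (ltW Fa)) // sqn_ge0.
have [eta e0 he] := @leqv_bump_field (cst v) a b a0 ab br (C_on_cst _ _ openT).
have [m hm] : exists m : nat, m.+1%:R^-1 < eta.
  by exists (Num.truncn eta^-1); rewrite invf_plt ?posrE // truncnS_gt.
have step j : (j <= m.+1)%N -> leqv F (fun x => F x + (j%:R / m.+1%:R) *: v).
  elim: j => [_|j IH jm]; first by apply: leqv_eq => x; rewrite mul0r scale0r addr0.
  have jm' := ltnW jm.
  apply: germ_equiv_trans (IH jm') _; set G := (fun x => F x + _).
  apply: (@germ_equiv_trans _ _ (f \o (fun x => G x + m.+1%:R^-1 *: v))); last first.
    apply: leqv_eq => x; rewrite /G -addrA -scalerDl.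
    by rewrite -[in j.+1%:R]natr1 mulrDl mul1r.
  apply: (he m.+1%:R^-1); first by rewrite ger0_norm ?invr_ge0 // ltW.
  have cG : {for (0 : 'rV[R]_n), continuous (fun x => sqn (G x - c))}.
    apply: (@continuous_comp _ _ _ G (fun z => sqn (z - c)));
      last exact: sqn_shift_continuous.
    apply: (@continuousD _ _ _ F (cst ((j%:R / m.+1%:R) *: v)) 0 cF); exact: cst_continuous.
  apply: (cvgr_lt _ cG); apply: le_lt_trans Fa.
  have -> : G 0 - c = (1 - j%:R / m.+1%:R) *: (F 0 - c).
    rewrite /G /v; set t := _ / _; rewrite scalerBl scale1r -[c - F 0]opprB scalerN.
    by rewrite addrAC.
  rewrite sqnZ ler_piMl ?sqn_ge0 // expr_le1 // ?subr_ge0 ?lerBlDr.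
    by rewrite ler_pdivrMr // mul1r ler_nat.
apply: germ_equiv_trans (step m.+1 (leqnn _)) _.
by apply: leqv_eq => x; rewrite divff // scale1r.
Qed.

Lemma leqv_linear (L T : 'M[R]_n) : 0 < \det T ->
  leqv (fun x => c + x *m L) (fun x => c + x *m (L *m T)).
Proof.
(* Quantifying over [L] inside the property of [T] makes it closed under products; the field
   [(z - c) N] then realises [1 + t N]. *)
move=> dT; move: T dT L; apply: GLpos_small => [S T hS hT L|N].
  by apply: germ_equiv_trans (hS L) _; rewrite mulmxA; exact: hT.
have CN : C_on k setT (fun z : 'rV[R]_n => (z - c) *m N).
  exact: C_on_affine openT.
have r3 : 0 <= r / 3 by rewrite divr_ge0 // ltW.
have r32 : r / 3 < r / 2 by rewrite ltr_pM2l // ltf_pV2 ?posrE // ltr_nat.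
have r2 : r / 2 < r by rewrite ltr_pdivrMr // ltr_pMr // ltr1n.
have [a0 a00 he] := leqv_bump_field r3 r32 r2 CN.
exists a0 => // t te L.
apply: (@germ_equiv_trans _ _ (f \o (fun x =>
  (c + x *m L) + t *: ((c + x *m L - c) *m N)))); last first.
  apply: leqv_eq => x; rewrite -addrA; congr (_ + _).
  by rewrite (addrC c) addrK mulmxDr mulmx1 mulmxDr -!scalemxAr mulmxA.
apply: he => //.
have cG : {for (0 : 'rV[R]_n), continuous (fun x : 'rV[R]_n => sqn ((c + x *m L) - c))}.
  apply: (@continuous_comp _ _ _ (fun x : 'rV[R]_n => c + x *m L) (fun z =>
    sqn (z - c))); last exact: sqn_shift_continuous.
  apply: (@continuousD _ _ _ (cst c) (mulmxr L) 0); first exact: cst_continuous.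
  exact: (@continuous_mulmxr R n n L).
by apply: (cvgr_lt _ cG); rewrite mul0mx addr0 subrr sqn0 divr_gt0.
Qed.

(* The field moving c + x 'J F 0 to F x is p := F \o l - id, cut off at scale d
   around c.  Both |p(z)| / |z - c| and |Dp(z)| are small near c, so the factor
   1/d lost in differentiating the cut-off is absorbed by |p| <= 2 e d. *)
Lemma leqv_linearize F : C_at k F 0 -> F 0 = c -> 'J F 0 \in unitmx ->
  leqv (fun x => c + x *m 'J F 0) F.
Proof.
move=> [W [oW W0 CF]] F0 uJ; set J := 'J F 0 in uJ *; set Q := invmx J.
pose l z := (z - c) *m Q.
have dl z v : differentiable l z /\ 'D_v l z = v *m Q by exact: is_derive_affine.
have cl : continuous l by move=> z; apply: differentiable_continuous; case: (dl z 0).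
pose V := l @^-1` W.
have oV : open V by apply: open_comp => // z _; exact: cl.
have lc : l c = 0 by rewrite /l subrr mul0mx.
have Vc : V c by rewrite /V /= lc.
pose p z := F (l z) - z.
have Cl (S : set 'rV[R]_n) : open S -> C_on k S l.
  exact: C_on_affine.
have Cp : C_on k V p.
  apply: C_on_add => //; first by apply: (C_on_comp oV oW) CF => //; exact: Cl.
  apply: (@C_on_ext _ _ _ _ _ (mulmx^~ (- 1%:M))) => //; last exact: C_on_mulmx.
  by move=> x _; rewrite mulmxN mulmx1.
have dp z : V z -> differentiable p z by exact: (C_on_differentiable k0 oV Cp).
have dF : differentiable F 0 by exact: (C_on_differentiable k0 oW CF W0).
have Dp v : 'D_v p c = 0.
  have dlc : differentiable l c by case: (dl c 0).
  have dFl : differentiable F (l c) by rewrite lc.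
  rewrite -[LHS]/('D_v ((F \o l) - id) c) deriveB; last exact: derivable_id.
    rewrite derive_id derive_comp //; case: (dl c v) => _ ->; rewrite lc.
    by rewrite (deriveEjacobian _ dF) -/J mulmxKV // subrr.
  by apply/diff_derivable/differentiable_comp.
have pc : p c = 0 by rewrite /p lc F0 subrr.
have [B B0 hB] : exists2 B : R, 0 <= B & forall x v : 'rV[R]_n,
  `|'D_v (bump 1 2) x| <= B * `|v|.
  apply: (CR1_derive_bound (CR_bump 1 2 1 openT) (@csball_compact _ _ 0 2)) => z /negP.
  by rewrite /csball /= subr0 -ltNge => /ltW; apply: bump_eq0; rewrite ltr1n.
(* The final estimate is [e (2 B + 1) |v|]: one [e] from [Dp], and [2 B e] from [|p| <= 2 e d] times
   the derivative [B / d] of the cut-off. *)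
pose e : R := (2 * (2 * B + 1))^-1.
have e0 : 0 < e by rewrite invr_gt0 mulr_gt0 // ltr_wpDl // mulr_ge0.
have [rho rho0 hrho] : exists2 rho, 0 < rho & sball c rho `<=` [set z |
    [/\ V z, sball c r z, `|p z| <= e * `|z - c| & forall v, `|'D_v p z| <= e * `|v|]].
  apply: nbhs_sball.
  have n1 : nbhs c V by exact: open_nbhs_nbhs.
  have n2 : nbhs c (sball c r).
    apply: open_nbhs_nbhs; split; first exact: sball_open.
    by rewrite /sball /= subrr sqn0.
  have n3 : \forall z \near c, `|p z| <= e * `|z - c|.
    have := differentiable_approx (dp c Vc) e0.
    rewrite (near_shift c) sub0r; apply: filterS => z /=.
    by rewrite subrK pc subr0 -deriveE ?Dp ?subr0 //; exact: dp.
  have n4 : \forall z \near c, forall v, `|'D_v p z| <= e * `|v|.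
    apply: derive_bound_near => //; first by apply: filterS n1 => z; exact: dp.
    by move=> v i; exact: (@C_on_derive R n n k V p v i k0 oV Cp c Vc).
  by near=> z; split; near: z.
(* From [d <= 1] and [d <= rho / 4] follows [2 d^2 <= 2 d <= rho / 2]. *)
have [d d0 hd] : exists2 d : R, 0 < d & 2 * d ^+ 2 < rho.
  exists (Num.min 1 (rho / 4)); first by rewrite lt_min ltr01 divr_gt0.
  set d := Num.min _ _; have d1 : d <= 1 by rewrite ge_min lexx.
  have d2 : d <= rho / 4 by rewrite ge_min lexx orbT.
  have d0 : 0 < d by rewrite lt_min ltr01 divr_gt0.
  have : d ^+ 2 <= d by rewrite expr2 ler_piMl // ltW.
  by move=> ?; nra.
pose beta z := bump 1 2 (d^-1 *: (z - c)).
(* Written with a scalar matrix, the rescaling falls under [is_derive_affine]. *)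
have betaE z : beta z = bump 1 2 ((z - c) *m (d^-1)%:M) by rewrite mul_mx_scalar.
have Cbeta j : CR j setT beta.
  apply: (@CR_comp _ _ _ _ setT setT (@bump R n 1 2) (fun z =>
    d^-1 *: (z - c)) openT openT) => [//|i|].
    apply: (CR_ext (f := fun z => d^-1 * (z ord0 i - c ord0 i)) openT) => [z _|];
      first by rewrite !mxE.
    apply: (CR_mul openT); first exact: CR_cst.
    by apply: (CR_add openT); [exact: CR_coord|exact: CR_cst].
  exact: CR_bump openT.
have sqd y : sqn (d^-1 *: y : 'rV[R]_n) = sqn y / d ^+ 2 by rewrite sqnZ exprVn mulrC.
have d20 : 0 < d ^+ 2 by rewrite exprn_gt0.
have beta0 z : 2 * d ^+ 2 <= sqn (z - c) -> beta z = 0.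
  by move=> h; apply: bump_eq0; rewrite ?ltr1n // sqd ler_pdivlMr.
pose w z := beta z *: p z.
have w0 z : 2 * d ^+ 2 <= sqn (z - c) -> w z = 0 by move=> /beta0; rewrite /w => ->;
  rewrite scale0r.
have oK : open [set z : 'rV[R]_n | 2 * d ^+ 2 < sqn (z - c)].
  by apply: open_comp (@open_gt R _) => z _; exact: sqn_shift_continuous.
(* [p] is controlled only near [c]: inside radius [rho] the field is a product of C^k factors, and
   beyond [2 d^2] it is 0; these two open sets cover everything. *)
have Cw : C_on k setT w.
  apply: C_on_loc openT _ => z _.
  have [h|h] := ltP (sqn (z - c)) rho.
    exists (sball c rho); split => //; first exact: sball_open.
    apply: C_on_scale => [|j|]; first exact: sball_open.
      by apply: CR_sub (Cbeta j).
    apply: C_on_sub Cp => //; first exact: sball_open.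
    by move=> y /hrho [].
  exists [set z : 'rV[R]_n | 2 * d ^+ 2 < sqn (z - c)]; split => //=;
    first exact: lt_le_trans h.
  apply: (@C_on_ext _ _ _ _ _ (cst 0)) => //; last exact: C_on_cst.
  by move=> y /= hy; rewrite w0 // ltW.
have hw z v : `|'D_v w z| <= 2^-1 * `|v|.
  have [h|h] := leP (sqn (z - c)) (2 * d ^+ 2); last first.
    rewrite (_ : 'D_v w z = 0) ?normr0 ?mulr_ge0 //.
    rewrite -(@derive_cst R _ _ (0 : 'rV[R]_n) z v); apply: near_eq_derive.
    have : nbhs z [set z : 'rV[R]_n | 2 * d ^+ 2 < sqn (z - c)] by exact: open_nbhs_nbhs.
    by apply: filterS => y /= hy; rewrite w0 // ltW.
  have [Vz _ pz Dpz] := hrho z (le_lt_trans h hd).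
  have dpz := dp z Vz.
  have dbeta : differentiable beta z by case: (Cbeta 1%N) => + _; apply.
  have dw : differentiable w z by exact: (C_on_differentiable k0 openT Cw).
  (* A round bound: on the support [|z - c|^2 <= 2 d^2 <= 4 d^2]. *)
  have zc : `|z - c| <= 2 * d.
    have := le_trans (sqn_norm _) h; set u := `|z - c| => u2.
    rewrite -(@ler_pXn2r _ 2%N) ?nnegrE ?mulr_ge0 ?(ltW d0) ?normr_ge0 //.
    rewrite (le_trans u2) // exprMn ler_wpM2r ?(ltW d20) //; lra.
  have Dbeta : `|'D_v beta z| <= B * (d^-1 * `|v|).
    have [da Da] := is_derive_affine c (d^-1)%:M z v.
    have -> : beta = bump 1 2 \o (fun z => (z - c) *m (d^-1)%:M) by apply/funext =>
      y /=; rewrite betaE.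
    rewrite derive_comp //; last by case: (@CR_bump R n 1 2 1 setT openT) => + _; apply.
    rewrite Da; apply: le_trans (hB _ _) _.
    by rewrite mul_mx_scalar normrZ ger0_norm // invr_ge0 ltW.
  apply: row_norm_le => [|i]; first by rewrite mulr_ge0.
  rewrite derive_row //.
  have dpi : differentiable (fun y => p y ord0 i) z by move: i; apply/differentiable_row.
  have -> : 'D_v (fun y =>
    w y ord0 i) z = beta z * 'D_v p z ord0 i + p z ord0 i * 'D_v beta z.
    have -> : (fun y => w y ord0 i) = beta * (fun y => p y ord0 i).
      by apply/funext => y; rewrite /w mxE.
    rewrite deriveM; [|exact: diff_derivable|exact: diff_derivable].
    by rewrite derive_row.
  have /andP[b0 b1] := bump_le1 1 2 (d^-1 *: (z - c)).
  rewrite (le_trans (ler_normD _ _)) // (normrM (beta z)) (normrM (p z ord0 i)).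
  have h1 : `|beta z| * `|'D_v p z ord0 i| <= e * `|v|.
    rewrite -[leRHS]mul1r; apply: ler_pM => //; first by rewrite ger0_norm.
    exact: le_trans (coord_norm_le _ _) (Dpz v).
  have h2 : `|p z ord0 i| * `|'D_v beta z| <= (e * (2 * d)) * (B * (d^-1 * `|v|)).
    apply: ler_pM => //; apply: le_trans (coord_norm_le _ _) _; apply: le_trans pz _.
    by rewrite ler_wpM2l // ltW.
  apply: le_trans (lerD h1 h2) _.
  have -> : e * `|v| + e * (2 * d) * (B * (d^-1 * `|v|)) = e * (2 * B + 1) * `|v|.
    by field; rewrite gt_eqF.
  have B1 : 2 * B + 1 != 0 by rewrite gt_eqF // ltr_wpDl // mulr_ge0.
  by have -> : e * (2 * B + 1) = 2^-1 by rewrite /e; field.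
have cJ : {for (0 : 'rV[R]_n), continuous (fun x : 'rV[R]_n => sqn ((c + x *m J) - c))}.
  apply: (@continuous_comp _ _ _ (fun x : 'rV[R]_n => c + x *m J) (fun z =>
    sqn (z - c))); last exact: sqn_shift_continuous.
  apply: (@continuousD _ _ _ (cst c) (mulmxr J) 0); first exact: cst_continuous.
  exact: (@continuous_mulmxr R n n J).
have J0 : sqn ((c + 0 *m J) - c) = 0 by rewrite mul0mx addr0 subrr sqn0.
apply: (@germ_equiv_trans _ _ (f \o (fun x => (c + x *m J) + w (c + x *m J)))).
  apply: (leqv_field (@csball_compact _ _ c (2 * d ^+ 2))) => //.
  - by move=> z /le_lt_trans /(_ hd) /hrho [].
  - by move=> z /negP; rewrite -ltNge => /ltW; exact: w0.
  - by apply: (cvgr_lt _ cJ); rewrite J0.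
apply: leqv_near.
have : \forall x \near (0 : 'rV[R]_n),
  sqn ((c + x *m J) - c) < d ^+ 2 by apply: (cvgr_lt _ cJ); rewrite J0.
apply: filterS => x hx; rewrite /w /beta bump_eq1 ?ltr1n //; last first.
  by rewrite sqd ler_pdivrMr // mul1r ltW.
have -> : p (c + x *m J) = F x - (c + x *m J).
  by rewrite /p; congr (F _ - _); rewrite /l (addrC c) addrK mulmxK.
by rewrite scale1r addrC subrK.
Unshelve. all: by end_near. Qed.
End Local.
End Germs.

(** * Equivalence of germs within one chart ball *)

Section LocalHomogeneity.
Variables (R : realType) (n : nat) (k : smoothness).
Hypothesis k0 : k <> Cfin 0.
Variables (M : topologicalType) (A : set (chart R n M)).
Hypothesis (hA : oriented_atlas k A) (hM : hausdorff_space M).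
Let E := @euclidean_atlas R n.
Let hE : oriented_atlas k E := @euclidean_oriented_atlas R n k.
Implicit Types (U : set M) (f g : 'rV[R]_n -> M).

(** Translate to the centre, linearise, then correct the linear part [J] to the prescribed [S]; the
    correction [J^-1 S] has positive determinant because [J] and [S] both have sign [s]. *)
Lemma leqv_normal_form U c r (s t : R) f (f' : M -> 'rV[R]_n) (F : 'rV[R]_n ->
  'rV[R]_n) (S : 'M[R]_n) :
  0 < r -> t != 0 -> s != 0 -> embedding k A (sball c r) t f f' ->
  f @` sball c r `<=` U -> C_at k F 0 -> sball c r (F 0) ->
  0 < s * \det ('J F 0) -> 0 < s * \det S ->
  leqv k A U f F (fun x : 'rV[R]_n => c + x *m S).
Proof.
move=> r0 t0 s0 ef fU CF F0 dF dS.
have cF := C_at_continuous CF.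
apply: (germ_equiv_trans k0 hA (leqv_translate k0 hA hM t0 ef fU cF F0)).
set G := (fun x => F x + (c - F 0)).
have dFF := C_at_differentiable k0 CF.
have CG : C_at k G 0.
  have [W [oW W0 CW]] := CF; exists W; split => //.
  by apply: C_on_add => //; exact: C_on_cst.
have G0 : G 0 = c by rewrite /G addrC subrK.
have JG : 'J G 0 = 'J F 0.
  apply/matrixP => i j; apply: etrans (jacobianE _ _ (C_at_differentiable k0 CG)) _.
  apply: etrans _ (esym (jacobianE _ _ dFF)).
  rewrite (@deriveD _ _ _ F (cst (c - F 0))) ?derive_cst ?addr0 //.
  exact: diff_derivable.
have u : 'J F 0 \in unitmx.
  rewrite unitmxE unitfE; apply: contraTneq dF => ->; by rewrite mulr0 ltxx.
have uG : 'J G 0 \in unitmx by rewrite JG.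
have := leqv_linearize k0 hA hM r0 t0 ef fU CG G0 uG; rewrite JG => h.
apply: (germ_equiv_trans k0 hA (germ_equiv_sym k0 hA h)).
move: u dF {h JG uG}; move: ('J F 0) => J u dF.
have -> : (fun x : 'rV[R]_n => c + x *m S) = (fun x => c + x *m (J *m (invmx J *m S))).
  by apply/funext => x; rewrite (mulmxA J) mulmxV // mul1mx.
apply: (leqv_linear k0 hA hM r0 t0 ef fU).
rewrite det_mulmx det_inv.
move: dF dS; set a := \det J; set b := \det S => ha hb.
have := mulr_gt0 ha hb; rewrite mulrACA => hab.
have a2 : 0 < (s * a) ^- 2 by rewrite invr_gt0 exprn_gt0.
have -> : a^-1 * b = (s * s * (a * b)) * (s * a) ^- 2.
  have a0 : a != 0 by apply: contraTneq ha => ->; rewrite mulr0 ltxx.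
  by field; rewrite a0 s0.
by rewrite mulr_gt0.
Qed.

Lemma chart_embedding phi O : A phi -> open O -> O `<=` chart_map phi @` chart_dom phi ->
  embedding k A O 1 (chart_inv phi) (chart_map phi).
Proof.
move=> Ap oO Od.
have dO z : O z -> exists2 x, chart_dom phi x & z = chart_map phi x.
  by move=> /Od [x dx <-]; exists x.
split => //.
- apply: open_at => _ [z Oz <-]; have [x dx zx] := dO z Oz; rewrite zx chartK //.
  have nO : nbhs (chart_map phi x) O by rewrite -zx; exact: open_nbhs_nbhs.
  have h1 := chart_near dx nO; have h2 := chart_nbhs dx.
  by apply: filterS2 h1 h2 => y Oy dy; exists (chart_map phi y) => //; rewrite chartK.
- by move=> z /dO [x dx ->]; exact: smap_chart_inv.
- by move=> z /dO [x dx ->]; rewrite chartK //; exact: smap_chart.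
- by move=> z /dO [x dx ->]; rewrite chartK.
- by move=> z /dO [x dx ->]; exact: (sgnat_chart_inv k0 hA Ap dx).
Qed.

Lemma ex_det_sign (s : R) : (0 < n)%N -> s != 0 -> exists S : 'M[R]_n, 0 < s * \det S.
Proof.
case: (n) => // m _ s0.
(* The determinant is [s] itself. This needs a diagonal entry, since in size 0 the determinant is
   always 1. *)
exists (diag_mx (\row_(i < m.+1) if i == ord0 then s else 1)).
rewrite det_diag (bigD1 ord0) //= mxE eqxx big1 => [|i /negPf i0]; last by rewrite mxE i0.
by rewrite mulr1 -expr2 lt_def sqrf_eq0 s0 sqr_ge0.
Qed.

Lemma affine_germ (c : 'rV[R]_n) (S : 'M[R]_n) :
  C_at k (fun x : 'rV[R]_n => c + x *m S) 0 /\ 'J (fun x : 'rV[R]_n => c + x *m S) 0 = S.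
Proof.
have CS : C_at k (fun x : 'rV[R]_n => c + x *m S) 0.
  exists setT; split => //; first exact: openT.
  by apply: (C_on_add openT); [exact: (C_on_cst _ c openT)|exact: C_on_mulmx openT].
split=> //; have dS := C_at_differentiable k0 CS.
have dm : differentiable (mulmxr S : 'rV[R]_n -> 'rV[R]_n) 0.
  by apply: linear_differentiable; exact: (@continuous_mulmxr R n n S).
apply/row_matrixP => i; rewrite [LHS]rowE [RHS]rowE.
apply: etrans (esym (deriveEjacobian _ dS)) _.
rewrite (@deriveD _ _ _ (cst c) (mulmxr S : 'rV[R]_n -> 'rV[R]_n));
  [|exact: derivable_cst|exact: diff_derivable].
rewrite derive_cst add0r deriveE // diff_lin //; exact: (@continuous_mulmxr R n n S).
Qed.

(** The two last clauses feed a clopen argument: any two germs of sign [s] based in [W] are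
    equivalent, and every point of [W] carries one. *)
Lemma local_germs U p s : (0 < n)%N -> open U -> U p -> s != 0 ->
  exists W : set M, [/\ open W, W p, W `<=` U,
   forall f g, smap k E A f 0 -> smap k E A g 0 -> sgnat E A s f 0 -> sgnat E A s g 0 ->
     W (f 0) -> W (g 0) -> germ_equiv k A U f g &
   forall q, W q -> exists f, [/\ f 0 = q, smap k E A f 0 & sgnat E A s f 0]].
Proof.
move=> n0 oU Up s0; have [phi Ap dp] := oa_cover hA p.
set c := chart_map phi p.
have [r r0 hr] : exists2 r, 0 < r & sball c r `<=` chart_map phi @` (chart_dom phi `&` U).
  apply: nbhs_sball; apply: open_nbhs_nbhs; split; last by exists p.
  by apply: chart_image_open; [apply: openI => //; exact: chart_dom_open|move=> x []].
have hr' : sball c r `<=` chart_map phi @` chart_dom phi by move=> z /hr [x [dx _] <-];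
  exists x.
have ef := chart_embedding Ap (@sball_open _ _ c r) hr'.
have fU : chart_inv phi @` sball c r `<=` U.
  by move=> _ [z /hr [x [dx Ux] <-] <-]; rewrite chartK.
have WE q : (chart_inv phi @` sball c r) q ->
  chart_dom phi q /\ sball c r (chart_map phi q).
  move=> [z Oz <-]; have [x [dx Ux] xz] := hr z Oz.
  by rewrite -xz chartK // xz.
have [S dS] := ex_det_sign n0 s0.
exists (chart_inv phi @` sball c r); split => //.
- exact: em_img ef.
- exists c; last by rewrite /c chartK.
  by rewrite /sball /= subrr sqn0.
(* All germs are compared with one normal form at the centre of the chart ball. *)
- have nf g : smap k E A g 0 -> sgnat E A s g 0 -> (chart_inv phi @` sball c r) (g 0) ->
      germ_equiv k A U g (chart_inv phi \o (fun x : 'rV[R]_n => c + x *m S)).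
    move=> sg dg /WE [dg0 Og].
    have Cg : C_at k (chart_map phi \o g) 0.
      by apply/smap_euclideanP; apply: (smap_comp hA sg); exact: smap_chart.
    apply: (germ_equiv_trans k0 hA (g := chart_inv phi \o (chart_map phi \o g))).
      apply: (germ_equiv_near hA).
      have nd : \forall x \near (0 : 'rV[R]_n),
        chart_dom phi (g x) := sg.1 _ (chart_nbhs dg0).
      apply: filterS nd => x dgx /=.
      by rewrite chartK.
    apply: (leqv_normal_form r0 (oner_neq0 R) s0 ef fU Cg Og _ dS).
    exact: (dg (@id_chart R n) phi).
  move=> f g sf sg df dg Wf Wg.
  apply: (germ_equiv_trans k0 hA (nf f sf df Wf)).
  exact: (germ_equiv_sym k0 hA (nf g sg dg Wg)).
move=> q /WE [dq Oq]; have [CS JS] := affine_germ (chart_map phi q) S.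
have hS : smap k E E (fun x : 'rV[R]_n =>
  chart_map phi q + x *m S) 0 by apply/smap_euclideanP.
have q0 : chart_map phi q + 0 *m S = chart_map phi q by rewrite mul0mx addr0.
exists (chart_inv phi \o (fun x : 'rV[R]_n => chart_map phi q + x *m S)); split.
- by rewrite /= q0 chartK.
- by apply: (smap_comp hE hS); rewrite q0; exact: smap_chart_inv.
- rewrite -[s]mulr1; apply: (sgnat_comp k0 hE hS).
  + by rewrite q0; exact: smap_chart_inv.
  + by apply/sgnat_euclidean; rewrite JS.
  + by rewrite q0; exact: (sgnat_chart_inv k0 hA Ap dq).
Qed.
End LocalHomogeneity.

(** * Connectedness *)

Section Connected.
Variable (T : topologicalType).
Implicit Types (A P Q : set T).

(** Working form of connectedness, with open sets of the whole space that are disjoint only inside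
    [A]. *)
Lemma connected_split A P Q : connected A -> open P -> open Q -> A `<=` P `|` Q ->
  (forall x, A x -> P x -> Q x -> False) -> A `&` P !=set0 -> A `<=` P.
Proof.
move=> cA oP oQ APQ dis ne; suff <- : A `&` P = A by move=> x [].
apply: cA => //; first by exists P.
exists (~` Q); first by rewrite closedC.
rewrite predeqE => x; split=> [[Ax Px]|[Ax Qx]]; split=> //; first by move=> /(dis x Ax Px).
by case: (APQ x Ax).
Qed.

Lemma connected_intro A : (forall P Q, open P -> open Q -> A `<=` P `|` Q ->
  (forall x, A x -> P x -> Q x -> False) -> A `&` P !=set0 -> A `<=` P) -> connected A.
Proof.
move=> h B B0 [C1 oC1 BC1] [C2 cC2 BC2].
have AC1 : A `<=` C1.
  apply: (h C1 (~` C2)) => //; first by rewrite openC.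
  - move=> x Ax; have [C2x|C2x] := pselect (C2 x); last by right.
    by left; have : B x by [rewrite BC2]; rewrite BC1 => -[].
  - by move=> x Ax C1x; apply; have : B x by [rewrite BC1]; rewrite BC2 => -[].
  - by rewrite -BC1.
by rewrite BC1; apply/setIidPl.
Qed.
End Connected.

Section Euclid.
Variables (R : realType).

Lemma star_connected (V : normedModType R) (A : set V) a : A a ->
  (forall x (t : R), A x -> 0 <= t <= 1 -> A (a + t *: (x - a))) -> connected A.
Proof.
move=> Aa star.
have -> : A = \bigcup_(x in A) ((fun t : R => a + t *: (x - a)) @` `[0, 1]%classic).
  rewrite predeqE => y; split=> [Ay|[x Ax [t t01 <-]]].
    by exists y => //; exists 1;
      [rewrite /= in_itv /= ler01 lexx|rewrite scale1r addrC subrK].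
  by apply: star => //; move: t01; rewrite /= in_itv.
apply: bigcup_connected.
  by exists a => x Ax; exists 0; [rewrite /= in_itv /= lexx ler01|rewrite scale0r addr0].
move=> x Ax; apply: connected_continuous_connected; first exact: segment_connected.
apply: continuous_subspaceT => t;
  apply: (@continuousD _ _ _ (cst a) (fun t : R => t *: (x - a)) t).
  exact: cst_continuous.
exact: scalel_continuous.
Qed.

Variable n : nat.
Implicit Types (x a : 'rV[R]_n).

(** The complement of the closed ray opposite to [a] is star-shaped about [a]. *)
Lemma ray_complement_connected a : a != 0 ->
  connected [set x | ~ exists2 t : R, 0 <= t & x = - (t *: a)].
Proof.
move=> a0; apply: (@star_connected _ _ a).
  move=> [t t0 /eqP]; rewrite -subr_eq0 opprK -[X in X + _]scale1r -scalerDl scaler_eq0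
    (negPf a0) orbF.
  by rewrite gt_eqF // ltr_pwDl.
(* If [a + t (x - a) = - u a] then [t x = - (u + 1 - t) a], so dividing by [t] puts [x] on the ray;
   [t = 0] would make a positive multiple of [a] vanish. *)
move=> x t nx /andP[t0 t1] [u u0 E]; apply: nx.
have E' : t *: x = - ((u + (1 - t)) *: a).
  by apply/rowP => i; have := congr1 (fun w : 'rV[R]_n => w ord0 i) E; rewrite !mxE; lra.
have v0 : 0 <= u + (1 - t) by rewrite addr_ge0 // subr_ge0.
have [t00|tn0] := eqVneq t 0.
  exfalso; move/eqP: E';
    rewrite t00 scale0r eq_sym oppr_eq0 subr0 scaler_eq0 (negPf a0) orbF.
  by rewrite gt_eqF // ltr_wpDl.
exists (t^-1 * (u + (1 - t))); first by rewrite mulr_ge0 // invr_ge0.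
by rewrite -scalerA -scalerN -E' scalerA mulVf // scale1r.
Qed.

(** The complements of two opposite rays cover the punctured space, and they share a vector [b] off
    the line of [a], which exists as [n >= 2]. *)
Lemma punctured_connected : (1 < n)%N -> connected [set x : 'rV[R]_n | x != 0].
Proof.
move=> n1; have n0 : (0 < n)%N by exact: ltnW.
pose a : 'rV[R]_n := delta_mx ord0 (Ordinal n0);
  pose b : 'rV[R]_n := delta_mx ord0 (Ordinal n1).
have a0 : a != 0.
  by apply/eqP => /rowP /(_ (Ordinal n0)); rewrite !mxE !eqxx /= => /eqP; rewrite oner_eq0.
have nab (t : R) : b <> - (t *: a).
  by move=> /rowP /(_ (Ordinal n1)); rewrite !mxE !eqxx /= mulr0 oppr0 => /eqP;
    rewrite oner_eq0.
have na0 : - a != 0 by rewrite oppr_eq0.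
have -> : [set x : 'rV[R]_n | x != 0] =
    [set x | ~ exists2 t : R, 0 <= t & x = - (t *: a)] `|` [set x | ~ exists2 t : R,
      0 <= t & x = - (t *: - a)].
  rewrite predeqE => x; split=> [x0|].
    have [[t t0 xt]|] := pselect (exists2 t : R, 0 <= t & x = - (t *: a)); last by left.
    right=> -[u u0 xu].
    have /eqP : (t + u) *: a = 0.
      by rewrite scalerDl -[t *: a]opprK -xt xu scalerN opprK addNr.
    rewrite scaler_eq0 (negPf a0) orbF paddr_eq0 // => /andP[/eqP t00 _].
    by move: x0 => /eqP; apply; rewrite xt t00 scale0r oppr0.
  case=> h; apply/eqP => x0; apply: h; exists 0 => //; by rewrite x0 scale0r oppr0.
apply: connectedU; [|exact: ray_complement_connected|exact: ray_complement_connected].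
exists b; split=> -[t _]; first exact: nab.
by rewrite scalerN -scaleNr; exact: nab.
Qed.

Lemma enormZ (t : R) x : enorm (t *: x) = `|t| * enorm x.
Proof. by rewrite !enormE sqnZ sqrtrM ?sqr_ge0 // sqrtr_sqr. Qed.

Lemma enorm_continuous : continuous (@enorm R n).
Proof.
move=> x; apply: (@continuous_comp _ _ _ (@sqn R n) Num.sqrt); first exact: sqn_continuous.
exact: sqrt_continuous.
Qed.

Lemma enorm_eq0 x : (enorm x == 0) = (x == 0).
Proof. by rewrite enormE sqrtr_eq0 -sqn_eq0 eq_le sqn_ge0 andbT. Qed.

Lemma enorm_ge0 x : 0 <= enorm x.
Proof. exact: sqrtr_ge0. Qed.

Lemma enorm_gt0 x : (0 < enorm x) = (x != 0).
Proof. by rewrite lt_def enorm_ge0 andbT enorm_eq0. Qed.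

Lemma shell_connected (e : R) : (1 < n)%N -> 0 < e ->
  connected [set x : 'rV[R]_n | 1 < enorm x < 1 + e].
Proof.
move=> n1 e0.
(* Radial rescaling taking the norm [t] to [1 + e t / (1 + t)], a bijection from the positive reals
   to the interval between 1 and [1 + e]. *)
pose c x := (1 + e * (enorm x / (1 + enorm x))) / enorm x.
have -> : [set x : 'rV[R]_n | 1 < enorm x < 1 + e] = (fun x =>
  c x *: x) @` [set x : 'rV[R]_n | x != 0].
  rewrite predeqE => y; split=> [/andP[y1 y2]|[x x0 <-]] /=.
    have y0 : 0 < enorm y by apply: lt_trans y1.
    set u := enorm y - 1; have u0 : 0 < u by rewrite subr_gt0.
    have ue : 0 < e - u by rewrite subr_gt0 ltrBlDl.
    set t := u / (e - u); have t0 : 0 < t by rewrite divr_gt0.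
    have ex : enorm ((t / enorm y) *: y) = t.
      by rewrite enormZ (ger0_norm (divr_ge0 (ltW t0) (ltW y0))) divfK // gt_eqF.
    exists ((t / enorm y) *: y).
      by rewrite -enorm_gt0 ex.
    rewrite /c ex scalerA.
    have -> : (1 + e * (t / (1 + t))) / t * (t / enorm y) = 1; last by rewrite scale1r.
    have -> : t / (1 + t) = u / e by rewrite /t; field; rewrite !gt_eqF.
    have -> : 1 + e * (u / e) = enorm y by rewrite /u; field; rewrite gt_eqF.
    by field; rewrite !gt_eqF.
  have x1 : 0 < enorm x by rewrite enorm_gt0.
  have c0 : 0 <= c x by rewrite divr_ge0 ?enorm_ge0 // addr_ge0 //
    mulr_ge0 ?(ltW e0) // divr_ge0 ?addr_ge0 // ?enorm_ge0.
  rewrite enormZ (ger0_norm c0) /c divfK ?gt_eqF //.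
  rewrite ltrDl mulr_gt0 ?divr_gt0 //=; last by rewrite addr_gt0.
  by rewrite ltrD2l gtr_pMr // ltr_pdivrMr ?addr_gt0 // mul1r ltrDr.
apply: connected_continuous_connected; first exact: punctured_connected.
apply: continuous_in_subspaceT => x; rewrite inE /= => x0.
have x1 : enorm x != 0 by rewrite enorm_eq0.
have ce := @enorm_continuous x.
apply: (@continuousZ _ _ _ (fun x => c x) id x); last exact: cvg_id.
apply: continuousM; last by apply: continuousV.
apply: continuousD; first exact: cst_continuous.
apply: continuousM; first exact: cst_continuous.
apply: continuousM => //; apply: continuousV;
  first by rewrite gt_eqF // ltr_pwDl // enorm_ge0.
by apply: continuousD => //; exact: cst_continuous.
Qed.

End Euclid.

Section Balls.
Variables (R : realType) (n : nat).
Implicit Types (e : R).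

Lemma enorm0 : enorm (0 : 'rV[R]_n) = 0.
Proof. by apply/eqP; rewrite enorm_eq0. Qed.

Lemma eball0E e : eball (0 : 'rV[R]_n) e = [set x | enorm x < e].
Proof. by rewrite predeqE => x; rewrite /eball /= subr0. Qed.

Lemma closed_eball0E e : closed_eball (0 : 'rV[R]_n) e = [set x | enorm x <= e].
Proof. by rewrite predeqE => x; rewrite /closed_eball /= subr0. Qed.

Lemma eball_open e : open (eball (0 : 'rV[R]_n) e).
Proof.
rewrite eball0E; apply: open_comp (@open_lt R e) => z _; exact: enorm_continuous.
Qed.

Lemma eball_connected e : 0 < e -> connected (eball (0 : 'rV[R]_n) e).
Proof.
move=> e0; rewrite eball0E; apply: (@star_connected _ _ _ 0) => /=.
  by rewrite enorm0.
move=> x t xe /andP[t0 t1]; rewrite add0r subr0 enormZ ger0_norm //.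
by rewrite (le_lt_trans _ xe) // ler_piMl // enorm_ge0.
Qed.

Lemma le_enorm_sqn (x : 'rV[R]_n) e : 0 <= e -> (enorm x <= e) = (sqn x <= e ^+ 2).
Proof.
move=> e0; rewrite enormE -[in LHS](ger0_norm e0) -sqrtr_sqr ler_sqrt //.
exact: sqr_ge0.
Qed.

Lemma closed_eball_compact e : 0 <= e -> compact (closed_eball (0 : 'rV[R]_n) e).
Proof.
move=> e0; have -> : closed_eball (0 : 'rV[R]_n) e = csball 0 (e ^+ 2).
  by rewrite predeqE => x; rewrite closed_eball0E /csball /= subr0 le_enorm_sqn.
exact: csball_compact.
Qed.

(** By compactness one [d] serves all dilations [(1 + t) z] of points [z] of the closed ball; a
    point of norm between 1 and [1 + d] is such a dilation of its radial projection. *)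
Lemma closed_eball_thicken (W : set 'rV[R]_n) : open W -> closed_eball 0 1 `<=` W ->
  exists2 e, 0 < e & eball 0 (1 + e) `<=` W.
Proof.
move=> oW KW; have cK := @closed_eball_compact 1 ler01.
have : \forall t \near (0 : R),
  closed_eball (0 : 'rV[R]_n) 1 `<=` [set z | W ((1 + t) *: z)].
  apply: ((compact_near_coveringP _).1 cK R (nbhs (0 : R)) (fun t z =>
    W ((1 + t) *: z))) => x Kx.
  have c : {for (x, 0 : R), continuous (fun p : 'rV[R]_n * R => (1 + p.2) *: p.1)}.
    apply: (@continuousZ _ _ _ (fun p : 'rV[R]_n * R => 1 + p.2) fst); last exact: cvg_fst.
    apply: cvgD; [exact: cvg_cst|exact: cvg_snd].
  have := c W; rewrite /= addr0 scale1r; apply.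
  by apply: open_nbhs_nbhs; split => //; exact: KW.
move=> /(near0_norm (V := R)) [d d0 hd]; exists d => // x; rewrite eball0E /= => xd.
have [x1|x1] := leP (enorm x) 1; first by apply: KW; rewrite closed_eball0E.
have := hd (enorm x - 1);
  rewrite ger0_norm ?subr_ge0 ?(ltW x1) // ltrBlDl => /(_ xd ((enorm x)^-1 *: x)).
rewrite /= addrC subrK scalerA divff ?scale1r; last by rewrite gt_eqF // (lt_trans ltr01).
apply; rewrite closed_eball0E /= enormZ ger0_norm ?invr_ge0 ?enorm_ge0 // mulVf //.
by rewrite gt_eqF // (lt_trans ltr01).
Qed.
End Balls.

(** * From charts to domains, and removal of a ball from a domain *)

Section Homogeneity.
Variables (R : realType) (n : nat) (k : smoothness).
Hypothesis k0 : k <> Cfin 0.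
Variables (M : topologicalType) (A : set (chart R n M)).
Hypothesis (hA : oriented_atlas k A) (hM : hausdorff_space M).
Let E := @euclidean_atlas R n.
Let hE : oriented_atlas k E := @euclidean_oriented_atlas R n k.
Implicit Types (U : set M) (f g : 'rV[R]_n -> M).

(** The base points of germs equivalent to [f] form an open set with open complement in [U], both by
    [local_germs]. *)
Lemma connected_germs U s f g : (0 < n)%N -> open U -> connected U -> s != 0 ->
  smap k E A f 0 -> smap k E A g 0 -> sgnat E A s f 0 -> sgnat E A s g 0 ->
  U (f 0) -> U (g 0) -> germ_equiv k A U f g.
Proof.
move=> n0 oU cU s0 sf sg df dg Uf Ug.
pose germ (h : 'rV[R]_n -> M) q := [/\ h 0 = q, smap k E A h 0 & sgnat E A s h 0].
pose P := [set q | U q /\ exists2 h, germ h q & germ_equiv k A U f h].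
pose Q := [set q | U q /\ ~ P q].
have loc q : U q -> exists W, [/\ nbhs q W, forall r, W r -> U r, forall r, W r ->
  exists h, germ h r
    & forall r r' h h', W r -> W r' -> germ h r -> germ h' r' -> germ_equiv k A U h h'].
  move=> Uq; have [W [oW Wq WU hW1 hW2]] := local_germs k0 hA hM n0 oU Uq s0.
  exists W; split => //; first exact: open_nbhs_nbhs.
  by move=> r r' h h' Wr Wr' [hr sh dh] [hr' sh' dh']; apply: hW1 => //; rewrite ?hr ?hr'.
have step q r W : (forall r r' h h', W r -> W r' -> germ h r -> germ h' r' ->
  germ_equiv k A U h h') ->
    (forall r, W r -> U r) -> (forall r, W r -> exists h, germ h r) -> W q -> W r ->
      P q -> P r.
  move=> h1 h2 h3 Wq Wr [_ [h gh fh]]; split; first exact: h2.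
  have [h' gh'] := h3 r Wr; exists h' => //.
  exact: (germ_equiv_trans k0 hA fh (h1 q r h h' Wq Wr gh gh')).
have UP : U `<=` P.
  apply: (@connected_split _ U P Q) => //.
  - apply: open_at => q Pq; have [W [nW WU hW1 hW2]] := loc q Pq.1.
    by apply: filterS (nW) => r Wr; apply: (step q r W) => //; exact: nbhs_singleton nW.
  - apply: open_at => q [Uq nPq]; have [W [nW WU hW1 hW2]] := loc q Uq.
    apply: filterS (nW) => r Wr; split; first exact: WU.
    by move=> Pr; apply: nPq; apply: (step r q W) => //; exact: nbhs_singleton nW.
  - by move=> q Uq; have [Pq|Pq] := pselect (P q); [left|right].
  - by move=> q _ Pq [].
  - exists (f 0); split => //; split => //; exists f => //.
    by apply: (germ_equiv_near hA); near=> x.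
have [_ [h gh fh]] := UP _ Ug.
have [W [nW WU hW1 hW2]] := loc _ Ug.
have Wg := nbhs_singleton nW.
by apply: (germ_equiv_trans k0 hA fh (hW2 _ _ h g Wg Wg gh _)).
Unshelve. all: by end_near. Qed.

Lemma embedding_sub O O' s f (f' : M -> 'rV[R]_n) : open O' -> O' `<=` O ->
  embedding k A O s f f' -> embedding k A O' s f f'.
Proof.
move=> oO' sub [h1 h2 h3 h4 h5 h6]; split => //; try by move=> x /sub; auto.
apply: open_at => _ [x Ox <-].
have : nbhs (f x) (f @` O) by apply: open_nbhs_nbhs; split => //; exists x => //;
  exact: sub.
have : nbhs (f x) (f' @^-1` O').
  have [c _] := h4 x (sub _ Ox); apply: c; rewrite h5; last exact: sub.
  exact: open_nbhs_nbhs.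
by apply: filterS2 => y /= Oy [z Oz zy]; exists z => //; move: Oy; rewrite -zy h5.
Qed.

(** The points of sign 1 and those of sign -1 are two disjoint open sets covering the connected set
    [O]. *)
Lemma embedding_sign O f (f' : M -> 'rV[R]_n) : open O -> connected O -> open (f @` O) ->
  (forall x, O x -> smap k E A f x) -> (forall x, O x -> smap k A E f' (f x)) ->
  (forall x, O x -> f' (f x) = x) -> exists2 s : R, s != 0 & embedding k A O s f f'.
Proof.
move=> oO cO oI sf sf' fK.
have nO x : O x -> \forall y \near x, O y by move=> Ox; exact: open_nbhs_nbhs.
have dich x : O x -> sgnat E A 1 f x \/ sgnat E A (-1) f x.
  move=> Ox; apply: (sgnat_exists k0 hE hA (sf x Ox) (sf' x Ox)).
  by apply: filterS (nO x Ox) => y; exact: fK.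
have opn (s : R) : open [set x | O x /\ sgnat E A s f x].
  apply: open_at => x [Ox sx].
  have nf : \forall y \near x, smap k E A f y by apply: filterS (nO x Ox); exact: sf.
  by apply: filterS2 (nO x Ox) (sgnat_near k0 hE hA nf sx) => y.
have [/set0P [x [Ox sx]]|/negPn/eqP O0] := boolP ([set x | O x /\ sgnat E A 1 f x] != set0).
  exists 1; first exact: oner_neq0.
  split => // y Oy.
  have /(_ y Oy) [] // : O `<=` [set x | O x /\ sgnat E A 1 f x].
  apply: (connected_split cO (opn 1) (opn (-1))).
  - by move=> z Oz; have [?|?] := dich z Oz; [left|right].
  - move=> z Oz [_ s1] [_ s2]; have := sgnat_unique hE hA s1 s2.
    by rewrite mul1r ltr0N1.
  - by exists x.
exists (-1); first by rewrite oppr_eq0 oner_neq0.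
split => // y Oy; have [s1|//] := dich y Oy.
by have : [set x | O x /\ sgnat E A 1 f x] y by []; rewrite O0.
Qed.

(* If U minus the ball splits into two open parts, the shell lies in one of them,
   whose union with the ball is then clopen in U. *)
Lemma connected_diff_ball U e s f (f' : M -> 'rV[R]_n) : (1 < n)%N -> connected U ->
  open U -> 0 < e ->
  embedding k A (eball 0 (1 + e)) s f f' -> f @` eball 0 (1 + e) `<=` U ->
  connected (U `\` f @` closed_eball 0 1).
Proof.
move=> n1 cU oU e0 ef fU.
set D := f @` closed_eball 0 1.
pose S := f @` [set x : 'rV[R]_n | 1 < enorm x < 1 + e].
have shO : [set x : 'rV[R]_n | 1 < enorm x < 1 + e] `<=` eball 0 (1 + e).
  by move=> x /andP[_ xe]; rewrite eball0E.
have cS : connected S.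
  apply: connected_continuous_connected; first exact: shell_connected.
  by apply: continuous_in_subspaceT => x; rewrite inE => /shO /(em_smooth ef) [].
have fDS : f @` eball 0 (1 + e) `<=` D `|` S.
  move=> _ [x + <-]; rewrite eball0E /= => xe; have [x1|x1] := leP (enorm x) 1.
    by left; exists x => //; rewrite closed_eball0E.
  by right; exists x => //=; rewrite x1.
have Df : D `<=` f @` eball 0 (1 + e).
  move=> _ [x + <-]; rewrite closed_eball0E => /= x1; exists x => //; rewrite eball0E /=.
  by rewrite (le_lt_trans x1) // ltrDl.
have oI := em_img ef.
have SD : S `<=` U `\` D.
  move=> _ [x /[dup] xS /andP[x1 x2] <-]; split; first by apply: fU; exists x => //;
    exact: shO.
  move=> [z]; rewrite closed_eball0E /= => z1 zx.
  have zO : eball 0 (1 + e) z by rewrite eball0E /= (le_lt_trans z1) // ltrDl.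
  have : z = x by rewrite -(em_K ef zO) zx (em_K ef) //; exact: shO.
  by move=> E0; move: z1; rewrite E0 leNgt x1.
have D0 : D (f 0).
  exists 0 => //; rewrite closed_eball0E /=.
  by rewrite enorm0.
have cD : closed D.
  apply: (image_compact_closed hM ef (@closed_eball_compact _ _ 1 ler01)).
  by move=> x; rewrite closed_eball0E eball0E /= => /le_lt_trans; apply; rewrite ltrDl.
apply: connected_intro => P Q oP oQ PQ dis ne x Ux.
have oUD : open (U `\` D) by apply: openI => //; rewrite openC.
pose P1 := P `&` (U `\` D); pose Q1 := Q `&` (U `\` D).
have oP1 : open P1 by exact: openI.
have oQ1 : open Q1 by exact: openI.
(* Stated for an arbitrary pair, as the shell may lie in either part. *)
have key P' Q' : open P' -> open Q' -> U `\` D `<=` P' `|` Q' -> P' `<=` U `\` D ->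
  Q' `<=` U `\` D ->
    (forall y, P' y -> Q' y -> False) -> S `<=` P' -> U `<=` P' `|` D.
  move=> oP' oQ' PQ' P'U Q'U dis' SP.
  (* The shell is in [P'], so adding the closed ball amounts to adding the larger open ball; the
     union is therefore open. *)
  have -> : P' `|` D = P' `|` f @` eball 0 (1 + e).
    rewrite predeqE => y; split=> [[?|/Df ?]|[?|/fDS [?|/SP ?]]]; by [left|right].
  apply: (connected_split cU (Q := Q')) => //.
  - exact: openU.
  - move=> y Uy; have [Dy|Dy] := pselect (D y); first by left; right; exact: Df.
    by have [|?|?] := PQ' y; [split|left; left|right].
  - move=> y Uy [P'y|/fDS [Dy|/SP P'y]] Q'y; [exact: dis' P'y Q'y| |exact: dis' P'y Q'y].
    by case: (Q'U y Q'y).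
  - by exists (f 0); split; [exact/fU/Df|right; exact: Df].
have PQ1 : U `\` D `<=` P1 `|` Q1.
  by move=> y UDy; have [?|?] := PQ y UDy; [left|right].
have dis1 y : P1 y -> Q1 y -> False by move=> [Py UDy] [Qy _]; exact: dis UDy Py Qy.
have P1U : P1 `<=` U `\` D by move=> y [].
have Q1U : Q1 `<=` U `\` D by move=> y [].
have [[y [Sy Py]]|nSP] := pselect (S `&` P1 !=set0).
  have SP : S `<=` P1.
    apply: (connected_split cS oP1 oQ1) => //; first by move=> z /SD; exact: PQ1.
      by move=> z _; exact: dis1.
    by exists y.
  by have [[]//|Dx] := key P1 Q1 oP1 oQ1 PQ1 P1U Q1U dis1 SP x Ux.1; case: Ux.
have SQ : S `<=` Q1.
  by move=> y Sy; have [P1y|//] := PQ1 _ (SD _ Sy); exfalso; apply: nSP; exists y.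
(* With the shell in [Q1], all of [U] is in [Q1] or [D], leaving no room for the point of [P]. *)
exfalso; move: ne => [y [[Uy nDy] Py]].
have dis1' z : Q1 z -> P1 z -> False by move=> q p; exact: dis1 p q.
have QP1 : U `\` D `<=` Q1 `|` P1 by move=> z /PQ1 [?|?]; [right|left].
have [Qy|Dy] := key Q1 P1 oQ1 oP1 QP1 Q1U P1U dis1' SQ y Uy; last by [].
by apply: dis1' Qy _; split.
Qed.
End Homogeneity.

(** * Moving balls *)

Section SingleBall.
Variables (R : realType) (n : nat) (k : smoothness).
Hypothesis k0 : k <> Cfin 0.
Variables (M : topologicalType) (A : set (chart R n M)).
Hypothesis (hA : oriented_atlas k A) (hM : hausdorff_space M).
Implicit Types (U : set M).

Lemma norm_le_enorm (x : 'rV[R]_n) : `|x| <= enorm x.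
Proof.
rewrite -(@ler_pXn2r _ 2%N) ?nnegrE ?enorm_ge0 //.
by rewrite enormE sqr_sqrtr ?sqn_ge0 // sqn_norm.
Qed.

Lemma shrink_ball U e s f (f' : M -> 'rV[R]_n) : 0 < e -> s != 0 ->
  embedding k A (eball 0 (1 + e)) s f f' -> f @` eball 0 (1 + e) `<=` U ->
  exists2 eta, 0 < eta & forall a, 0 <= a <= eta -> exists H H', opdiff k A U H H' /\
    forall x, enorm x <= 1 -> H (f x) = f ((1 - a) *: x).
Proof.
move=> e0 s0 ef fU.
have e1 : 1 < 1 + e by rewrite ltrDl.
(* The squared radius [1 + e] is below [(1 + e)^2], so the support lies inside the open ball of
   radius [1 + e]. *)
pose K := csball (0 : 'rV[R]_n) (1 + e).
have cK : compact K by exact: csball_compact.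
have KO : K `<=` eball 0 (1 + e).
  move=> x; rewrite /K /csball eball0E /= subr0 => xe.
  rewrite ltNge -[_ <= _](@ler_pXn2r _ 2%N) ?nnegrE ?enorm_ge0 ?addr_ge0 ?(ltW e0) //.
  rewrite enormE sqr_sqrtr ?sqn_ge0 // -ltNge (le_lt_trans xe) //.
  by rewrite expr2 ltr_pMl // addr_gt0.
pose w (x : 'rV[R]_n) := bump 1 (1 + e) x *: x.
have Cw : C_on k setT w.
  by apply: C_on_scale openT _ (C_on_id _ openT) => j; exact: CR_bump openT.
have off z : ~ K z -> w z = 0.
  by move=> /negP; rewrite /K /csball /= subr0 -ltNge => /ltW h;
    rewrite /w bump_eq0 ?scale0r.
have [eta eta0 heta] := small_field k0 Cw cK off.
exists eta => // a /andP[a0 a1].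
have [|||H [H' [HH Hf]]] := field_opdiff k0 hA hM s0 ef cK KO (w :=
  (- a) \*: w) fU _ _ (heta (- a) _).
- apply: (@C_on_ext _ _ _ _ _ (fun z => cst (- a) z *: w z) _ openT) => //.
  by apply: C_on_scale openT _ Cw => j; exact: CR_cst.
- by move=> z /off /= ->; rewrite scaler0.
- by rewrite normrN ger0_norm.
exists H, H'; split => // x x1.
have xO : eball 0 (1 + e) x by rewrite eball0E /= (le_lt_trans x1).
rewrite Hf //; congr f; rewrite /= /w bump_eq1 //; last first.
  by move: x1; rewrite le_enorm_sqn // expr1n.
by rewrite scale1r scaleNr scalerBl scale1r.
Qed.

(** The shrunken ball lies in the unit ball, so the same map applies again. *)
Lemma shrink_ball_iter U (f : 'rV[R]_n -> M) a N : 0 <= a <= 1 ->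
  (exists H H', opdiff k A U H H' /\ forall x, enorm x <= 1 ->
    H (f x) = f ((1 - a) *: x)) ->
  exists H H', opdiff k A U H H' /\ forall x, enorm x <= 1 ->
    H (f x) = f ((1 - a) ^+ N *: x).
Proof.
move=> /andP[a0 a1] [H [H' [HH Hf]]]; elim: N => [|N [G [G' [GG Gf]]]].
  by exists id, id; split; [exact: opdiff_id|move=> x _; rewrite expr0 scale1r].
exists (H \o G), (G' \o H'); split; first exact: opdiff_comp.
have b0 : 0 <= 1 - a by rewrite subr_ge0.
have b1 : 1 - a <= 1 by rewrite gerBl.
move=> x x1; rewrite /= Gf // Hf; first by rewrite scalerA exprS.
rewrite enormZ ger0_norm ?exprn_ge0 // mulr_ile1 ?exprn_ge0 ?enorm_ge0 //.
by rewrite exprn_ile1.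
Qed.

Lemma single_ball U e s f (f' : M -> 'rV[R]_n) g (g' : M -> 'rV[R]_n) :
  (0 < n)%N -> open U -> connected U -> 0 < e -> s != 0 ->
  embedding k A (eball 0 (1 + e)) s f f' -> embedding k A (eball 0 (1 + e)) s g g' ->
  f @` eball 0 (1 + e) `<=` U -> g @` eball 0 (1 + e) `<=` U ->
  exists H H', opdiff k A U H H' /\ forall x, enorm x <= 1 -> H (f x) = g x.
Proof.
move=> n0 oU cU e0 s0 ef eg fU gU.
have O0 : eball 0 (1 + e) (0 : 'rV[R]_n) by rewrite eball0E /= enorm0 addr_gt0.
have [H0 [H0' [HH0 nfg]]] : germ_equiv k A U f g.
  apply: (connected_germs k0 hA hM n0 oU cU s0).
  - exact: em_smooth ef _ O0.
  - exact: em_smooth eg _ O0.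
  - exact: em_sign ef _ O0.
  - exact: em_sign eg _ O0.
  - by apply: fU; exists 0.
  - by apply: gU; exists 0.
move/near0_norm: nfg => [d d0 hd].
have [ef0 ef1 hef] := shrink_ball e0 s0 ef fU.
have [eg0 eg1 heg] := shrink_ball e0 s0 eg gU.
(* One [a] serves both balls, so they shrink by the same factor; 1/2 keeps [1 - a] strictly between
   0 and 1. *)
pose a := Num.min (2^-1) (Num.min ef0 eg0).
have a0 : 0 < a by rewrite !lt_min ef1 eg1 !andbT invr_gt0.
have a2 : a <= 2^-1 by rewrite ge_min lexx.
have af : a <= ef0 by rewrite !ge_min lexx orbT.
have ag : a <= eg0 by rewrite !ge_min lexx !orbT.
have a1 : a < 1 by apply: (le_lt_trans a2); rewrite invf_lt1 // ltr1n.
have [N hN] : exists N, (1 - a) ^+ N < d.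
  have : `|1 - a| < 1 by rewrite ger0_norm ?subr_ge0 ?(ltW a1) // gtrBl.
  move=> /cvg_expr /cvgrPdist_lt /(_ d d0) [N _ hN]; exists N.
  have := hN N (leqnn N); rewrite sub0r normrN ger0_norm //.
  by rewrite exprn_ge0 // subr_ge0 ltW.
have a01 : 0 <= a <= 1 by rewrite (ltW a0) (ltW a1).
have [|F [F' [FF Ff]]] := @shrink_ball_iter U f a N a01; first by apply: hef;
  rewrite (ltW a0).
have [|G [G' [GG Gg]]] := @shrink_ball_iter U g a N a01; first by apply: heg;
  rewrite (ltW a0).
(* f x |-> f (mu x) |-> g (mu x) |-> g x with mu := (1 - a)^N *)
exists (G' \o (H0 \o F)), ((F' \o H0') \o G); split.
  apply: (opdiff_comp k0 hA); last exact: (opdiff_inv k0 hA).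
  exact: (opdiff_comp k0 hA).
move=> x x1; rewrite /= Ff // hd; first by rewrite -Gg // (od_K GG).
rewrite normrZ ger0_norm ?exprn_ge0 ?subr_ge0 ?(ltW a1) // (le_lt_trans _ hN) //.
by rewrite ler_piMr ?exprn_ge0 ?subr_ge0 ?(ltW a1) // (le_trans (norm_le_enorm x)).
Qed.

Lemma embedding_opdiff U O s f (f' : M -> 'rV[R]_n) H H' : embedding k A O s f f' ->
  opdiff k A U H H' ->
  embedding k A O s (H \o f) (f' \o H').
Proof.
move=> ef HH; split.
- exact: em_open ef.
- apply: open_at => _ [x Ox <-] /=.
  have c : {for H (f x), continuous H'} by case: (od_smooth_inv HH (H (f x))).
  have : nbhs (H (f x)) (H' @^-1` (f @` O)).
    apply: c; rewrite (od_K HH); apply: open_nbhs_nbhs; split; first exact: em_img ef.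
    by exists x.
  by apply: filterS => y [z Oz zy]; exists z => //=; rewrite zy (od_invK HH).
- by move=> x Ox; apply: (smap_comp hA (em_smooth ef Ox)); exact: od_smooth HH _.
- move=> x Ox /=; apply: (smap_comp hA (od_smooth_inv HH _)); rewrite (od_K HH).
  exact: em_smooth_inv ef _ Ox.
- by move=> x Ox /=; rewrite (od_K HH) (em_K ef).
- move=> x Ox; rewrite -[s]mulr1;
    apply: (sgnat_comp k0 hA (em_smooth ef Ox) (od_smooth HH _)).
    exact: em_sign ef _ Ox.
  exact: od_sign HH _.
Qed.

Lemma embedding_thicken O s f (f' : M -> 'rV[R]_n) (V : set M) :
  embedding k A O s f f' -> closed_eball 0 1 `<=` O -> open V ->
    f @` closed_eball 0 1 `<=` V ->
  exists2 e, 0 < e & eball 0 (1 + e) `<=` O `&` f @^-1` V.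
Proof.
move=> ef KO oV fV; apply: closed_eball_thicken; last first.
  by move=> x Kx; split; [exact: KO|apply: fV; exists x].
apply: open_at => x [Ox Vx]; apply: filterI.
  by apply: open_nbhs_nbhs; split=> //; exact: em_open ef.
by have [c _] := em_smooth ef Ox; apply: c; exact: open_nbhs_nbhs.
Qed.

Section Families.
Variables (U : set M) (l : nat) (e s : 'I_l -> R).
Hypotheses (n1 : (1 < n)%N) (oU : open U) (cU : connected U).
Hypotheses (e0 : forall i, 0 < e i) (s0 : forall i, s i != 0).

Let ball : set 'rV[R]_n := closed_eball 0 1.

Lemma ball_sub_eball r : 0 < r -> ball `<=` eball 0 (1 + r).
Proof. by move=> r0 x; rewrite /ball closed_eball0E eball0E /= => /le_lt_trans; apply;
  rewrite ltrDl. Qed.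

Variables (g : 'I_l -> 'rV[R]_n -> M) (g' : 'I_l -> M -> 'rV[R]_n).
Hypothesis eg : forall i, embedding k A (eball 0 (1 + e i)) (s i) (g i) (g' i).
Hypothesis gU : forall i, g i @` eball 0 (1 + e i) `<=` U.
Hypothesis gdisj : forall i j x y, ball x -> ball y -> g i x = g j y -> i = j.

(** Room left at stage [m]: the targets are removed, not the sources, since the balls already moved
    occupy their targets. *)
Definition remaining m : set M := [set x | U x /\ forall i : 'I_l, (i < m)%N ->
  ~ (g i @` ball) x].

Lemma remaining_image m (i : 'I_l) : (m <= i)%N -> g i @` ball `<=` remaining m.
Proof.
move=> mi _ [x bx <-]; split; first by apply: gU; exists x => //; exact: ball_sub_eball.
by move=> j jm [y by_ /(gdisj by_ bx) ij]; move: jm; rewrite ij ltnNge mi.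
Qed.

(** By disjointness the next target lies in the open set that remains, and by compactness so does a
    collar of it, as [connected_diff_ball] requires. *)
Lemma remaining_domain m : (m <= l)%N -> open (remaining m) /\ connected (remaining m).
Proof.
elim: m => [_|m IH ml].
  by have -> : remaining 0 = U by [rewrite predeqE => x; split=> [[]|]].
have [om cm] := IH (ltnW ml); pose i := Ordinal ml.
have [r r0 hr] := embedding_thicken (eg i) (ball_sub_eball (e0 i)) om (@remaining_image
  m i (leqnn m)).
have eg' := embedding_sub (@eball_open _ _ _) (fun x h => (hr x h).1) (eg i).
have -> : remaining m.+1 = remaining m `\` g i @` ball.
  rewrite predeqE => x; split=> [[Ux h]|[[Ux h] nx]].
    by split; [split=> // j jm; apply: h; exact: ltnW|apply: h => /=].
  split=> // j; rewrite ltnS leq_eqVlt => /orP[/eqP jm|]; last exact: h.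
  by have -> : j = i by apply/val_inj.
split.
  apply: openI => //; rewrite openC.
  apply: (image_compact_closed hM (eg i) (@closed_eball_compact _ _ 1 ler01)).
  exact: ball_sub_eball.
apply: (connected_diff_ball hM n1 cm om r0 eg').
by move=> _ [x /hr [_ ?] <-].
Qed.

Variables (f : 'I_l -> 'rV[R]_n -> M) (f' : 'I_l -> M -> 'rV[R]_n).
Hypothesis ef : forall i, embedding k A (eball 0 (1 + e i)) (s i) (f i) (f' i).
Hypothesis fU : forall i, f i @` eball 0 (1 + e i) `<=` U.
Hypothesis fdisj : forall i j x y, ball x -> ball y -> f i x = f j y -> i = j.

Lemma move_balls m : (m <= l)%N -> exists H H', opdiff k A U H H' /\
  forall i : 'I_l, (i < m)%N -> forall x, ball x -> H (f i x) = g i x.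
Proof.
elim: m => [_|m IH ml]; first by exists id, id; split; [exact: opdiff_id|].
have [H [H' [HH Hm]]] := IH (ltnW ml); pose i := Ordinal ml.
have [om cm] := remaining_domain (ltnW ml).
have eh := embedding_opdiff (ef i) HH.
(* The next ball, as displaced by [H], misses the occupied targets because they are images under [H]
   of disjoint balls. *)
have hV : (H \o f i) @` ball `<=` remaining m.
  move=> _ [x bx <-] /=; split.
    apply: (fixed_off_stable (od_K HH) (K := U)) => //; first exact: od_off HH.
    by apply: fU; exists x => //; exact: ball_sub_eball.
  move=> j jm [y by_]; rewrite -(Hm j jm y by_) => /(can_inj (od_K HH)) /(fdisj by_ bx) ij.
  by move: jm; rewrite ij /= ltnn.
have [r r0 hr] := embedding_thicken eh (ball_sub_eball (e0 i)) om hV.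
have [q q0 hq] := embedding_thicken (eg i) (ball_sub_eball (e0 i)) om (@remaining_image
  m i (leqnn m)).
(* [single_ball] wants both embeddings on a ball of the same radius. *)
pose t := Num.min r q.
have t0 : 0 < t by rewrite lt_min r0.
have tr : eball 0 (1 + t) `<=` eball (0 : 'rV[R]_n) (1 + r).
  by move=> x; rewrite !eball0E /= => /lt_le_trans; apply; rewrite lerD2l ge_min lexx.
have tq : eball 0 (1 + t) `<=` eball (0 : 'rV[R]_n) (1 + q).
  by move=> x; rewrite !eball0E /= => /lt_le_trans; apply; rewrite lerD2l ge_min lexx orbT.
have eh' := embedding_sub (@eball_open _ _ _) (fun x h => (hr x (tr x h)).1) eh.
have eg' := embedding_sub (@eball_open _ _ _) (fun x h => (hq x (tq x h)).1) (eg i).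
have [||G [G' [GG Gh]]] := single_ball (ltnW n1) om cm t0 (s0 i) eh' eg'.
- by move=> _ [x /tr /hr [_ ?] <-].
- by move=> _ [x /tq /hq [_ ?] <-].
exists (G \o H), (H' \o G'); split.
  apply: (opdiff_comp k0 hA HH); apply: opdiff_sub GG; by move=> x [].
move=> j; rewrite ltnS leq_eqVlt => /orP[/eqP jm|jm] x bx /=.
  have -> : j = i by apply/val_inj.
  by apply: Gh; move: bx; rewrite /ball closed_eball0E.
(* Balls already placed are outside [remaining m], where [G] is the identity. *)
rewrite Hm // (od_off GG) // => -[_ /(_ j jm)]; apply; by exists x.
Qed.
End Families.
End SingleBall.

(** * From the given balls and diffeomorphisms to pairs of embeddings *)

Lemma C_map_smap (R : realType) (n : nat) k (M N : topologicalType) (A : set (chart R n M))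
    (B : set (chart R n N)) (Om : set M) (f : M -> N) : open Om ->
  C_map k A B Om f -> forall x, Om x -> smap k A B f x.
Proof. by move=> oO /C_mapP; apply. Qed.

Section Assembly.
Variables (R : realType) (n : nat) (k : smoothness).
Hypothesis k0 : k <> Cfin 0.
Variables (M : topologicalType) (A : set (chart R n M)).
Hypothesis (hA : oriented_atlas k A) (hM : hausdorff_space M).
Let E := @euclidean_atlas R n.
Let hE : oriented_atlas k E := @euclidean_oriented_atlas R n k.
Let ball : set 'rV[R]_n := closed_eball 0 1.

Lemma C_diffeo_embedding e (F : 'rV[R]_n -> M) : 0 < e ->
  C_diffeo k E A (eball 0 (1 + e)) F ->
  exists s F', s != 0 /\ embedding k A (eball 0 (1 + e)) s F F'.
Proof.
move=> e0 [oO oI CF [F' FK CF']].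
have [|||x Ox|x Ox|x Ox|s s0 ef] := @embedding_sign R n k k0 M A hA (eball 0 (1 + e)) F F'.
- exact: eball_open.
- by apply: eball_connected; rewrite addr_gt0.
- exact: oI.
- exact: C_map_smap oO CF x Ox.
- by apply: (C_map_smap oI CF'); exists x.
- by apply: FK; rewrite inE.
by exists s, F'.
Qed.

(** The target is parametrised by [F o f], extended past the unit ball, so carrying [f] to [g]
    pointwise reproduces [F] on [D]. A common sign [s] encodes that [F] preserves orientation. *)
Record ball_pair U (D : set M) (F : M -> M) (e s : R) (f g : 'rV[R]_n ->
  M) (f' g' : M -> 'rV[R]_n) : Prop :=
  BallPair {
  bp_gt0 : 0 < e;
  bp_sign : s != 0;
  bp_f : embedding k A (eball 0 (1 + e)) s f f';
  bp_g : embedding k A (eball 0 (1 + e)) s g g';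
  bp_fU : f @` eball 0 (1 + e) `<=` U;
  bp_gU : g @` eball 0 (1 + e) `<=` U;
  bp_D : f @` ball = D;
  bp_F : forall x, ball x -> g x = F (f x)
}.

(** Openness comes from the continuous inverse on the open image of [V]. *)
Lemma C_diffeo_open_image V (G : M -> M) W : C_diffeo k A A V G -> open W ->
  W `<=` V -> open (G @` W).
Proof.
move=> [oV oI _ [G' GK CG']] oW WV; apply: open_at => _ [x Wx <-].
have h1 : nbhs (G x) (G @` V) by apply: open_nbhs_nbhs; split=> //; exists x => //;
  exact: WV.
have h2 : nbhs (G x) (G' @^-1` W).
  have [c _] := CG'; apply: (c (G x)); first by exists x => //; exact: WV.
  by rewrite GK ?inE; [exact: open_nbhs_nbhs|exact: WV].
apply: filterS2 h1 h2 => _ [z Vz <-] /=; rewrite GK ?inE // => Wz.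
by exists z.
Qed.

Lemma ball_pair_exists U (D : set M) (F : M -> M) : open U -> C_closed_ball k A D ->
  op_C_diffeo_closed k A A D F -> D `<=` U -> F @` D `<=` U ->
  exists e s f g f' g', ball_pair U D F e s f g f' g'.
Proof.
move=> oU [cD [e [f [e0 Cf fD]]]] [V [G [DV CG FG oG]]] DU FU.
have [s [f' [s0 ef]]] := C_diffeo_embedding e0 Cf.
have [oV oI CmG [G' GK CmG']] := CG.
have sG x : V x -> smap k A A G x by exact: (C_map_smap oV CmG).
have sG' x : V x -> smap k A A G' (G x).
  by move=> Vx; apply: (C_map_smap oI CmG'); exists x.
(* Where the extension [G] is defined and both source and image stay in [U]; the collar is chosen
   inside it. *)
pose W := V `&` U `&` G @^-1` U.
have oW : open W.
  apply: open_at => x [[Vx Ux] GUx]; apply: filterI.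
    by apply: filterI; exact: open_nbhs_nbhs.
  by have [c _] := sG x Vx; apply: c; exact: open_nbhs_nbhs.
have fW : f @` closed_eball 0 1 `<=` W.
  rewrite fD => x Dx; split; first by split; [exact: DV|exact: DU].
  by rewrite /preimage /= -FG ?inE //; apply: FU; exists x.
have [r r0 hr] := embedding_thicken ef (ball_sub_eball e0) oW fW.
have ef1 := embedding_sub (@eball_open _ _ _) (fun x h => (hr x h).1) ef.
have fV x : eball 0 (1 + r) x -> V (f x) by move=> /hr [_ [[]]].
have [|||x Ox|x Ox|x Ox|t t0 eg] :=
  @embedding_sign R n k k0 M A hA (eball 0 (1 + r)) (G \o f) (f' \o G').
- exact: eball_open.
- by apply: eball_connected; rewrite addr_gt0.
- rewrite -image_comp; apply: (C_diffeo_open_image CG); first exact: em_img ef1.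
  by move=> _ [x /fV Vx <-].
- by apply: (smap_comp hA (em_smooth ef1 Ox)); apply: sG; exact: fV.
- have Vx := fV x Ox; rewrite /=; apply: (smap_comp hA (sG' _ Vx)).
  by rewrite GK ?inE //; exact: em_smooth_inv ef1 _ Ox.
- by rewrite /= GK ?inE; [exact: em_K ef1 _ Ox|exact: fV].
have O0 : eball 0 (1 + r) (0 : 'rV[R]_n) by rewrite eball0E /= enorm0 addr_gt0.
(* Signs are constant on the ball, so comparing at 0 suffices; [f 0] lies in [D], where [G]
   preserves orientation. *)
have st : 0 < t * s.
  apply: (sgnat_unique hE hA (em_sign eg O0)).
  rewrite -[s]mulr1; apply: (sgnat_comp k0 hA (em_smooth ef1 O0) (sG _ (fV _ O0))
    (em_sign ef1 O0)).
  have Df0 : D (f 0) by rewrite -fD; exists 0 => //; rewrite closed_eball0E /= enorm0.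
  by move=> phi psi Ap Bp dx dGx; rewrite mul1r; exact: oG.
have eg1 : embedding k A (eball 0 (1 + r)) s (G \o f) (f' \o G').
  case: eg => h1 h2 h3 h4 h5 h6; split => // x Ox; apply: sgnat_scale st _; exact: h6.
exists r, s, f, (G \o f), f', (f' \o G'); split => //.
- by move=> _ [x /hr [_ [[]]] _ ? _ <-].
- by move=> _ [x /hr [_ [_]] ? <-].
- by move=> x bx /=; rewrite FG // inE -fD; exists x.
Qed.
End Assembly.

Lemma ambient_extension (R : realType) (n : nat) (k : smoothness)
    (M : topologicalType) (A : set (chart R n M))
    (l : nat) (D D' : 'I_l -> set M) (Fs : 'I_l -> M -> M) (U : set M) :
  (2 <= n)%N -> k <> Cfin 0 -> is_oriented_manifold k A ->
  (forall i, C_closed_ball k A (D i)) ->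
  trivIset [set: 'I_l] D -> trivIset [set: 'I_l] D' ->
  (forall i, op_C_diffeo_closed k A A (D i) (Fs i)) -> (forall i, Fs i @` D i = D' i) ->
  open U -> connected U -> (forall i, D i `<=` U) -> (forall i, D' i `<=` U) ->
  exists F : M -> M,
      [/\ C_diffeo k A A [set: M] F, F @` [set: M] = [set: M],
          forall i, {in D i, F =1 Fs i} &
          {in ~` U, F =1 id}].
Proof.
move=> n1 k0 hMf hD tD tD' hF FD' oU cU DU D'U.
have hA := oriented_manifold_atlas hMf; have hM := manifold_hausdorff hMf.
(* The data of a pair are packed into one tuple, so that a single use of choice gives all the
   families. *)
have H1 i : exists d : (R * R) * (('rV[R]_n -> M) * ('rV[R]_n -> M)) * ((M ->
  'rV[R]_n) * (M -> 'rV[R]_n)),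
    ball_pair k A U (D i) (Fs i) d.1.1.1 d.1.1.2 d.1.2.1 d.1.2.2 d.2.1 d.2.2.
  have [|e [s [f [g [f' [g' h]]]]]] := ball_pair_exists k0 hA oU (hD i) (hF i) (DU i).
    by rewrite FD'; exact: D'U.
  by exists ((e, s), (f, g), (f', g')).
have [d hd] := choice H1; move=> {H1}.
have [||||||||H [H' [HH Hfg]]] := @move_balls R n k k0 M A hA hM U l
  (fun i => (d i).1.1.1) (fun i => (d i).1.1.2) n1 oU cU _ _
  (fun i => (d i).1.2.2) (fun i => (d i).2.2) _ _ _
  (fun i => (d i).1.2.1) (fun i => (d i).2.1) _ _ _ l (leqnn l).
all: try by move=> i; case: (hd i).
- move=> i j x y bx by_ E; apply: tD' => //; exists ((d i).1.2.2 x); split.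
    by rewrite -FD' (bp_F (hd i)) //; exists ((d i).1.2.1 x) => //;
      rewrite -(bp_D (hd i)); exists x.
  by rewrite E -FD' (bp_F (hd j)) //; exists ((d j).1.2.1 y) => //;
    rewrite -(bp_D (hd j)); exists y.
- move=> i j x y bx by_ E; apply: tD => //; exists ((d i).1.2.1 x); split.
    by rewrite -(bp_D (hd i)); exists x.
  by rewrite E -(bp_D (hd j)); exists y.
have Hsurj : H @` [set: M] = [set: M].
  by rewrite predeqE => x; split=> // _; exists (H' x) => //; exact: od_invK HH _.
exists H; split => //.
- split; [exact: openT|by rewrite Hsurj; exact: openT| |].
    by apply/C_mapP => [|x _]; [exact: openT|exact: od_smooth HH x].
  exists H'; first by move=> x _; exact: od_K HH x.
  by rewrite Hsurj; apply/C_mapP => [|x _]; [exact: openT|exact: od_smooth_inv HH x].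
- move=> i x; rewrite inE -(bp_D (hd i)) => -[z bz <-].
  by rewrite (Hfg i (ltn_ord i) z bz) (bp_F (hd i)).
- by move=> x; rewrite inE => Ux; exact: od_off HH x Ux.
Qed.
Theorem theorem1p4 (R : realType) (n : nat) (k : smoothness)
    (M : topologicalType) (A : set (chart R n M))
    (l : nat) (D D' : 'I_l -> set M) (Fs : 'I_l -> M -> M)
    (n_ge2 : (2 <= n)%N)
    (k_pos : k <> Cfin 0)
    (M_manifold : is_oriented_manifold k A)
    (M_connected : connected [set: M])
    (D_ball : forall i, C_closed_ball k A (D i))
    (D'_ball : forall i, C_closed_ball k A (D' i))
    (D_disj : trivIset [set: 'I_l] D)
    (D'_disj : trivIset [set: 'I_l] D')
    (Fs_diffeo : forall i, op_C_diffeo_closed k A A (D i) (Fs i))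
    (Fs_surj : forall i, Fs i @` D i = D' i) :
  (exists F : M -> M,
    [/\ C_diffeo k A A [set: M] F, F @` [set: M] = [set: M] &
        forall i, {in D i, F =1 Fs i}]) /\
  (forall U : set M, open U -> connected U ->
    (forall i, D i `<=` U) -> (forall i, D' i `<=` U) ->
    exists F : M -> M,
      [/\ C_diffeo k A A [set: M] F, F @` [set: M] = [set: M],
          forall i, {in D i, F =1 Fs i} &
          {in ~` U, F =1 id}]).
Proof.
have ext := fun U => @ambient_extension R n k M A l D D' Fs U n_ge2 k_pos M_manifold D_ball
  D_disj D'_disj Fs_diffeo Fs_surj.
split; last by move=> U; exact: ext.
have [||||F [h1 h2 h3 _]] := ext [set: M]; [exact: openT|exact: M_connected|by []|by []|].
by exists F.
Qed.
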